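(* Let $p \in [1, \infty)$, let $G$ be a second countable locally compact group, and let $(G, A, \alpha)$ be an isometric $G$-$L^p$ operator algebra such that $A$ is nondegenerately $\sigma$-finitely representable. Then: (1) There is a homomorphism $\iota_{\mathrm r} \colon C_{\mathrm c}(G, A, \alpha) \to F^p_{\mathrm r}(G, A, \alpha)$ such that whenever $(X, \mathcal B, \mu)$ is a $\sigma$-finite measure space and $(v, \pi)$ is a nondegenerate contractive regular covariant representation of $(G, A, \alpha)$ on $L^p(X, \mu)$, there is a unique contractive representation $\rho_{v, \pi} \colon F^p_{\mathrm r}(G, A, \alpha) \to L(L^p(X, \mu))$ such that $\rho_{v, \pi} \circ \iota_{\mathrm r} = v \ltimes \pi$. (2) For every $a \in F^p_{\mathrm r}(G, A, \alpha)$, we have $\|a\| = \sup \|\rho_{v, \pi}(a)\|$, the supremum being over all nondegenerate $\sigma$-finite contractive regular covariant representations $(v, \pi)$ of $(G, A, \alpha)$. (3) The homomorphism $\iota_{\mathrm r}$ of (1) has dense range.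
   Context: $L(E)$ is the algebra of bounded operators on a Banach space $E$. An $L^p$ operator algebra is a Banach algebra (not necessarily unital) isometrically isomorphic to a norm closed subalgebra of $L(L^p(X,\mu))$ for some measure space $(X,\mathcal B,\mu)$. A representation of $A$ on $L^p(X,\mu)$ is a continuous homomorphism $\pi\colon A\to L(L^p(X,\mu))$; it is contractive if $\|\pi(a)\|\le\|a\|$ for all $a$, isometric if $\|\pi(a)\|=\|a\|$ for all $a$, $\sigma$-finite if $\mu$ is $\sigma$-finite, and nondegenerate if the span of $\{\pi(a)\xi\}$ is dense. $A$ is nondegenerately $\sigma$-finitely representable if it has a nondegenerate $\sigma$-finite isometric representation. An isometric $G$-$L^p$ operator algebra $(G,A,\alpha)$ is an $L^p$ operator algebra $A$ with a homomorphism $g\mapsto\alpha_g$ from $G$ to the group of isometric automorphisms of $A$ such that $g\mapsto\alpha_g(a)$ is continuous for every $a\in A$. A covariant representation of $(G,A,\alpha)$ on $L^p(X,\mu)$ is a pair $(v,\pi)$ of a strongly continuous representation $g\mapsto v_g$ of $G$ by invertible bounded operators and a representation $\pi$ of $A$, both on $L^p(X,\mu)$, with $\pi(\alpha_g(a))=v_g\pi(a)v_g^{-1}$. $\nu$ is a left Haar measure on $G$. Given a contractive representation $\pi_0\colon A\to L(L^p(X_0,\mu_0))$, the associated regular covariant representation $(v,\pi)$ acts on $L^p(G\times X_0,\nu\times\mu_0)$ by $(v_g\xi)(h,x)=\xi(g^{-1}h,x)$ and, for $\xi\in C_{\mathrm c}(G,L^p(X_0,\mu_0))$ (a dense subspace),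 $(\pi(a)\xi)(h)=\pi_0(\alpha_h^{-1}(a))(\xi(h))$. Covariant representations so obtained are called contractive regular covariant representations; such a one is called nondegenerate or $\sigma$-finite if $\pi_0$ is. $C_{\mathrm c}(G,A,\alpha)$ is the space of compactly supported continuous functions $G\to A$ with product $(ab)(g)=\int_G a(h)\alpha_h(b(h^{-1}g))\,d\nu(h)$, and $(v\ltimes\pi)(a)\xi=\int_G\pi(a(g))v_g\xi\,d\nu(g)$ for $a\in C_{\mathrm c}(G,A,\alpha)$. The reduced $L^p$ operator crossed product $F^p_{\mathrm r}(G,A,\alpha)$ is the Hausdorff completion of $C_{\mathrm c}(G,A,\alpha)$ in the seminorm $a\mapsto\sup\|(v\ltimes\pi)(a)\|$, the supremum being over all regular covariant representations $(v,\pi)$ coming from nondegenerate $\sigma$-finite contractive representations $\pi_0$ of $A$. *)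

(* Defs.v *)
From HB Require Import structures.
From mathcomp Require Import all_boot all_order all_algebra.
From mathcomp.real_closed Require Import complex.
From mathcomp Require Import ring lra.
From mathcomp Require Import all_classical all_reals all_analysis.
From mathcomp Require Import measurable_realfun.
Set Implicit Arguments.
Unset Strict Implicit.
Unset Printing Implicit Defensive.
Import Order.TTheory GRing.Theory Num.Theory.
Import numFieldNormedType.Exports.
Local Open Scope classical_set_scope.
Local Open Scope ring_scope.
Local Open Scope complex_scope.
Local Open Scope quotient_scope.

Section rnorm.
Variables (R : realType) (V : normedZmodType R[i]).
Implicit Types x y : V.

Definition rnorm x : R := complex.Re `|x|.

Lemma rnormE x : (rnorm x)%:C = `|x|.
Proof. by rewrite /rnorm RRe_real. Qed.

Lemma rnorm_ge0 x : 0 <= rnorm x.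
Proof. by rewrite -ler0c rnormE normr_ge0. Qed.

Lemma rnorm_eq0 x : rnorm x = 0 -> x = 0.
Proof. by move=> x0; apply/normr0_eq0; rewrite -rnormE x0. Qed.

Lemma rnorm0 : rnorm 0 = 0.
Proof. by rewrite /rnorm normr0. Qed.

Lemma rnormD x y : rnorm (x + y) <= rnorm x + rnorm y.
Proof. by rewrite -lecR rmorphD/= !rnormE ler_normD. Qed.

Lemma rnormB x y : rnorm (x - y) = rnorm (y - x).
Proof. by rewrite /rnorm distrC. Qed.

Lemma rnorm_tri z x y : rnorm (x - y) <= rnorm (x - z) + rnorm (z - y).
Proof. by rewrite -[x - y](subrKA z) rnormD. Qed.

End rnorm.

Lemma rnormM (R : realType) (k l : R[i]) :
  rnorm (k * l) = rnorm k * rnorm l.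
Proof. by apply: complexI; rewrite rmorphM/= !rnormE normrM. Qed.

Lemma rnormZ (R : realType) (V : normedModType R[i]) (k : R[i]) (x : V) :
  rnorm (k *: x) = rnorm k * rnorm x.
Proof. by apply: complexI; rewrite rmorphM/= !rnormE normrZ. Qed.

(* Not necessarily unital normed and Banach algebras. *)
HB.mixin Record NormedModule_isNormedAlg (K : numFieldType) A
    & NormedModule K A := {
  bmul : A -> A -> A;
  bmulA : associative bmul;
  bmulDl : left_distributive bmul +%R;
  bmulDr : right_distributive bmul +%R;
  bmulZl : forall (k : K) a b, bmul (k *: a) b = k *: bmul a b;
  bmulZr : forall (k : K) a b, bmul a (k *: b) = k *: bmul a b;
  bnormM : forall a b, `|bmul a b| <= `|a| * `|b|
}.

#[short(type="normedAlgType")]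
HB.structure Definition NormedAlg (K : numFieldType) :=
  {A of NormedModule K A & NormedModule_isNormedAlg K A}.

#[short(type="banachAlgType")]
HB.structure Definition BanachAlg (K : numFieldType) :=
  {A of NormedAlg K A & CompleteNormedModule K A}.

Record seminorm (R : realType) (V : lmodType R[i]) := Seminorm {
  seminorm_fun :> V -> R;
  seminormD : forall x y,
    seminorm_fun (x + y) <= seminorm_fun x + seminorm_fun y;
  seminormZ : forall (k : R[i]) x,
    seminorm_fun (k *: x) = rnorm k * seminorm_fun x }.

Section seminorm_theory.
Variables (R : realType) (V : lmodType R[i]) (N : seminorm V).

Lemma seminorm0 : N 0 = 0.
Proof. by rewrite -(scale0r (0 : V)) seminormZ rnorm0 mul0r. Qed.

Lemma seminormN x : N (- x) = N x.
Proof.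
rewrite -scaleN1r seminormZ; suff -> : rnorm (-1 : R[i]) = 1 by rewrite mul1r.
by apply: complexI; rewrite rnormE normrN1.
Qed.

Lemma seminorm_ge0 x : 0 <= N x.
Proof.
have := seminormD N x (- x); rewrite subrr seminorm0 seminormN.
by rewrite -mulr2n pmulrn_lge0.
Qed.

Lemma seminormB x y : N (x - y) = N (y - x).
Proof. by rewrite -seminormN opprB. Qed.

Lemma seminorm_tri z x y : N (x - y) <= N (x - z) + N (z - y).
Proof. by rewrite -[x - y](subrKA z) seminormD. Qed.

Lemma seminorm_dist x y : `|N x - N y| <= N (x - y).
Proof.
rewrite ler_norml; apply/andP; split.
  rewrite lerNl opprB lerBlDr seminormB.
  by rewrite -{1}(subrK x y); exact: seminormD.
by rewrite lerBlDr -{1}(subrK y x); exact: seminormD.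
Qed.

Lemma seminorm_null x y : N (x - y) = 0 -> N x = N y.
Proof.
move=> xy; have := seminorm_dist x y; rewrite xy normr_le0 subr_eq0.
by move/eqP.
Qed.

End seminorm_theory.

Section hausdorff_quotient.
Variables (R : realType) (V : lmodType R[i]) (N : seminorm V).

Definition null_rel x y := N (x - y) == 0.

Let null_refl : reflexive null_rel.
Proof. by move=> x; rewrite /null_rel subrr seminorm0. Qed.

Let null_sym : symmetric null_rel.
Proof. by move=> x y; rewrite /null_rel seminormB. Qed.

Let null_trans : transitive null_rel.
Proof.
move=> y x z /eqP xy /eqP yz; rewrite /null_rel eq_le seminorm_ge0 andbT.
by rewrite (le_trans (seminorm_tri N y x z))// xy yz addr0.
Qed.

Canonical null_equiv := EquivRel null_rel null_refl null_sym null_trans.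

Definition hquot := {eq_quot null_rel}.
HB.instance Definition _ := Choice.on hquot.
HB.instance Definition _ := EqQuotient.on hquot.

Lemma hquotP x y : \pi_hquot x = \pi_hquot y <-> N (x - y) = 0.
Proof. by split=> [/eqmodP/eqP//|xy]; apply/eqmodP/eqP. Qed.

Lemma hquotK x : N (repr (\pi_hquot x) - x) = 0.
Proof. by apply/hquotP; rewrite reprK. Qed.

Definition hq_add (a b : hquot) : hquot := \pi_hquot (repr a + repr b).
Definition hq_opp (a : hquot) : hquot := \pi_hquot (- repr a).
Definition hq_scale (k : R[i]) (a : hquot) : hquot := \pi_hquot (k *: repr a).
Definition hq_norm (a : hquot) : R[i] := (N (repr a))%:C.

Lemma hq_addE x y : hq_add (\pi_hquot x) (\pi_hquot y) = \pi_hquot (x + y).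
Proof.
apply/hquotP/eqP; rewrite eq_le seminorm_ge0 andbT.
rewrite opprD addrACA (le_trans (seminormD N _ _))//.
by rewrite !hquotK addr0.
Qed.

Lemma hq_oppE x : hq_opp (\pi_hquot x) = \pi_hquot (- x).
Proof. by apply/hquotP; rewrite -opprD seminormN hquotK. Qed.

Lemma hq_scaleE k x : hq_scale k (\pi_hquot x) = \pi_hquot (k *: x).
Proof. by apply/hquotP; rewrite -scalerBr seminormZ hquotK mulr0. Qed.

Lemma hq_normE x : hq_norm (\pi_hquot x) = (N x)%:C.
Proof. by rewrite /hq_norm (seminorm_null (hquotK x)). Qed.

Lemma hquotW (P : hquot -> Prop) : (forall x, P (\pi_hquot x)) -> forall a, P a.
Proof. by move=> h a; rewrite -(reprK a). Qed.

Let addA : associative hq_add.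
Proof.
elim/hquotW => x; elim/hquotW => y; elim/hquotW => z.
by rewrite !hq_addE addrA.
Qed.

Let addC : commutative hq_add.
Proof. by elim/hquotW => x; elim/hquotW => y; rewrite !hq_addE addrC. Qed.

Let add0 : left_id (\pi_hquot 0) hq_add.
Proof. by elim/hquotW => x; rewrite hq_addE add0r. Qed.

Let addN : left_inverse (\pi_hquot 0) hq_opp hq_add.
Proof. by elim/hquotW => x; rewrite hq_oppE hq_addE addNr. Qed.

HB.instance Definition _ := GRing.isZmodule.Build hquot addA addC add0 addN.

Lemma hquot_piD x y : \pi_hquot x + \pi_hquot y = \pi_hquot (x + y).
Proof. exact: hq_addE. Qed.

Let scaleA k l (a : hquot) : hq_scale k (hq_scale l a) = hq_scale (k * l) a.
Proof. by elim/hquotW: a => x; rewrite !hq_scaleE scalerA. Qed.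

Let scale1 : left_id 1 hq_scale.
Proof. by elim/hquotW => x; rewrite !hq_scaleE scale1r. Qed.

Let scaleDr : right_distributive hq_scale +%R.
Proof.
move=> k; elim/hquotW => x; elim/hquotW => y.
by rewrite hquot_piD !hq_scaleE hquot_piD scalerDr.
Qed.

Let scaleDl (a : hquot) : {morph hq_scale^~ a : k l / k + l}.
Proof.
by move=> k l; elim/hquotW: a => x; rewrite !hq_scaleE hquot_piD scalerDl.
Qed.

HB.instance Definition _ := GRing.Zmodule_isLmodule.Build R[i] hquot
  scaleA scale1 scaleDr scaleDl.

Lemma hquot_piZ k x : k *: \pi_hquot x = \pi_hquot (k *: x).
Proof. exact: hq_scaleE. Qed.

Let normD (a b : hquot) : hq_norm (a + b) <= hq_norm a + hq_norm b.
Proof.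
elim/hquotW: a => x; elim/hquotW: b => y.
by rewrite hquot_piD !hq_normE -rmorphD lecR seminormD.
Qed.

Let normZ (k : R[i]) (a : hquot) : hq_norm (k *: a) = `|k| * hq_norm a.
Proof.
elim/hquotW: a => x.
by rewrite hquot_piZ !hq_normE seminormZ rmorphM/= rnormE.
Qed.

Let norm0 (a : hquot) : hq_norm a = 0 -> a = 0.
Proof.
elim/hquotW: a => x; rewrite hq_normE => /complexI x0.
by apply/hquotP; rewrite subr0.
Qed.

HB.instance Definition _ := Lmodule_isNormed.Build R[i] hquot normD normZ norm0.

Lemma hquot_norm x : `|\pi_hquot x| = (N x)%:C.
Proof. exact: hq_normE. Qed.

Lemma hquot_rnorm x : rnorm (\pi_hquot x) = N x.
Proof. by rewrite /rnorm hquot_norm. Qed.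

Lemma hquot_piN x : - \pi_hquot x = \pi_hquot (- x).
Proof. exact: hq_oppE. Qed.

Lemma hquot_piB x y : \pi_hquot x - \pi_hquot y = \pi_hquot (x - y).
Proof. by rewrite hquot_piN hquot_piD. Qed.

End hausdorff_quotient.

(* The Hausdorff completion of a seminormed space: Cauchy sequences, with the
   limit seminorm, modulo null sequences. *)
Section completion.
Variables (R : realType) (V : lmodType R[i]) (N : seminorm V).
Implicit Types u v : nat -> V.

Definition cauchy_seq u := forall e : R, 0 < e -> exists k : nat,
  forall m n, (k <= m)%N -> (k <= n)%N -> N (u m - u n) < e.

Definition cauchy_pred : {pred nat -> V} := [pred u | `[< cauchy_seq u >]].

Let cauchy_submod : submod_closed cauchy_pred.
Proof.
split.
  by apply/asboolP => e e0; exists 0%N => m n _ _; rewrite subrr seminorm0.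
move=> k u v /asboolP cu /asboolP cv; apply/asboolP => e e0.
have k0 : 0 < rnorm k + 1 by rewrite ltr_wpDl// rnorm_ge0.
have [a ha] := cu (e / 2 / (rnorm k + 1)) (divr_gt0 (divr_gt0 e0 (ltr0Sn _ 1)) k0).
have [b hb] := cv (e / 2) (divr_gt0 e0 (ltr0Sn _ 1)).
exists (maxn a b) => m n; rewrite !geq_max => /andP[am bm] /andP[an bn].
have -> : (k *: u + v) m - (k *: u + v) n =
    k *: (u m - u n) + (v m - v n).
  by rewrite scalerBr opprD addrACA.
rewrite (le_lt_trans (seminormD N _ _))// (splitr e) ler_ltD ?hb//.
rewrite seminormZ (le_trans (ler_wpM2l (rnorm_ge0 _) (ltW (ha _ _ am an))))//.
rewrite mulrA ler_pdivrMr// mulrC ler_wpM2l ?lerDl//.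
by rewrite divr_ge0// ltW.
Qed.

HB.instance Definition _ := GRing.isSubmodClosed.Build R[i] (nat -> V)
  cauchy_pred cauchy_submod.

Record cseq := Cseq { cseq_val :> nat -> V; _ : cseq_val \in cauchy_pred }.
HB.instance Definition _ := [isSub for cseq_val].
HB.instance Definition _ := [Choice of cseq by <:].
HB.instance Definition _ := [SubChoice_isSubLmodule of cseq by <:].

Lemma cseqP (u : cseq) : cauchy_seq u.
Proof. by case: u => u /= /asboolP. Qed.

Definition clim (u : cseq) : R := limn (fun n => N (u n)).

Lemma cvg_clim (u : cseq) : (fun n => N (u n)) @ \oo --> clim u.
Proof.
apply/cvg_ex; suff : cvgn (fun n => N (u n)) by move=> /cvg_ex.
apply/cauchy_cvgP/cauchyP => e e0.
have [k hk] := cseqP u e0; exists (N (u k)), k => // n /= kn.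
by rewrite /ball/= (le_lt_trans (seminorm_dist N _ _))// hk.
Qed.

Lemma clim_le (u : cseq) (g : nat -> R) c :
  (forall n, N (u n) <= g n) -> g @ \oo --> c -> clim u <= c.
Proof.
move=> ug gc; apply: (ler_cvg_to (@cvg_clim u) gc).
by apply: nearW => n; exact: ug.
Qed.

Lemma clim_eq0 (u : cseq) : (forall n, N (u n) = 0) -> clim u = 0.
Proof.
move=> u0; apply: (cvg_unique (@norm_hausdorff _ _) (@cvg_clim u)) => /=.
by under eq_fun do rewrite u0; exact: cvg_cst.
Qed.

Let climD (u v : cseq) : clim (u + v) <= clim u + clim v.
Proof.
apply: (clim_le (g := fun n => N (u n) + N (v n))).
  by move=> n; exact: seminormD.
by apply: cvgD; exact: cvg_clim.
Qed.

Let climZ (k : R[i]) (u : cseq) : clim (k *: u) = rnorm k * clim u.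
Proof.
apply: (cvg_unique (@norm_hausdorff _ _) (@cvg_clim (k *: u))) => /=.
under eq_fun do rewrite seminormZ.
by apply: cvgMr; exact: cvg_clim.
Qed.

Definition cseminorm := Seminorm climD climZ.

Definition completion := hquot cseminorm.
HB.instance Definition _ := NormedModule.on completion.

Let cst_cauchy (x : V) : (fun=> x) \in cauchy_pred.
Proof.
by apply/asboolP => e e0; exists 0%N => m n _ _; rewrite subrr seminorm0.
Qed.

Definition to_completion (x : V) : completion :=
  \pi_(hquot cseminorm) (Cseq (cst_cauchy x)).

Let to_completion_linear : linear to_completion.
Proof.
move=> k x y; rewrite /to_completion hquot_piZ hquot_piD; congr \pi.
exact: val_inj.
Qed.

HB.instance Definition _ := GRing.isLinear.Build R[i] V completion _
  to_completion to_completion_linear.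

Lemma to_completion_norm x : rnorm (to_completion x) = N x.
Proof.
rewrite hquot_rnorm/=; apply: (cvg_unique (@norm_hausdorff _ _) (@cvg_clim _)) => /=.
exact: cvg_cst.
Qed.

Lemma cauchy_approx (u : cseq) (e : R) (k : nat) :
  (forall n, (k <= n)%N -> N (u n - u k) <= e) ->
  rnorm (\pi_(hquot cseminorm) u - to_completion (u k)) <= e.
Proof.
move=> h; rewrite /to_completion hquot_piB hquot_rnorm/=.
apply: (ler_cvg_to (@cvg_clim _) (cvg_cst e)).
by near=> n => /=; apply: h; near: n; exact: nbhs_infty_ge.
Unshelve. all: by end_near. Qed.

Lemma completion_complete (F : set_system completion) :
  ProperFilter F -> cauchy F -> cvg F.
Proof.
move=> FF /cauchyP Fc.
pose e n : R := n.+1%:R^-1.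
have e0 n : 0 < e n by rewrite invr_gt0.
have e0C n : 0 < (e n)%:C by rewrite (ltcR 0).
have /choice[x Fx] n : exists x, F (ball x (e n)%:C) by exact: Fc.
have xx n m : rnorm (x n - x m) <= e n + e m.
  have [z [/= zn zm]] := @filter_ex _ _ FF _ (filterI (Fx n) (Fx m)).
  rewrite -lecR rnormE rmorphD/= -(subrKA z) (le_trans (ler_normD _ _))//.
  move: zn zm; rewrite -ball_normE/= => /ltW zn /ltW zm.
  by rewrite lerD// distrC.
have /choice[k hk] n : exists k : nat, forall m, (k <= m)%N ->
    N (repr (x n) m - repr (x n) k) <= e n.
  have [k hk] := cseqP (repr (x n)) (e0 n).
  by exists k => m km; exact/ltW/hk.
pose w n := repr (x n) (k n).
have xw n : rnorm (x n - to_completion (w n)) <= e n.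
  by rewrite -{1}[x n]reprK; apply: cauchy_approx => m; exact: hk.
have ww n m : N (w n - w m) <= (e n + e m) *+ 2.
  rewrite -to_completion_norm linearB/= mulr2n.
  rewrite (le_trans (rnorm_tri (x n) _ _))//.
  rewrite -addrA lerD// 1?rnormB//.
  rewrite (le_trans (rnorm_tri (x m) _ _))// [e n + _]addrC.
  by rewrite lerD// rnormB.
have small (d : R) : 0 < d -> exists K : nat, forall n, (K <= n)%N -> e n < d.
  move=> d0; have [K _ hK] := near_infty_natSinv_lt (PosNum d0).
  by exists K => n Kn; exact: hK.
have w_small (d : R) : 0 < d -> exists K : nat, forall m n,
    (K <= m)%N -> (K <= n)%N -> N (w m - w n) < d.
  move=> d0; have [K hK] := small (d / 4) (divr_gt0 d0 (ltr0Sn _ 3)).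
  exists K => m n Km Kn; rewrite (le_lt_trans (ww m n))//.
  by have := hK _ Km; have := hK _ Kn; lra.
have cw : w \in cauchy_pred by apply/asboolP.
pose W := Cseq cw; apply/cvg_ex; exists (\pi_(hquot cseminorm) W).
apply/cvg_ballP => eps eps0.
have [d d0 deps] : exists2 d : R, 0 < d & eps = d%:C.
  exists (complex.Re eps); first by move: eps0; rewrite ltcE/= => /andP[].
  by rewrite RRe_real// gtr0_real.
have [K1 hK1] := small (d / 4) (divr_gt0 d0 (ltr0Sn _ 3)).
have [K2 hK2] := w_small (d / 4) (divr_gt0 d0 (ltr0Sn _ 3)).
pose n := maxn K1 K2.
have WL : rnorm (\pi_(hquot cseminorm) W - to_completion (w n)) <= d / 4.
  apply: (cauchy_approx (u := W)) => m nm; apply/ltW/hK2.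
    by rewrite (leq_trans _ nm)// leq_maxr.
  by rewrite leq_maxr.
apply: filterS (Fx n) => z; rewrite -ball_normE/= -!rnormE deps !ltcR => xz.
rewrite (le_lt_trans (rnorm_tri (to_completion (w n)) _ _))//.
have := rnorm_tri (x n) (to_completion (w n)) z; rewrite [rnorm (_ - x n)]rnormB.
have := xw n; have := hK1 n (leq_maxl _ _); move: WL xz; lra.
Qed.

HB.instance Definition _ := Uniform_isComplete.Build completion
  completion_complete.

Lemma to_completion_dense (a : completion) (d : R) : 0 < d ->
  exists x, rnorm (a - to_completion x) < d.
Proof.
rewrite -(reprK a) => d0.
have [k hk] := cseqP (repr a) (divr_gt0 d0 (ltr0Sn _ 1)).
exists (repr a k); rewrite (@le_lt_trans _ _ (d / 2))//; last first.
  by rewrite ltr_pdivrMr// ltr_pMr// ltr1n.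
by apply: cauchy_approx => n kn; apply/ltW/hk.
Qed.

End completion.

Section algebra_seminorm.
Variables (R : realType) (V : lmodType R[i]) (mul : V -> V -> V).

(* The ring axioms are only required up to [N]-null vectors: this is what the
   Hausdorff completion needs. *)
Definition is_algebra_seminorm (N : V -> R) : Prop :=
  [/\ forall x y, N (x + y) <= N x + N y,
      forall (k : R[i]) x, N (k *: x) = rnorm k * N x &
      [/\ forall x y, N (mul x y) <= N x * N y,
          forall x y z, N (mul x (mul y z) - mul (mul x y) z) = 0 &
      [/\ forall x y z, N (mul (x + y) z - (mul x z + mul y z)) = 0,
          forall x y z, N (mul x (y + z) - (mul x y + mul x z)) = 0,
          forall (k : R[i]) x y, N (mul (k *: x) y - k *: mul x y) = 0 &
          forall (k : R[i]) x y, N (mul x (k *: y) - k *: mul x y) = 0]]].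

Record algebra_seminorm := AlgebraSeminorm {
  algebra_seminorm_fun :> V -> R;
  _ : `[< is_algebra_seminorm algebra_seminorm_fun >] }.
HB.instance Definition _ := [isSub for algebra_seminorm_fun].

Let zero_is_algebra_seminorm : `[< is_algebra_seminorm (fun=> 0) >].
Proof.
apply/asboolP; split; [by move=> *; rewrite addr0|by move=> *; rewrite mulr0|].
by split => [|//|]; [move=> *; rewrite mulr0|split].
Qed.

Definition zero_seminorm := AlgebraSeminorm zero_is_algebra_seminorm.

Lemma algebra_seminormP (N : algebra_seminorm) : is_algebra_seminorm N.
Proof. by case: N => N /= /asboolP. Qed.

Definition to_seminorm (N : algebra_seminorm) : seminorm V :=
  let: And3 D Z _ := algebra_seminormP N in Seminorm D Z.

Lemma to_seminormE N : to_seminorm N = N :> (V -> R).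
Proof. by rewrite /to_seminorm; case: algebra_seminormP. Qed.

End algebra_seminorm.

Section algebra_completion.
Variables (R : realType) (V : lmodType R[i]) (mul : V -> V -> V).
Variable M : algebra_seminorm mul.
Let N := to_seminorm M.

Let NM x y : N (mul x y) <= N x * N y.
Proof. by rewrite to_seminormE; case: (algebra_seminormP M) => _ _ []. Qed.

Let NA x y z : N (mul x (mul y z) - mul (mul x y) z) = 0.
Proof. by rewrite to_seminormE; case: (algebra_seminormP M) => _ _ []. Qed.

Let NDl x y z : N (mul (x + y) z - (mul x z + mul y z)) = 0.
Proof. by rewrite to_seminormE; case: (algebra_seminormP M) => _ _ [] _ _ []. Qed.

Let NDr x y z : N (mul x (y + z) - (mul x y + mul x z)) = 0.
Proof. by rewrite to_seminormE; case: (algebra_seminormP M) => _ _ [] _ _ []. Qed.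

Let NZl (k : R[i]) x y : N (mul (k *: x) y - k *: mul x y) = 0.
Proof. by rewrite to_seminormE; case: (algebra_seminormP M) => _ _ [] _ _ []. Qed.

Let NZr (k : R[i]) x y : N (mul x (k *: y) - k *: mul x y) = 0.
Proof. by rewrite to_seminormE; case: (algebra_seminormP M) => _ _ [] _ _ []. Qed.

Let NBl x y z : N (mul x z - mul y z) <= N (x - y) * N z.
Proof.
rewrite (le_trans _ (NM _ _))// (le_trans (seminorm_tri N (mul (x - y) z + mul y z) _ _))//.
by rewrite -{1}[x](subrK y) NDl add0r addrK.
Qed.

Let NBr x y z : N (mul z x - mul z y) <= N z * N (x - y).
Proof.
rewrite (le_trans _ (NM _ _))// (le_trans (seminorm_tri N (mul z (x - y) + mul z y) _ _))//.
by rewrite -{1}[x](subrK y) NDr add0r addrK.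
Qed.

Let cauchy_bounded (u : cseq N) : exists2 B : R, 0 < B & forall n, N (u n) <= B.
Proof.
have /cvg_ex[/= l ul] : cvgn (fun n => N (u n)).
  by apply/cvg_ex; exists (clim u); exact: cvg_clim.
have [B [Breal hB]] := cvg_seq_bounded (cvgP _ ul).
exists (`|B| + 1); first by rewrite ltr_wpDl.
move=> n; have := hB (`|B| + 1); rewrite (le_lt_trans (ler_norm B)) ?ltrDl//.
by move=> /(_ isT n I); exact: le_trans (ler_norm _).
Qed.

Let cauchy_mul (u v : cseq N) :
  (fun n => mul (u n) (v n)) \in cauchy_pred N.
Proof.
apply/asboolP => e e0.
have [B B0 hB] := cauchy_bounded u; have [C C0 hC] := cauchy_bounded v.
have [a ha] := cseqP u (divr_gt0 (divr_gt0 e0 (ltr0Sn _ 1)) C0).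
have [b hb] := cseqP v (divr_gt0 (divr_gt0 e0 (ltr0Sn _ 1)) B0).
exists (maxn a b) => m n; rewrite !geq_max => /andP[am bm] /andP[an bn].
rewrite (le_lt_trans (seminorm_tri N (mul (u n) (v m)) _ _))// (splitr e).
rewrite ltr_leD//.
  rewrite (le_lt_trans (NBl _ _ _))// (le_lt_trans (ler_wpM2l _ (hC m)))//.
    exact: seminorm_ge0.
  by rewrite -ltr_pdivlMr// ha.
rewrite (le_trans (NBr _ _ _))// (le_trans (ler_wpM2r _ (hB n)))//.
  exact: seminorm_ge0.
by rewrite mulrC -ler_pdivlMr// ltW// hb.
Qed.

Definition cmul (u v : cseq N) : cseq N := Cseq (cauchy_mul u v).

Definition completion_mul (a b : completion N) : completion N :=
  \pi_(hquot (cseminorm N)) (cmul (repr a) (repr b)).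

Let cN := cseminorm N.

Let cmul_wd (u u' v v' : cseq N) : cN (u - u') = 0 -> cN (v - v') = 0 ->
  cN (cmul u v - cmul u' v') = 0.
Proof.
move=> uu' vv'; apply/eqP; rewrite eq_le seminorm_ge0 andbT.
apply: (clim_le (g := fun n => N (u n - u' n) * N (v n) + N (u' n) * N (v n - v' n))).
  move=> n; rewrite (le_trans (seminorm_tri N (mul (u' n) (v n)) _ _))//.
  by rewrite lerD ?NBl ?NBr.
have -> : 0 = 0 * clim v + clim u' * 0 by rewrite mul0r mulr0 addr0.
apply: cvgD; apply: cvgM; try exact: cvg_clim.
  by rewrite -uu'; exact: (@cvg_clim _ _ _ (u - u')).
by rewrite -vv'; exact: (@cvg_clim _ _ _ (v - v')).
Qed.

Let piM (u v : cseq N) :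
  completion_mul (\pi_(hquot cN) u) (\pi_(hquot cN) v) =
  \pi_(hquot cN) (cmul u v).
Proof. by apply/hquotP/cmul_wd; exact: hquotK. Qed.

Let pi_eq (u v : cseq N) : (forall n, N (u n - v n) = 0) ->
  \pi_(hquot cN) u = \pi_(hquot cN) v.
Proof. by move=> uv; apply/hquotP; exact: clim_eq0. Qed.

Let mulA : associative completion_mul.
Proof.
elim/hquotW => x; elim/hquotW => y; elim/hquotW => z.
rewrite (piM y z) (piM x y) (piM x) (piM _ z).
by apply: pi_eq => n; exact: NA.
Qed.

Let mulDl : left_distributive completion_mul +%R.
Proof.
elim/hquotW => x; elim/hquotW => y; elim/hquotW => z.
rewrite hquot_piD (piM x z) (piM y z) hquot_piD (piM _ z).
by apply: pi_eq => n; exact: NDl.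
Qed.

Let mulDr : right_distributive completion_mul +%R.
Proof.
elim/hquotW => x; elim/hquotW => y; elim/hquotW => z.
rewrite hquot_piD (piM x y) (piM x z) hquot_piD (piM x).
by apply: pi_eq => n; exact: NDr.
Qed.

Let mulZl (k : R[i]) a b : completion_mul (k *: a) b = k *: completion_mul a b.
Proof.
elim/hquotW: a => x; elim/hquotW: b => y.
rewrite hquot_piZ (piM x y) hquot_piZ (piM _ y).
by apply: pi_eq => n; exact: NZl.
Qed.

Let mulZr (k : R[i]) a b : completion_mul a (k *: b) = k *: completion_mul a b.
Proof.
elim/hquotW: a => x; elim/hquotW: b => y.
rewrite hquot_piZ (piM x y) hquot_piZ (piM x).
by apply: pi_eq => n; exact: NZr.
Qed.

Let normM a b : `|completion_mul a b| <= `|a| * `|b|.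
Proof.
elim/hquotW: a => x; elim/hquotW: b => y.
rewrite piM !hquot_norm -rmorphM lecR.
apply: (clim_le (g := fun n => N (x n) * N (y n))) => [n|]; first exact: NM.
by apply: cvgM; exact: cvg_clim.
Qed.

Definition algebra_completion := completion N.
HB.instance Definition _ := CompleteNormedModule.on algebra_completion.
HB.instance Definition _ := NormedModule_isNormedAlg.Build R[i]
  algebra_completion mulA mulDl mulDr mulZl mulZr normM.

Lemma to_completionM x y :
  to_completion N (mul x y) =
  bmul (to_completion N x : algebra_completion) (to_completion N y).
Proof. by rewrite /to_completion [RHS]piM; apply: pi_eq => n; rewrite subrr seminorm0. Qed.

End algebra_completion.

Section bounded_operators.
Variables (R : realType) (E : normedModType R[i]).

Definition bounded_operator : {pred E -> E} := [pred f : E -> E |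
  `[< linear f /\ exists M : R, forall x, rnorm (f x) <= M * rnorm x >]].

Let bounded_submod : submod_closed bounded_operator.
Proof.
split.
  apply/asboolP; split; first by move=> k x y; rewrite /= scaler0 addr0.
  by exists 0 => x; rewrite mul0r rnorm0.
move=> k f g /asboolP[fl [M hM]] /asboolP[gl [L hL]]; apply/asboolP; split.
  by move=> l x y; rewrite !fctE fl gl !scalerDr !scalerA (mulrC k) addrACA.
exists (rnorm k * M + L) => x; rewrite (le_trans (rnormD _ _))// mulrDl.
by rewrite lerD// rnormZ -mulrA ler_wpM2l ?rnorm_ge0.
Qed.

HB.instance Definition _ := GRing.isSubmodClosed.Build R[i] (E -> E)
  bounded_operator bounded_submod.

Record bop := Bop { bop_fun :> E -> E; _ : bop_fun \in bounded_operator }.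
HB.instance Definition _ := [isSub for bop_fun].
HB.instance Definition _ := [Choice of bop by <:].
HB.instance Definition _ := [SubChoice_isSubLmodule of bop by <:].

Lemma bopP (f : bop) :
  linear f /\ exists M : R, forall x, rnorm (f x) <= M * rnorm x.
Proof. by case: f => f /= /asboolP. Qed.

Lemma bopD (f g : bop) x : (f + g) x = f x + g x. Proof. by []. Qed.
Lemma bopZ k (f : bop) x : (k *: f) x = k *: f x. Proof. by []. Qed.

Definition opnorm (f : E -> E) : R :=
  sup [set rnorm (f x) | x in [set x | rnorm x <= 1]].

Let bop0 (f : bop) : f 0 = 0.
Proof.
have [fl _] := bopP f; have := fl 1 0 0.
rewrite !scale1r addr0 => /eqP.
by rewrite eq_sym -subr_eq0 addrK => /eqP.
Qed.

Let bop_scale (f : bop) k x : f (k *: x) = k *: f x.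
Proof.
by have [fl _] := bopP f; rewrite -[k *: x]addr0 fl bop0 addr0.
Qed.

Let opnorm_ub (f : bop) (x : E) : rnorm x <= 1 -> rnorm (f x) <= opnorm f.
Proof.
move=> x1; apply: ub_le_sup; last by exists x.
have [_ [M hM]] := bopP f; exists `|M| => _ [y /= y1 <-].
rewrite (le_trans (hM y))// (le_trans (ler_norm _))// normrM.
by rewrite ler_piMr// ger0_norm// rnorm_ge0.
Qed.

Let opnorm_least (f : bop) c : (forall x, rnorm x <= 1 -> rnorm (f x) <= c) ->
  opnorm f <= c.
Proof.
move=> h; apply: ge_sup; last by move=> _ [x /= x1 <-]; exact: h.
by exists (rnorm (f 0)), 0 => //=; rewrite rnorm0.
Qed.

Lemma opnorm_ge0 (f : bop) : 0 <= opnorm f.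
Proof. by rewrite (le_trans (rnorm_ge0 (f 0)))// opnorm_ub// rnorm0. Qed.

Lemma le_opnorm (f : bop) x : rnorm (f x) <= opnorm f * rnorm x.
Proof.
have [->|x0] := eqVneq x 0; first by rewrite bop0 rnorm0 mulr0.
have rx : 0 < rnorm x.
  by rewrite lt_neqAle rnorm_ge0 andbT eq_sym; apply: contra_neq x0; exact: rnorm_eq0.
have rnormV : rnorm ((rnorm x)^-1%:C) = (rnorm x)^-1.
  by apply: complexI; rewrite rnormE ger0_norm// (lecR 0) invr_ge0 ltW.
rewrite -ler_pdivrMr// mulrC -rnormV -rnormZ -bop_scale opnorm_ub//.
by rewrite rnormZ rnormV mulVf// gt_eqF.
Qed.

Let normD (f g : bop) : (opnorm (f + g)%R)%:C <= (opnorm f)%:C + (opnorm g)%:C.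
Proof.
rewrite -rmorphD lecR; apply: opnorm_least => x x1.
by rewrite (le_trans (rnormD _ _))// lerD ?opnorm_ub.
Qed.

Let normZ (k : R[i]) (f : bop) : (opnorm (k *: f)%R)%:C = `|k| * (opnorm f)%:C.
Proof.
have le l (g : bop) : opnorm (l *: g)%R <= rnorm l * opnorm g.
  by apply: opnorm_least => x x1; rewrite rnormZ ler_wpM2l ?rnorm_ge0 ?opnorm_ub.
rewrite -rnormE -rmorphM; congr (_%:C).
have [->|k0] := eqVneq k 0.
  apply/eqP; rewrite eq_le scale0r rnorm0 mul0r opnorm_ge0 andbT.
  by have := le 0 f; rewrite scale0r rnorm0 mul0r.
apply/eqP; rewrite eq_le le/=.
have kV : rnorm k * rnorm k^-1 = 1.
  by rewrite -rnormM mulfV//; apply: complexI; rewrite rnormE normr1.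
rewrite -{1}(scale1r f) -(mulVf k0) -scalerA.
rewrite (le_trans (ler_wpM2l (rnorm_ge0 _) (le _ _)))//.
by rewrite mulrA kV mul1r.
Qed.

Let norm0 (f : bop) : (opnorm f)%:C = 0 -> f = 0.
Proof.
move=> /complexI f0; apply/val_inj/funext => x; apply/rnorm_eq0/eqP.
by rewrite eq_le rnorm_ge0 andbT (le_trans (le_opnorm f x))// f0 mul0r.
Qed.

HB.instance Definition _ := Lmodule_isNormed.Build R[i] bop normD normZ norm0.

Lemma bop_rnorm (f : bop) : rnorm f = opnorm f. Proof. by []. Qed.

Let comp_bounded (f g : bop) : (f \o g : E -> E) \in bounded_operator.
Proof.
have [fl _] := bopP f; have [gl _] := bopP g; apply/asboolP; split.
  by move=> k x y; rewrite /= gl fl.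
exists (opnorm f * opnorm g) => x; rewrite (le_trans (le_opnorm f _))// -mulrA.
by rewrite ler_wpM2l ?opnorm_ge0 ?le_opnorm.
Qed.

Definition bop_comp (f g : bop) : bop := Bop (comp_bounded f g).

Let compA : associative bop_comp.
Proof. by move=> f g h; exact: val_inj. Qed.

Let compDl : left_distributive bop_comp +%R.
Proof. by move=> f g h; exact: val_inj. Qed.

Let compDr : right_distributive bop_comp +%R.
Proof.
move=> f g h; apply/val_inj/funext => x /=; have [fl _] := bopP f.
by have := fl 1 (g x) (h x); rewrite !scale1r.
Qed.

Let compZl (k : R[i]) f g : bop_comp (k *: f) g = k *: bop_comp f g.
Proof. exact: val_inj. Qed.

Let compZr (k : R[i]) f g : bop_comp f (k *: g) = k *: bop_comp f g.
Proof. by apply/val_inj/funext => x /=; exact: bop_scale. Qed.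

Let compM f g : `|bop_comp f g| <= `|f| * `|g|.
Proof.
rewrite -!rnormE -rmorphM lecR !bop_rnorm; apply: opnorm_least => x x1.
rewrite (le_trans (le_opnorm f _))// ler_wpM2l ?opnorm_ge0//.
by rewrite opnorm_ub.
Qed.

HB.instance Definition _ := NormedModule_isNormedAlg.Build R[i] bop
  compA compDl compDr compZl compZr compM.

End bounded_operators.

(* The library only has real valued L^p functions; complex ones are taken here,
   with [|f|] measured by the library's [Lnorm]. *)
Section complex_Lp.
Context d (T : measurableType d) (R : realType).
Variables (mu : {measure set T -> \bar R}) (p : R) (p1 : 1 <= p).

Definition cmeasurable (f : T -> R[i]) :=
  measurable_fun setT (fun x => complex.Re (f x)) /\
  measurable_fun setT (fun x => complex.Im (f x)).

Definition cLnorm (f : T -> R[i]) : \bar R :=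
  ('N[mu]_(p%:E)[EFin \o (fun x => rnorm (f x))])%E.

Definition cLfun_pred : {pred T -> R[i]} :=
  [pred f | `[< cmeasurable f /\ (cLnorm f < +oo)%E >]].

Let p1E : (1 <= p%:E)%E. Proof. by rewrite lee_fin. Qed.
Let p0 : 0 < p. Proof. exact: lt_le_trans p1. Qed.

Lemma measurable_rnorm (f : T -> R[i]) : cmeasurable f ->
  measurable_fun setT (fun x => rnorm (f x)).
Proof.
move=> [mr mi].
have -> : (fun x => rnorm (f x)) =
    (fun x => Num.sqrt (complex.Re (f x) ^+ 2 + complex.Im (f x) ^+ 2)).
  by apply/funext => x; rewrite /rnorm normc_def.
apply: (@measurableT_comp _ _ _ _ _ _ (@Num.sqrt R)); last first.
  by apply: measurable_funD; exact: measurable_funX.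
by apply: continuous_measurable_fun; exact: sqrt_continuous.
Qed.

Let le_Lnorm (f g : T -> R) : measurable_fun setT f -> measurable_fun setT g ->
  (forall x, 0 <= f x <= g x) ->
  ('N[mu]_(p%:E)[EFin \o f] <= 'N[mu]_(p%:E)[EFin \o g])%E.
Proof.
move=> mf mg fg; rewrite unlock /Lnorm.
have mp (h : T -> R) : measurable_fun setT h ->
    measurable_fun setT (fun x => (`|(EFin \o h) x| `^ p)%E).
  move=> mh; apply/measurable_EFinP.
  apply: (@measurableT_comp _ _ _ _ _ _ (@powR R ^~ p)) => //.
  exact: measurableT_comp.
apply: gt0_ler_poweR; rewrite ?in_itv/= ?invr_ge0 ?(ltW p0)//.
- by rewrite leey andbT integral_ge0// => x _; rewrite lee_fin powR_ge0.
- by rewrite leey andbT integral_ge0// => x _; rewrite lee_fin powR_ge0.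
apply: ge0_le_integral => //; [exact: mp|exact: mp|].
move=> x _ /=; have /andP[f0 fg'] := fg x.
rewrite lee_fin ge0_ler_powR ?nnegrE ?(ltW p0)//.
by rewrite !ger0_norm// (le_trans f0).
Qed.

Lemma cLnormD (f g : T -> R[i]) : cmeasurable f -> cmeasurable g ->
  (cLnorm (f \+ g)%R <= cLnorm f + cLnorm g)%E.
Proof.
move=> mf mg; have mnf := measurable_rnorm mf; have mng := measurable_rnorm mg.
apply: le_trans (minkowski_EFin mu mnf mng p1).
apply: le_Lnorm; [|exact: measurable_funD|].
  by apply: measurable_rnorm; split; under eq_fun do rewrite raddfD/=;
    apply: measurable_funD; case: mf; case: mg.
by move=> x; rewrite rnorm_ge0/= rnormD.
Qed.

Lemma cLnormZ (k : R[i]) (f : T -> R[i]) : cmeasurable f -> (cLnorm f < +oo)%E ->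
  cLnorm (k \*: f) = ((rnorm k)%:E * cLnorm f)%E.
Proof.
move=> mf ff.
have nf : (fun x => rnorm (f x)) \in @Lfun _ T R mu p%:E.
  by rewrite inE; apply/andP; split; rewrite inE//; exact: measurable_rnorm.
rewrite -[RHS]/((rnorm k)%:E * 'N[mu]_p%:E[EFin \o Lfun_Sub p1E nf])%E.
rewrite -[rnorm k]ger0_norm ?rnorm_ge0// -LnormZ; congr Lnorm.
by apply/funext => x /=; rewrite rnormM.
Qed.

Let cmeasurableD (f g : T -> R[i]) :
  cmeasurable f -> cmeasurable g -> cmeasurable (f \+ g).
Proof.
by move=> [? ?] [? ?]; split; under eq_fun do rewrite raddfD/=;
  exact: measurable_funD.
Qed.

Let cmeasurableZ (k : R[i]) (f : T -> R[i]) :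
  cmeasurable f -> cmeasurable (k \*: f).
Proof.
case: k => a b [mr mi]; split.
  rewrite (_ : (fun _ => _) = (fun x => a * complex.Re (f x) - b * complex.Im (f x))).
    by apply: measurable_funB; apply: measurable_funM.
  by apply/funext => x /=; case: (f x).
rewrite (_ : (fun _ => _) = (fun x => a * complex.Im (f x) + b * complex.Re (f x))).
  by apply: measurable_funD; apply: measurable_funM.
by apply/funext => x /=; case: (f x).
Qed.

Let cLfun_submod : submod_closed cLfun_pred.
Proof.
split.
  apply/asboolP; split; first by split; exact: measurable_cst.
  rewrite /cLnorm (_ : _ \o _ = cst 0%E) ?Lnorm0// ?eqe ?gt_eqF//.
  by apply/funext => x /=; rewrite rnorm0.
move=> k f g /asboolP[mf ff] /asboolP[mg fg]; apply/asboolP; split.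
  by apply: cmeasurableD => //; exact: cmeasurableZ.
rewrite (le_lt_trans (cLnormD (cmeasurableZ k mf) mg))// lte_add_pinfty//.
by rewrite cLnormZ// lte_mul_pinfty// ?lee_fin ?rnorm_ge0.
Qed.

HB.instance Definition _ := GRing.isSubmodClosed.Build R[i] (T -> R[i]^o)
  cLfun_pred cLfun_submod.

Record cLfun := CLfun { cLfun_val :> T -> R[i]^o; _ : cLfun_val \in cLfun_pred }.
HB.instance Definition _ := [isSub for cLfun_val].
HB.instance Definition _ := [Choice of cLfun by <:].
HB.instance Definition _ := [SubChoice_isSubLmodule of cLfun by <:].

Lemma cLfunP (f : cLfun) : cmeasurable f /\ (cLnorm f < +oo)%E.
Proof. by case: f => f /= /asboolP. Qed.

Let cLfin (f : cLfun) : (fine (cLnorm f))%:E = cLnorm f.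
Proof.
rewrite fineK// ge0_fin_numE ?Lnorm_ge0//.
by have [] := cLfunP f.
Qed.

Let nD (f g : cLfun) :
  fine (cLnorm (f + g)) <= fine (cLnorm f) + fine (cLnorm g).
Proof.
rewrite -lee_fin EFinD !cLfin.
by apply: cLnormD; [have [] := cLfunP f|have [] := cLfunP g].
Qed.

Let nZ (k : R[i]) (f : cLfun) :
  fine (cLnorm (k *: f)) = rnorm k * fine (cLnorm f).
Proof.
apply: EFin_inj; rewrite EFinM !cLfin.
by have [mf ff] := cLfunP f; rewrite -cLnormZ.
Qed.

Definition Lp_seminorm : seminorm cLfun := Seminorm nD nZ.

Definition Lp := hquot Lp_seminorm.
HB.instance Definition _ := NormedModule.on Lp.

(* A representative: only meaningful up to [mu]-a.e. equality. *)
Definition Lp_fun (f : Lp) : T -> R[i] := cLfun_val (repr f).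

End complex_Lp.

HB.mixin Record isTopologicalGroup G & Group G & Topological G := {
  mulg_continuous : continuous (fun x : G * G => (x.1 * x.2)%g);
  invg_continuous : continuous (fun x : G => x^-1%g)
}.

#[short(type="topologicalGroupType")]
HB.structure Definition TopologicalGroup :=
  {G of Group G & PointedTopological G & isTopologicalGroup G}.

Definition borel (G : ptopologicalType) := g_sigma_algebraType (@open G).
HB.instance Definition _ (G : ptopologicalType) := Measurable.on (borel G).

(* A nonzero left invariant Radon measure; images [g B] are measurable because
   left translations are homeomorphisms. *)
Definition left_haar (R : realType) (G : topologicalGroupType)
    (nu : {measure set (borel G) -> \bar R}) : Prop :=
  [/\ forall (g : G) (B : set (borel G)), measurable B ->
        nu [set (g * x)%g | x in B] = nu B,
      forall K : set G, compact K -> (nu K < +oo)%E,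
      forall B : set (borel G), measurable B ->
        nu B = ereal_inf [set nu U | U in [set U : set G | open U /\ B `<=` U]],
      forall U : set G, open U ->
        nu U = ereal_sup [set nu K | K in [set K : set G | compact K /\ K `<=` U]] &
      nu setT != 0%E].

Section bochner.
Context d (T : measurableType d) (R : realType).
Variables (mu : {measure set T -> \bar R}) (E : normedModType R[i]).

Definition simple_integrable (s : T -> E) : Prop :=
  [/\ finite_set (range s),
      forall y, measurable (s @^-1` [set y]) &
      forall y, y != 0 -> (mu (s @^-1` [set y]) < +oo)%E].

Definition simple_integral (s : T -> E) : E :=
  \sum_(y \in range s) (fine (mu (s @^-1` [set y])))%:C *: y.

Definition is_bochner_integral (f : T -> E) (I : E) : Prop :=
  exists s : nat -> T -> E,
    [/\ forall n, simple_integrable (s n),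
        forall n, measurable_fun setT (fun x => rnorm (f x - s n x)),
        (\int[mu]_x (rnorm (f x - s n x))%:E)%E @[n --> \oo] --> 0%E &
        simple_integral (s n) @[n --> \oo] --> I].

(* The value is [0] if [f] is not Bochner integrable. *)
Definition bochner_integral (f : T -> E) : E :=
  xget 0 [set I | is_bochner_integral f I].

End bochner.

Section Cc.
Variables (R : realType) (G : topologicalType) (E : normedModType R[i]).

Definition Cc_pred : {pred G -> E} := [pred f |
  `[< continuous (f : G -> E) /\ compact (closure [set g | f g != 0]) >]].

Let Cc_submod : submod_closed Cc_pred.
Proof.
split.
  apply/asboolP; split; first by move=> x; exact: cvg_cst.
  rewrite (_ : [set _ | _] = set0) ?closure0; first exact: compact0.
  by apply/seteqP; split => x //=; rewrite eqxx.
move=> k f g /asboolP[fc fK] /asboolP[gc gK]; apply/asboolP; split.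
  move=> x; apply: cvgD; last exact: gc.
  by apply: cvgZr; exact: fc.
apply: subclosed_compact (compactU fK gK) _; first exact: closed_closure.
rewrite -closureU; apply: closureS => x /=; apply: contraNP => /not_orP[].
move=> /negP/negPn/eqP fx /negP/negPn/eqP gx.
by rewrite -[(_ + _) x]/(k *: f x + g x) fx gx scaler0 addr0.
Qed.

HB.instance Definition _ := GRing.isSubmodClosed.Build R[i] (G -> E)
  Cc_pred Cc_submod.

Record Cc := MkCc { Cc_val :> G -> E; _ : Cc_val \in Cc_pred }.
HB.instance Definition _ := [isSub for Cc_val].
HB.instance Definition _ := [Choice of Cc by <:].
HB.instance Definition _ := [SubChoice_isSubLmodule of Cc by <:].

End Cc.

Section representations.
Variables (R : realType) (A : normedAlgType R[i]).

(* Algebras need not be unital. *)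
Definition homomorphism (B : normedAlgType R[i]) (f : A -> B) : Prop :=
  linear f /\ {morph f : a b / bmul a b}.

Definition representation (E : normedModType R[i]) (pi : A -> bop E) : Prop :=
  homomorphism pi /\ continuous pi.

Definition contractive (E : normedModType R[i]) (pi : A -> bop E) : Prop :=
  forall a, `|pi a| <= `|a|.

Definition isometric (E : normedModType R[i]) (pi : A -> bop E) : Prop :=
  forall a, `|pi a| = `|a|.

Definition linear_span (E : lmodType R[i]) (S : set E) : set E :=
  [set x | exists n (c : 'I_n -> R[i]) (s : 'I_n -> E),
     (forall i, S (s i)) /\ x = \sum_i c i *: s i].

Definition nondegenerate (E : normedModType R[i]) (pi : A -> bop E) : Prop :=
  dense (linear_span [set x : E | exists a xi, x = pi a xi]).

Variables (p : R) (p1 : 1 <= p).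

(* [A] is identified, through an isometric homomorphism, with its range, a norm
   closed subalgebra. *)
Definition Lp_operator_algebra : Prop :=
  exists d (X : measurableType d) (mu : {measure set X -> \bar R})
         (pi : A -> bop (Lp mu p1)),
    [/\ homomorphism pi, isometric pi & closed (range pi)].

Definition nondegenerately_sigma_finitely_representable : Prop :=
  exists d (X : measurableType d) (mu : {sigma_finite_measure set X -> \bar R})
         (pi : A -> bop (Lp mu p1)),
    [/\ representation pi, isometric pi & nondegenerate pi].

End representations.

Section crossed_product.
Variables (R : realType) (p : R) (p1 : 1 <= p) (G : topologicalGroupType).
Variables (nu : {measure set (borel G) -> \bar R}) (A : banachAlgType R[i]).
Variable alpha : G -> A -> A.

Definition isometric_action : Prop :=
  [/\ forall g, [/\ homomorphism (alpha g), bijective (alpha g) &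
                 forall a, `|alpha g a| = `|a|],
      forall a, alpha 1%g a = a,
      forall g h a, alpha (g * h)%g a = alpha g (alpha h a) &
      forall a, continuous (alpha^~ a)].

Definition convolution (a b : Cc G A) : G -> A := fun g =>
  bochner_integral nu (fun h : borel G => bmul (a h) (alpha h (b (h^-1 * g)%g))).

(* [convolution a b] is again continuous with compact support: the default
   value of [insubd] is never used. *)
Definition Cc_mul (a b : Cc G A) : Cc G A := insubd 0 (convolution a b).

(* [v] being multiplicative, [v g^-1] is the inverse of [v g]. *)
Definition covariant (E : normedModType R[i]) (v : G -> bop E)
    (pi : A -> bop E) : Prop :=
  [/\ representation pi,
      forall x, v 1%g x = x,
      forall g h x, v (g * h)%g x = v g (v h x),
      forall x, continuous (fun g => v g x) &
      forall g a x, pi (alpha g a) x = v g (pi a (v g^-1%g x))].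

Definition integrated_form (E : normedModType R[i]) (v : G -> bop E)
    (pi : A -> bop E) (a : Cc G A) : E -> E := fun x =>
  bochner_integral nu (fun g : borel G => pi (a g) (v g x)).

(* [xi' (h, x) = xi h x] identifies a continuous compactly supported function
   [xi : G -> L^p(X0)] with an element [xi'] of [L^p(G * X0)]. *)
Definition regular_covariant d (X0 : measurableType d)
    (mu0 : {sigma_finite_measure set X0 -> \bar R})
    (pi0 : A -> bop (Lp mu0 p1))
    (v : G -> bop (Lp (nu \x mu0)%E p1))
    (pi : A -> bop (Lp (nu \x mu0)%E p1)) : Prop :=
  [/\ covariant v pi,
      forall g (xi : Lp (nu \x mu0)%E p1),
        {ae (nu \x mu0)%E, forall z,
          Lp_fun (v g xi) z = Lp_fun xi ((g^-1 * z.1)%g, z.2)} &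
      forall a (xi : Cc G (Lp mu0 p1)) (xi' : Lp (nu \x mu0)%E p1),
        {ae nu, forall h, {ae mu0, forall x,
          Lp_fun xi' (h, x) = Lp_fun (xi h) x}} ->
        {ae nu, forall h, {ae mu0, forall x,
          Lp_fun (pi a xi') (h, x) = Lp_fun (pi0 (alpha h^-1%g a) (xi h)) x}}].

Definition nondegenerate_contractive_regular d (X0 : measurableType d)
    (mu0 : {sigma_finite_measure set X0 -> \bar R})
    (v : G -> bop (Lp (nu \x mu0)%E p1))
    (pi : A -> bop (Lp (nu \x mu0)%E p1)) : Prop :=
  exists pi0 : A -> bop (Lp mu0 p1),
    [/\ representation pi0, contractive pi0, nondegenerate pi0 &
        regular_covariant pi0 v pi].

Definition reduced_norm (a : Cc G A) : R :=
  sup [set r | exists d (X0 : measurableType d)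
    (mu0 : {sigma_finite_measure set X0 -> \bar R})
    (v : G -> bop (Lp (nu \x mu0)%E p1))
    (pi : A -> bop (Lp (nu \x mu0)%E p1)),
    nondegenerate_contractive_regular v pi /\
    r = opnorm (integrated_form v pi a)].

(* [reduced_norm] is an algebra seminorm; as above, [insubd] only serves to give
   it that type before this is proved. *)
Definition reduced_seminorm : algebra_seminorm Cc_mul :=
  insubd (zero_seminorm Cc_mul) reduced_norm.

Definition reduced_crossed_product : banachAlgType R[i] :=
  algebra_completion reduced_seminorm.

End crossed_product.

(* Main.v *)
(** A regular covariant representation [(v, pi)] acts by isometries [v g] (left
    invariance and Tonelli) and contractively through [pi] (Tonelli, on the dense
    image of [C_c(G, L^p(X0))]). Hence [(v x| pi)(a)], the integral of
    [pi (a g) v_g], has norm at most [sup |a| * nu (supp a)], uniformly in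
    [(v, pi)], and [v x| pi] is multiplicative by Fubini and left invariance. So
    the supremum of these norms is an algebra seminorm for which every [v x| pi]
    is contractive, and [v x| pi] extends uniquely to the completion. For the norm
    formula, if [x] in [C_c(G, A)] is [e]-close to [a], then
    [|a| <= |x| + e] and [|(v x| pi)(x)| <= |rho a| + e] for every [(v, pi)].

    The Bochner integrals involved are those of continuous compactly supported
    functions; they are uniform limits of Riemann sums over Borel partitions,
    from which linearity, Fubini and invariance follow. *)

Require Import Defs.
From HB Require Import structures.
From mathcomp Require Import all_boot all_order all_algebra.
From mathcomp.real_closed Require Import complex.
From mathcomp Require Import ring lra finmap.
From mathcomp Require Import all_classical all_reals all_analysis.
From mathcomp Require Import measurable_realfun.
Set Implicit Arguments.
Unset Strict Implicit.
Unset Printing Implicit Defensive.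
Import Order.TTheory GRing.Theory Num.Theory.
Import numFieldNormedType.Exports.
Local Open Scope classical_set_scope.
Local Open Scope ring_scope.
Local Open Scope complex_scope.

(** * Bochner integrals of continuous compactly supported functions *)

(** Two points shape the proof. First, [sup] of a set of reals without an upper bound is 0, so the
    reduced norm is meaningful only because the norms of the integrated forms are bounded by data of
    [a] alone, uniformly over all measure spaces [X0]. Second, no algebraic identity of the
    convolution is proved directly: each axiom is tested in the operator algebras where the
    integrated forms take their values, and so holds up to vectors of seminorm 0.

    The representation [pi] is described only on classes that come from [Cc G (Lp mu0 p1)], and only
    almost everywhere on sections. Its contractivity on the whole space needs the density of these
    classes, obtained by showing that a closed subspace with enough indicators is everything; the
    boundedness of [pi a], which is part of its type, then lets the sharp bound pass to the closure.

    Bochner integrals with values in L^p and the extension to the completion both need limits in the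
    target, hence sequential completeness of L^p and of its bounded operators. *)

Section rnorm_facts.
Context {R : realType} {V : normedModType R[i]}.
Implicit Types x y : V.

Lemma rnorm_real (r : R) : rnorm (r%:C : R[i]) = `|r|.
Proof. by apply: complexI; rewrite rnormE normc_def/= expr0n addr0 sqrtr_sqr. Qed.

Lemma rnorm_le0 x : rnorm x <= 0 -> x = 0.
Proof. by move=> x0; apply/rnorm_eq0/eqP; rewrite eq_le x0 rnorm_ge0. Qed.

Lemma rnorm_dist x y : `|rnorm x - rnorm y| <= rnorm (x - y).
Proof.
rewrite ler_norml lerBlDr -{3}[x](subrK y) rnormD andbT lerNl opprB lerBlDr.
by rewrite (rnormB x) -{1}[y](subrK x) rnormD.
Qed.

Lemma rnorm_sum (I : Type) (r : seq I) (P : pred I) (f : I -> V) :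
  rnorm (\sum_(i <- r | P i) f i) <= \sum_(i <- r | P i) rnorm (f i).
Proof.
elim/big_ind2 : _ => //; first by rewrite rnorm0.
by move=> ? ? ? ? h k; rewrite (le_trans (rnormD _ _))// lerD.
Qed.

(** A positive element of [R[i]] is real, so real radii suffice to describe the neighbourhoods. *)
Lemma cvg_rnormP {T : Type} {F : set_system T} {FF : Filter F} (f : T -> V) l :
  f @ F --> l <-> forall e : R, 0 < e -> \forall t \near F, rnorm (f t - l) < e.
Proof.
split=> [/cvgrPdist_lt fl e e0|fl].
  have e0C : 0 < e%:C by rewrite (ltcR 0).
  by have := fl _ e0C; apply: filterS => t; rewrite -ltcR rnormE distrC.
apply/cvgrPdist_lt => e e0; have e0' : 0 < complex.Re e.
  by move: e0; rewrite ltcE/= => /andP[].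
have := fl _ e0'; apply: filterS => t.
by rewrite -ltcR rnormE distrC RRe_real// gtr0_real.
Qed.

Lemma continuous_rnormP {T : topologicalType} (f : T -> V) :
  continuous f <->
  forall t (e : R), 0 < e -> \forall s \near t, rnorm (f s - f t) < e.
Proof. by split=> h t; [move/cvg_rnormP: (h t)|apply/cvg_rnormP/h]. Qed.

Lemma continuous_rnorm {T : topologicalType} (f : T -> V) :
  continuous f -> continuous (fun t => rnorm (f t) : R^o).
Proof.
move=> /continuous_rnormP fc t; apply/cvgrPdist_lt => e e0.
have := fc t e e0; apply: filterS => s; apply: le_lt_trans.
by rewrite distrC rnorm_dist.
Qed.

End rnorm_facts.

(** * Simple functions and common refinements *)

Section simple_functions.
Context d (T : measurableType d) (R : realType).
Variables (mu : {measure set T -> \bar R}) (E : normedModType R[i]).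

Section comp.
Variables (W : choiceType) (u : T -> W).
Hypotheses (finu : finite_set (range u))
  (mu_fib : forall w, measurable (u @^-1` [set w])).

Lemma preimage_comp_bigcup (W' : Type) (phi : W -> W') (y : W') :
  (phi \o u) @^-1` [set y] =
  \bigcup_(w in range u `&` phi @^-1` [set y]) u @^-1` [set w].
Proof.
apply/seteqP; split=> [t /= ty|t [w [_ /= wy] /= tw]]; last by rewrite tw.
by exists (u t) => //; split => //; exists t.
Qed.

(** Every fibre of [phi \o u] is a finite disjoint union of fibres of [u], and over a nonzero value
    all of these have finite measure. *)
Lemma simple_integrable_comp (phi : W -> E) :
  (forall w, phi w != 0 -> (mu (u @^-1` [set w]) < +oo)%E) ->
  simple_integrable mu (phi \o u).
Proof.
move=> fin; split.
- by rewrite -(image_comp u); exact: finite_image.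
- move=> y; rewrite preimage_comp_bigcup; apply: fin_bigcup_measurable => //.
  exact: finite_setIl.
- move=> y y0; rewrite preimage_comp_bigcup measure_fin_bigcup//.
  + rewrite fsbig_finite/=; last exact: finite_setIl.
    rewrite big_seq; apply/lte_sum_pinfty => w.
    rewrite in_fset_set; last exact: finite_setIl.
    by rewrite inE => -[_ /= wy]; apply: fin; rewrite wy.
  + exact: finite_setIl.
  + by apply: sub_trivIset (@trivIset_preimage1 _ _ setT u); exact: subsetT.
Qed.

(** The integral may be computed on any finer finite partition. With [u] a pair of simple functions,
    this puts two integrals on the same partition. *)
Lemma simple_integral_comp (phi : W -> E) :
  (forall w, phi w != 0 -> (mu (u @^-1` [set w]) < +oo)%E) ->
  simple_integral mu (phi \o u) =
  \sum_(w <- fset_set (range u)) (fine (mu (u @^-1` [set w])))%:C *: phi w.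
Proof.
move=> fin.
have finr : finite_set (range (phi \o u)).
  by rewrite -(image_comp u); exact: finite_image.
rewrite /simple_integral fsbig_finite//=.
have meas y : y != 0 -> fine (mu ((phi \o u) @^-1` [set y])) =
    \sum_(w <- fset_set (range u))
      if phi w == y then fine (mu (u @^-1` [set w])) else 0.
  move=> y0; rewrite preimage_comp_bigcup measure_fin_bigcup//; last 2 first.
    exact: finite_setIl.
    by apply: sub_trivIset (@trivIset_preimage1 _ _ setT u); exact: subsetT.
  rewrite fsbig_mkcondr fsbig_finite//= -[RHS]/(fine _%:E) -sumEFin.
  congr fine; apply: eq_bigr => w _.
  have -> : (w \in phi @^-1` [set y]) = (phi w == y).
    by apply/idP/eqP => [/set_mem//|wy]; apply/mem_set.
  case: eqP => // wy; rewrite fineK// ge0_fin_numE// fin//.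
  by rewrite wy.
under eq_bigr => y _.
  rewrite (_ : _ *: y = \sum_(w <- fset_set (range u))
     if phi w == y then (fine (mu (u @^-1` [set w])))%:C *: phi w else 0).
    over.
  (* Fibres of infinite measure, where [fine] is not additive, occur only over the value 0, and
     there both sides vanish. *)
  have [->|y0] := eqVneq y 0.
    rewrite scaler0 big1// => w _; case: eqP => // ->; by rewrite scaler0.
  rewrite meas// rmorph_sum scaler_suml/=; apply: eq_bigr => w _.
  by case: eqP => [->//|_]; rewrite scale0r.
rewrite exchange_big/= big_seq [RHS]big_seq; apply: eq_bigr => w.
rewrite in_fset_set// inE => -[t _ tw].
have pw : phi w \in fset_set (range (phi \o u)).
  by rewrite in_fset_set// inE; exists t => //=; rewrite tw.
rewrite (bigD1_seq (phi w)) ?fset_uniq//=.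
rewrite ifT// big1 ?addr0// => y.
by rewrite eq_sym => /negbTE ->.
Qed.

(** [W] carries no sigma-algebra; this decomposition gives measurability of [psi \o u] for an
    arbitrary [psi]. *)
Lemma simple_comp_indic (psi : W -> R) x : psi (u x) =
  \sum_(w <- fset_set (range u)) psi w * \1_(u @^-1` [set w]) x.
Proof.
rewrite (bigD1_seq (u x)) ?fset_uniq//=; last first.
  by rewrite in_fset_set//; apply/mem_set; exists x.
rewrite indicE mem_set// mulr1 big1 ?addr0// => w wx.
by rewrite indicE memNset ?mulr0//= => xw; rewrite xw eqxx in wx.
Qed.

Lemma measurable_simple_comp (psi : W -> R) :
  measurable_fun setT (psi \o u).
Proof.
rewrite (_ : _ \o _ = (fun x => \sum_(w <- fset_set (range u))
  psi w * \1_(u @^-1` [set w]) x)); last exact/funext/simple_comp_indic.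
by apply: measurable_sum => w; apply: measurable_funM.
Qed.

Lemma integral_simple_comp (psi : W -> R) : (forall w, 0 <= psi w) ->
  (\int[mu]_x (psi (u x))%:E =
   \sum_(w <- fset_set (range u)) (psi w)%:E * mu (u @^-1` [set w]))%E.
Proof.
move=> psi0.
under eq_integral do rewrite simple_comp_indic -sumEFin.
rewrite ge0_integral_sum//.
- apply: eq_bigr => w _; under eq_integral do rewrite EFinM.
  rewrite ge0_integralZl//.
  + by rewrite integral_indic// setIT.
  + exact/measurable_EFinP.
  + by rewrite lee_fin.
- by move=> w; apply/measurable_EFinP/measurable_funM.
- by move=> w x _; rewrite lee_fin mulr_ge0.
Qed.

End comp.

Section pair.
Variables s t : T -> E.
Hypotheses (hs : simple_integrable mu s) (ht : simple_integrable mu t).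

Let u x := (s x, t x).

Let u_fib w : u @^-1` [set w] = s @^-1` [set w.1] `&` t @^-1` [set w.2].
Proof. by case: w => y z; apply/seteqP; split => x /= -[<- <-]. Qed.

Let finu : finite_set (range u).
Proof.
have [[fs _ _] [ft _ _]] := (hs, ht).
apply: sub_finite_set (finite_setX fs ft) => _ [x _ <-].
by split; exists x.
Qed.

Let mu_fib w : measurable (u @^-1` [set w]).
Proof.
by have [[_ ms _] [_ mt _]] := (hs, ht); rewrite u_fib; exact: measurableI.
Qed.

Let fin_fib1 (w : E * E) : w.1 != 0 -> (mu (u @^-1` [set w]) < +oo)%E.
Proof.
have [[_ ms fs] [_ mt _]] := (hs, ht) => /fs; apply: le_lt_trans.
by rewrite u_fib le_measure// ?inE//; exact: measurableI.
Qed.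

Let fin_fib2 (w : E * E) : w.2 != 0 -> (mu (u @^-1` [set w]) < +oo)%E.
Proof.
have [[_ ms _] [_ mt ft]] := (hs, ht) => /ft; apply: le_lt_trans.
by rewrite u_fib le_measure// ?inE//; exact: measurableI.
Qed.

Lemma measurable_rnorm_simpleB : measurable_fun setT (fun x => rnorm (s x - t x)).
Proof. exact: (measurable_simple_comp finu mu_fib (fun w => rnorm (w.1 - w.2))). Qed.

(** On the joint fibres of [s] and [t] the two sums have the same weights, so the triangle
    inequality applies term by term. *)
Lemma simple_integral_dist :
  ((rnorm (simple_integral mu s - simple_integral mu t))%:E <=
   \int[mu]_x (rnorm (s x - t x))%:E)%E.
Proof.
have -> : simple_integral mu s = simple_integral mu (fst \o u) by [].
have -> : simple_integral mu t = simple_integral mu (snd \o u) by [].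
rewrite !simple_integral_comp// -sumrB.
rewrite (integral_simple_comp finu mu_fib (psi := fun w => rnorm (w.1 - w.2)));
  last by move=> w; exact: rnorm_ge0.
apply: (@le_trans _ _ (\sum_(w <- fset_set (range u))
    (rnorm (w.1 - w.2) * fine (mu (u @^-1` [set w])))%:E)%E).
  rewrite sumEFin lee_fin (le_trans (rnorm_sum _ _ _))// ler_sum// => w _.
  by rewrite -scalerBr rnormZ rnorm_real mulrC ger0_norm// fine_ge0.
apply: lee_sum => w _; rewrite EFinM.
(* A joint fibre may have infinite measure only where both values are 0, and there the integrand is
   0. *)
have [->|w0] := eqVneq (w.1 - w.2) 0; first by rewrite rnorm0 !mul0e.
rewrite fineK// ge0_fin_numE//.
have [w10|] := eqVneq w.1 0; last exact: fin_fib1.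
by apply: fin_fib2; move: w0; rewrite w10 sub0r oppr_eq0.
Qed.

End pair.
End simple_functions.

(* Completeness has to be a hypothesis on the space of values: [Lp] carries no
   [completeNormedModType] structure. *)
Definition seq_complete (R : realType) (E : normedModType R[i]) := forall u : nat -> E,
  (forall e : R, 0 < e -> exists k : nat, forall m n,
    (k <= m)%N -> (k <= n)%N -> rnorm (u m - u n) < e) ->
  exists l : E, u @ \oo --> l.

Lemma completeNormedModType_seq_complete (R : realType)
  (E : completeNormedModType R[i]) : seq_complete E.
Proof.
move=> u hu; have : cvgn u; last by move=> /cvg_ex.
apply/cauchy_cvgP/cauchyP => e e0.
have e0' : 0 < complex.Re e by move: e0; rewrite ltcE/= => /andP[].
have [k hk] := hu _ e0'; exists (u k), k => // n /= kn.
rewrite -ball_normE/= -rnormE -[e]RRe_real ?gtr0_real// ltcR.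
exact: hk.
Qed.

Lemma continuous_borel_measurable (R : realType) (G : ptopologicalType) (f : G -> R) :
  continuous (f : G -> R^o) -> measurable_fun setT (f : borel G -> R).
Proof.
move=> fc; apply: (measurability _ (RGenOpens.measurableE R)).
move=> _ [_ [a [b ->]] <-]; rewrite setTI; apply: sub_sigma_algebra.
by apply: open_comp; [move=> x _; exact: fc|exact: interval_open].
Qed.

Lemma cvge0_near_lt (R : realType) (u : nat -> \bar R) (e : R) :
  u @ \oo --> 0%E -> 0 < e -> \forall n \near \oo, (u n < e%:E)%E.
Proof.
move=> u0 e0; have := open_ereal_lt' (_ : 0%:E < e%:E)%E.
by rewrite lte_fin => /(_ e0)/u0.
Qed.

(** * Existence, uniqueness and approximation of the integral *)

Section bochner_continuous.
Context (R : realType) (G : topologicalGroupType).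
Variable nu : {measure set (borel G) -> \bar R}.
Hypothesis T2 : hausdorff_space G.
Hypothesis fin_compact : forall K : set G, compact K -> (nu K < +oo)%E.

Lemma compact_borel_measurable (K : set G) : compact K -> measurable (K : set (borel G)).
Proof.
move=> /(compact_closed T2)/closed_openC oK; rewrite -[K]setCK.
by apply: measurableC; exact: sub_sigma_algebra.
Qed.

(** Measurability of [f] itself has no meaning here; on each of the finitely many fibres of [u] the
    function is the continuous real function [rnorm (f x - phi w)]. *)
Lemma measurable_rnorm_subsimple (E : normedModType R[i]) (f : G -> E)
    (W : choiceType) (u : borel G -> W) (phi : W -> E) :
  continuous f -> finite_set (range u) ->
  (forall w, measurable (u @^-1` [set w])) ->
  measurable_fun setT (fun x : borel G => rnorm (f x - phi (u x))).
Proof.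
move=> fc finu mu_fib.
have -> : (fun x : borel G => rnorm (f x - phi (u x))) =
    (fun x => \sum_(w <- fset_set (range u))
      rnorm (f x - phi w) * \1_(u @^-1` [set w]) x).
  apply/funext => x; exact: (simple_comp_indic finu (fun w => rnorm (f x - phi w))).
apply: measurable_sum => w; apply: measurable_funM => //.
apply: continuous_borel_measurable; apply: continuous_rnorm => x.
by apply: cvgB; [exact: fc|exact: cvg_cst].
Qed.

Lemma measurable_rnorm_simple (E : normedModType R[i]) (f : G -> E) (s : borel G -> E) :
  continuous f -> simple_integrable nu s ->
  measurable_fun setT (fun x : borel G => rnorm (f x - s x)).
Proof.
by move=> fc [fs ms _]; exact: (@measurable_rnorm_subsimple E f E s id).
Qed.

Lemma simple_integral_tri (E : normedModType R[i]) (f : G -> E) (s t : borel G -> E) :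
  continuous f -> simple_integrable nu s -> simple_integrable nu t ->
  ((rnorm (simple_integral nu t - simple_integral nu s))%:E <=
   \int[nu]_x (rnorm (f x - s x))%:E + \int[nu]_x (rnorm (f x - t x))%:E)%E.
Proof.
move=> fc hs ht; apply: (le_trans (simple_integral_dist ht hs)).
rewrite -ge0_integralD//; last 4 first.
  by move=> x _; rewrite lee_fin rnorm_ge0.
  apply/measurable_EFinP; exact: (measurable_rnorm_simple fc hs).
  by move=> x _; rewrite lee_fin rnorm_ge0.
  apply/measurable_EFinP; exact: (measurable_rnorm_simple fc (ht)).
apply: ge0_le_integral => //.
- by move=> x _; rewrite lee_fin rnorm_ge0.
- apply/measurable_EFinP; exact: (measurable_rnorm_simpleB ht hs).
- apply: emeasurable_funD; apply/measurable_EFinP.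
    exact: (measurable_rnorm_simple fc hs).
  exact: (measurable_rnorm_simple fc (ht)).
- move=> x _; rewrite -EFinD lee_fin [leRHS]addrC (rnormB (f x) (t x)).
  exact: rnorm_tri.
Qed.

(** The inequality holds along a sequence [t n] defining [I], up to the integral of
    [rnorm (f x - t n x)], which tends to 0. Uniqueness, norm bounds and Riemann estimates are all
    instances of it. *)
Lemma bochner_dist (E : normedModType R[i]) (f : G -> E) I (s : borel G -> E) :
  continuous f -> is_bochner_integral nu (f : borel G -> E) I ->
  simple_integrable nu s ->
  ((rnorm (I - simple_integral nu s))%:E <= \int[nu]_x (rnorm (f x - s x))%:E)%E.
Proof.
move=> fc [t [ht _ tf tI]] hs; apply/lee_addgt0Pr => e e0.
have [n [tn1 tn2]] : exists n, (\int[nu]_x (rnorm (f x - t n x))%:E < (e / 2)%:E)%E /\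
    rnorm (simple_integral nu (t n) - I) < e / 2.
  have e20 : 0 < e / 2 by rewrite divr_gt0.
  have : \forall n \near \oo, (\int[nu]_x (rnorm (f x - t n x))%:E < (e / 2)%:E)%E.
    exact: cvge0_near_lt.
  have /cvg_rnormP/(_ _ e20) := tI.
  move=> h1 h2; have [N _ hN] := filterI h1 h2.
  by have [] := hN N (leqnn N); exists N.
apply: (@le_trans _ _ ((rnorm (simple_integral nu (t n) - I))%:E +
    (rnorm (simple_integral nu (t n) - simple_integral nu s))%:E)%E).
  by rewrite -EFinD lee_fin (le_trans (rnorm_tri (simple_integral nu (t n)) _ _))// lerD// rnormB.
rewrite [X in (_ <= _ + X%:E)%E](splitr e) EFinD addeCA.
apply: leeD; first by rewrite lee_fin ltW.
apply: (le_trans (simple_integral_tri fc hs (ht n))).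
by apply: leeD2l; exact: ltW.
Qed.

(** By [bochner_dist] for [I], the sequence that defines [J] also converges to [I]. *)
Lemma bochner_unique (E : normedModType R[i]) (f : G -> E) I J : continuous f ->
  is_bochner_integral nu (f : borel G -> E) I ->
  is_bochner_integral nu (f : borel G -> E) J -> I = J.
Proof.
move=> fc fI [t [ht _ tf tJ]].
apply/eqP; rewrite eq_sym; apply/eqP.
suff tI : simple_integral nu (t n) @[n --> \oo] --> I.
  exact: (cvg_unique (@norm_hausdorff _ _) tJ tI).
apply/cvg_rnormP => e e0.
have := cvge0_near_lt tf e0.
apply: filterS => n; rewrite -lte_fin; apply: le_lt_trans.
by rewrite rnormB; exact: bochner_dist.
Qed.

(** This is [bochner_dist] against the zero simple function. *)
Lemma bochner_bound (E : normedModType R[i]) (f : G -> E) I (K : set G) M :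
  continuous f -> is_bochner_integral nu (f : borel G -> E) I ->
  compact K -> (forall x, ~ K x -> f x = 0) -> (forall x, rnorm (f x) <= M) ->
  rnorm I <= M * fine (nu K).
Proof.
move=> fc fI cK f0 fM.
have s0 : simple_integrable nu (fun _ : borel G => 0 : E).
  have r0 : range (fun _ : borel G => 0 : E) `<=` [set (0 : E)] by move=> _ [x _ <-].
  split.
  - exact: sub_finite_set r0 (finite_set1 _).
  - by move=> y; rewrite preimage_cst; case: ifP.
  - by move=> y y0; rewrite preimage_cst memNset ?measure0// => /= y0'; rewrite y0' eqxx in y0.
have SI0 : simple_integral nu (fun _ : borel G => 0 : E) = 0.
  by rewrite /simple_integral fsbig1// => y [x _ <-]; rewrite scaler0.
have mK := compact_borel_measurable cK.
have := bochner_dist fc fI s0; rewrite SI0 subr0 => h.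
rewrite -lee_fin (le_trans h)//.
apply: (@le_trans _ _ (\int[nu]_x (M%:E * (\1_(K : set (borel G)) x)%:E))%E).
  apply: ge0_le_integral => //.
  - by move=> x _; rewrite lee_fin rnorm_ge0.
  - apply/measurable_EFinP; exact: (measurable_rnorm_simple fc s0).
  - by apply/measurable_EFinP/measurable_funM.
  - move=> x _; rewrite subr0 -EFinM lee_fin indicE.
    case: (pselect (K x)) => Kx; first by rewrite mem_set// mulr1.
    by rewrite memNset// mulr0 f0// rnorm0.
rewrite ge0_integralZl//; last 2 first.
  exact/measurable_EFinP.
  by rewrite lee_fin (le_trans (rnorm_ge0 (f 1%g))).
rewrite integral_indic// setIT EFinM fineK// ge0_fin_numE//.
exact: fin_compact.
Qed.

(* A tagged partition of [K], encoded by the map sending a point to its tag. *)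
Definition tagging (tag : G -> G) := finite_set (range tag) /\
  forall y, measurable (tag @^-1` [set y] : set (borel G)).

(** Earlier members of the list take priority on their open set, which makes the cover disjoint
    while keeping its pieces Borel. *)
Lemma tagging_cover (cs : seq G) (U : G -> set G) : (forall c, open (U c)) ->
  exists2 tag, tagging tag &
    forall g c, c \in cs -> U c g -> U (tag g) g.
Proof.
move=> oU; elim: cs => [|c cs [tag [ftag mtag] htag]].
  exists (fun=> 1%g) => //; split.
    by apply: sub_finite_set (finite_set1 1%g) => _ [x _ <-].
  by move=> y; rewrite preimage_cst; case: ifP => _; [exact: measurableT|exact: measurable0].
exists (fun g => if g \in U c then c else tag g).
  split.
    apply: (@sub_finite_set _ _ (c |` range tag)); last first.
      by rewrite finite_setU; split => //; exact: finite_set1.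
    by move=> _ [x _ <-]; case: ifP => _; [left|right; exists x].
  move=> y; have mU : measurable (U c : set (borel G)).
    by apply: sub_sigma_algebra; exact: oU.
  rewrite (_ : _ @^-1` _ = (U c `&` (if c == y then setT else set0)) `|`
      (~` U c `&` tag @^-1` [set y])); last first.
    apply/seteqP; split => [x /=|x /= [[Ux]|[Ux xy]]].
    - case: ifPn => [/set_mem Ux cy|/negP Ux xy]; first by left; rewrite -cy eqxx.
      by right; split => // /mem_set.
    - by case: eqP => // cy _; rewrite (mem_set Ux).
    - by rewrite memNset.
  apply: measurableU; apply: measurableI => //.
  - by case: ifP => _; [exact: measurableT|exact: measurable0].
  - exact: measurableC.
move=> g c'; rewrite inE => /orP[/eqP ->|c'cs] Ug; first by rewrite mem_set.
by case: ifPn => [/set_mem//|_]; exact: htag Ug.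
Qed.

(** This replaces uniform continuity: [P c] collects the points where all functions at hand are
    close to their value at [c], and finitely many such sets cover [K]. Tags may lie outside [K]. *)
Lemma tagging_compact (K : set G) (P : G -> set G) : compact K ->
  (forall c, nbhs c (P c)) ->
  exists2 tag, tagging tag & forall g, K g -> P (tag g) g.
Proof.
rewrite compact_cover => cK nP.
have [|g Kg|D _ KD] := cK G setT (fun c => interior (P c)).
- by move=> c _; exact: open_interior.
- by exists g => //; exact: nP.
have [tag ttag htag] := @tagging_cover (enum_fset D) (fun c => interior (P c))
  (fun c => @open_interior _ _).
exists tag => // g Kg; have [c /= cD Pc] := KD g Kg.
by apply: interior_subset; exact: htag Pc.
Qed.

Section riemann_sums.
Variables (K : set G) (tag : G -> G).
Hypotheses (cK : compact K) (ttag : tagging tag).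

(** [None] is the complement of [K], possibly of infinite measure. [oapp f 0] gives it the value 0,
    so that its weight never matters. *)
Let u (x : borel G) := if x \in K then Some (tag x) else None.

Let mK : measurable (K : set (borel G)). Proof. exact: compact_borel_measurable. Qed.

Let finu : finite_set (range u).
Proof.
have [ft _] := ttag.
apply: (@sub_finite_set _ _ (None |` Some @` range tag)).
  move=> _ [x _ <-]; rewrite /u; case: ifP => _; [right|by left].
  by exists (tag x) => //; exists x.
by rewrite finite_setU; split; [exact: finite_set1|exact: finite_image].
Qed.

Let u_fib w : measurable (u @^-1` [set w]).
Proof.
have [_ mt] := ttag; case: w => [y|].
  rewrite (_ : _ @^-1` _ = K `&` tag @^-1` [set y]); first exact: measurableI.
  apply/seteqP; split => x /=; rewrite /u.
    by case: ifPn => // /set_mem Kx [].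
  by move=> [Kx ->]; rewrite mem_set.
rewrite (_ : _ @^-1` _ = ~` K); first exact: measurableC.
apply/seteqP; split => x /=; rewrite /u; last by move=> Kx; rewrite memNset.
by case: ifPn => // /negP Kx _ /mem_set.
Qed.

Let u_fin y : (nu (u @^-1` [set Some y]) < +oo)%E.
Proof.
apply: le_lt_trans (fin_compact cK); apply: le_measure; rewrite ?inE//.
by move=> x /=; rewrite /u; case: ifPn => // /set_mem.
Qed.

Definition riemann_sum (E : normedModType R[i]) (f : G -> E) : E :=
  \sum_(w <- fset_set (range u)) (fine (nu (u @^-1` [set w])))%:C *: oapp f 0 w.

Definition riemann_step (E : normedModType R[i]) (f : G -> E) : borel G -> E :=
  oapp f 0 \o u.

Lemma riemann_step_simple (E : normedModType R[i]) (f : G -> E) :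
  simple_integrable nu (riemann_step f).
Proof.
by apply: simple_integrable_comp => // -[y|]/=; rewrite ?eqxx// => _; exact: u_fin.
Qed.

Lemma riemann_stepE (E : normedModType R[i]) (f : G -> E) :
  simple_integral nu (riemann_step f) = riemann_sum f.
Proof.
by apply: simple_integral_comp => // -[y|]/=; rewrite ?eqxx// => _; exact: u_fin.
Qed.

(** Exact compatibility of finite sums with linear maps; the integral inherits it by
    approximation. *)
Lemma riemann_sum_linear (E F : normedModType R[i]) (L : {linear E -> F}) (f : G -> E) :
  riemann_sum (L \o f) = L (riemann_sum f).
Proof.
rewrite /riemann_sum linear_sum; apply: eq_bigr => -[y|] _ /=.
  by rewrite linearZ.
by rewrite !scaler0 linear0.
Qed.

Lemma riemann_sumP (E : normedModType R[i]) (k : R[i]) (f g : G -> E) :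
  riemann_sum (fun x => k *: f x + g x) = k *: riemann_sum f + riemann_sum g.
Proof.
rewrite /riemann_sum scaler_sumr -big_split; apply: eq_bigr => -[y|] _ /=.
  by rewrite scalerDr !scalerA mulrC.
by rewrite !scaler0 addr0.
Qed.

Lemma riemann_step_dist (E : normedModType R[i]) (f : G -> E) (e : R) :
  continuous f -> 0 <= e -> (forall x, ~ K x -> f x = 0) ->
  (forall x, K x -> rnorm (f x - f (tag x)) <= e) ->
  (\int[nu]_x (rnorm (f x - riemann_step f x))%:E <= (e * fine (nu K))%:E)%E.
Proof.
move=> fc e0 f0 fe.
apply: (@le_trans _ _ (\int[nu]_x (e%:E * (\1_(K : set (borel G)) x)%:E))%E).
  apply: ge0_le_integral => //.
  - by move=> x _; rewrite lee_fin rnorm_ge0.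
  - apply/measurable_EFinP; exact: (measurable_rnorm_simple fc (riemann_step_simple f)).
  - by apply/measurable_EFinP/measurable_funM.
  - move=> x _; rewrite -EFinM lee_fin indicE /riemann_step /= /u.
    case: (pselect (K x)) => Kx; first by rewrite mem_set// mulr1 fe.
    by rewrite memNset// mulr0 f0//= subr0 rnorm0.
rewrite ge0_integralZl//; last exact/measurable_EFinP.
rewrite integral_indic// setIT EFinM fineK// ge0_fin_numE//.
exact: fin_compact.
Qed.

Lemma bochner_riemann (E : normedModType R[i]) (f : G -> E) (I : E) (e : R) :
  continuous f -> 0 <= e -> (forall x, ~ K x -> f x = 0) ->
  (forall x, K x -> rnorm (f x - f (tag x)) <= e) ->
  is_bochner_integral nu (f : borel G -> E) I ->
  rnorm (I - riemann_sum f) <= e * fine (nu K).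
Proof.
move=> fc e0 f0 fe fI; rewrite -lee_fin -riemann_stepE.
apply: (le_trans (bochner_dist fc fI (riemann_step_simple f))).
exact: riemann_step_dist.
Qed.

End riemann_sums.

(** [K] only has to contain the points where [f] is nonzero, so that several functions can share one
    compact set. *)
Definition cpt_supp (E : normedModType R[i]) (K : set G) (f : G -> E) :=
  [/\ continuous f, compact K & forall x, ~ K x -> f x = 0].

Notation bint f := (bochner_integral nu (f : borel G -> _)).

(** Riemann steps of mesh error [1 / (n + 1)] approximate [f] in mean, and their integrals form a
    Cauchy sequence. Hence the default value of [bochner_integral] does not arise for such [f]. *)
Lemma bochner_exists (E : normedModType R[i]) (K : set G) (f : G -> E) :
  seq_complete E -> cpt_supp K f -> is_bochner_integral nu (f : borel G -> E) (bint f).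
Proof.
move=> cE [fc cK f0]; apply: xgetPex.
have e0 n : 0 < n.+1%:R^-1 :> R by rewrite invr_gt0.
have /choice[tag htag] n : exists tag, tagging tag /\
    forall x, K x -> rnorm (f x - f (tag x)) < n.+1%:R^-1.
  have [|tag ttag hx] := @tagging_compact K
    (fun c x => rnorm (f x - f c) < n.+1%:R^-1) cK; last by exists tag.
  by move=> c; move/continuous_rnormP: fc; apply.
pose s n := riemann_step K (tag n) f.
have hs n : simple_integrable nu (s n).
  by apply: riemann_step_simple => //; have [] := htag n.
have sf n : (\int[nu]_x (rnorm (f x - s n x))%:E <= (n.+1%:R^-1 * fine (nu K))%:E)%E.
  have [ttag hx] := htag n.
  by apply: riemann_step_dist => // x Kx; apply/ltW/hx.
have cvg0 : (n.+1%:R^-1 * fine (nu K) : R) @[n --> \oo] --> 0.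
  by rewrite -[X in _ --> X](mul0r (fine (nu K))); apply: cvgMl; exact: cvg_harmonic.
have [I sI] : exists I : E, simple_integral nu (s n) @[n --> \oo] --> I.
  apply: cE => e ep.
  have e2 : 0 < e / 2 by rewrite divr_gt0.
  have /cvgrPdist_lt/(_ _ e2)[N _ hN] := cvg0.
  have hN' n : (N <= n)%N -> n.+1%:R^-1 * fine (nu K) < e / 2.
    by move=> /hN/=; rewrite sub0r normrN; apply: le_lt_trans; exact: ler_norm.
  exists N => m n Nm Nn; rewrite -lte_fin.
  apply: (le_lt_trans (simple_integral_tri fc (hs n) (hs m))).
  rewrite (splitr e) EFinD; apply: lteD.
    by apply: (le_lt_trans (sf n)); rewrite lte_fin hN'.
  by apply: (le_lt_trans (sf m)); rewrite lte_fin hN'.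
exists I; exists s; split => //.
  by move=> n; exact: measurable_rnorm_simple.
apply: (@squeeze_cvge _ _ _ _ (fun=> 0%E) _ (fun n => (n.+1%:R^-1 * fine (nu K))%:E)).
- apply: nearW => n; rewrite sf andbT; apply: integral_ge0 => x _.
  by rewrite lee_fin rnorm_ge0.
- exact: cvg_cst.
- by apply: cvg_EFin => //; exact: nearW.
Qed.

Lemma bint_unique (E : normedModType R[i]) (K : set G) (f : G -> E) I :
  seq_complete E -> cpt_supp K f -> is_bochner_integral nu (f : borel G -> E) I ->
  bint f = I.
Proof.
by move=> cE fK; apply: bochner_unique; [case: fK|exact: bochner_exists fK].
Qed.

Lemma bint_riemann (E : normedModType R[i]) (K : set G) (f : G -> E) tag (e : R) :
  seq_complete E -> cpt_supp K f -> tagging tag -> 0 <= e ->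
  (forall x, K x -> rnorm (f x - f (tag x)) <= e) ->
  rnorm (bint f - riemann_sum K tag f) <= e * fine (nu K).
Proof.
move=> cE fK ttag e0 fe; have [fc cK f0] := fK.
by apply: bochner_riemann => //; exact: bochner_exists fK.
Qed.

(** The shape of every Riemann argument below: the error is [e] times a constant that does not
    depend on [e]. *)
Lemma rnorm_small_eq (E : normedModType R[i]) (x y : E) (C : R) :
  (forall e : R, 0 < e -> rnorm (x - y) <= e * C) -> x = y.
Proof.
move=> h; apply/eqP; rewrite -subr_eq0; apply/eqP/rnorm_le0.
apply/ler_addgt0Pr => e e0; rewrite add0r.
have C0 : 0 < `|C| + 1 by rewrite ltr_wpDl.
apply: (le_trans (h (e / (`|C| + 1)) _)); first by rewrite divr_gt0.
rewrite -mulrA ger_pMr// mulrC ler_pdivrMr// mul1r.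
by rewrite (le_trans (ler_norm _))// lerDl.
Qed.

Lemma bint_linear (E : normedModType R[i]) (K : set G) (k : R[i]) (f g : G -> E) :
  seq_complete E -> cpt_supp K f -> cpt_supp K g ->
  bint (fun x => k *: f x + g x) = k *: bint f + bint g.
Proof.
move=> cE fK gK; have [[fc cK f0] [gc _ g0]] := (fK, gK).
have hc : continuous (fun x => k *: f x + g x : E).
  by move=> x; apply: cvgD; [apply: cvgZr; exact: fc|exact: gc].
have h0 x : ~ K x -> k *: f x + g x = 0.
  by move=> Kx; rewrite f0// g0// scaler0 addr0.
(* One tagging serves all three functions: 1 is the error of the combination, [rnorm k] that of [f],
   and the last 1 that of [g]. *)
apply: (@rnorm_small_eq _ _ _ ((1 + (rnorm k + 1)) * fine (nu K))) => e e0.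
have [|tag ttag htag] := @tagging_compact K (fun c x =>
    [/\ rnorm (f x - f c) < e, rnorm (g x - g c) < e &
     rnorm (k *: f x + g x - (k *: f c + g c)) < e]) cK.
  move=> c; move/continuous_rnormP: fc => /(_ c _ e0).
  move/continuous_rnormP: gc => /(_ c _ e0).
  move/continuous_rnormP: hc => /(_ c _ e0).
  by apply: filterS3 => x.
have Hh : rnorm (bint (fun x => k *: f x + g x) -
    riemann_sum K tag (fun x => k *: f x + g x)) <= e * fine (nu K).
  by apply: bint_riemann => //; [exact: ltW|move=> x Kx; apply/ltW; have [] := htag x Kx].
have Hf : rnorm (bint f - riemann_sum K tag f) <= e * fine (nu K).
  by apply: bint_riemann => //; [exact: ltW|move=> x Kx; apply/ltW; have [] := htag x Kx].
have Hg : rnorm (bint g - riemann_sum K tag g) <= e * fine (nu K).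
  by apply: bint_riemann => //; [exact: ltW|move=> x Kx; apply/ltW; have [] := htag x Kx].
rewrite (le_trans (rnorm_tri (riemann_sum K tag (fun x => k *: f x + g x)) _ _))//.
rewrite mulrCA mulrDl mul1r lerD// riemann_sumP opprD addrACA -scalerBr.
rewrite (le_trans (rnormD _ _))// rnormZ (rnormB (riemann_sum _ _ _)).
rewrite [rnorm (riemann_sum _ _ _ - _)]rnormB mulrDl mul1r lerD//.
by rewrite ler_wpM2l// rnorm_ge0.
Qed.

Lemma bint_bound (E : normedModType R[i]) (K : set G) (f : G -> E) M :
  seq_complete E -> cpt_supp K f -> (forall x, rnorm (f x) <= M) ->
  rnorm (bint f) <= M * fine (nu K).
Proof.
move=> cE fK; have [fc cK f0] := fK.
by apply: bochner_bound => //; exact: bochner_exists fK.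
Qed.

Lemma bint_dist (E : normedModType R[i]) (K : set G) (f g : G -> E) M :
  seq_complete E -> cpt_supp K f -> cpt_supp K g ->
  (forall x, rnorm (f x - g x) <= M) ->
  rnorm (bint f - bint g) <= M * fine (nu K).
Proof.
move=> cE fK gK fgM; rewrite addrC -scaleN1r -(bint_linear _ cE gK fK).
have [[fc cK f0] [gc _ g0]] := (fK, gK).
apply: bint_bound => //; last by move=> x; rewrite scaleN1r addrC.
split => // x; last by move=> Kx; rewrite f0// g0// scaler0 addr0.
by apply: cvgD; [apply: cvgZr; exact: gc|exact: fc].
Qed.

(** Riemann sums commute with [L]; a tagging good for both [f] and [L \o f] compares the two
    integrals with them. *)
Lemma bint_bounded_linear (E F : normedModType R[i]) (L : {linear E -> F}) (C : R)
    (K : set G) (f : G -> E) :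
  seq_complete E -> seq_complete F -> (forall x, rnorm (L x) <= C * rnorm x) ->
  cpt_supp K f -> bint (L \o f) = L (bint f).
Proof.
move=> cE cF LC fK; have [fc cK f0] := fK.
have C0 : 0 <= `|C| by [].
have LC' x : rnorm (L x) <= `|C| * rnorm x.
  by rewrite (le_trans (LC x))// ler_wpM2r ?rnorm_ge0// ler_norm.
have Lfc : continuous (L \o f).
  apply/continuous_rnormP => t e e0.
  have C1 : 0 < `|C| + 1 by rewrite ltr_wpDl.
  have /continuous_rnormP/(_ t _ (divr_gt0 e0 C1)) := fc.
  apply: filterS => s; rewrite ltr_pdivlMr// => h; apply: le_lt_trans h.
  by rewrite /= -linearB (le_trans (LC' _))// mulrC ler_wpM2l ?rnorm_ge0// lerDl.
have LfK : cpt_supp K (L \o f).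
  by split => // x Kx /=; rewrite f0// linear0.
apply: (@rnorm_small_eq _ _ _ ((1 + `|C|) * fine (nu K))) => e e0.
have [|tag ttag htag] := @tagging_compact K (fun c x =>
    rnorm (f x - f c) < e /\ rnorm (L (f x) - L (f c)) < e) cK.
  move=> c; move/continuous_rnormP: fc => /(_ c _ e0).
  move/continuous_rnormP: Lfc => /(_ c _ e0).
  by apply: filterS2 => x.
rewrite (le_trans (rnorm_tri (riemann_sum K tag (L \o f)) _ _))//.
rewrite mulrCA mulrDl mul1r lerD//.
  by apply: bint_riemann => //; [exact: ltW|move=> x Kx; apply/ltW; have [] := htag x Kx].
rewrite riemann_sum_linear -linearB (le_trans (LC' _))// ler_wpM2l// rnormB.
by apply: bint_riemann => //; [exact: ltW|move=> x Kx; apply/ltW; have [] := htag x Kx].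
Qed.

(** * Left invariance of the integral *)

Hypothesis left_inv : forall (g : G) (B : set (borel G)), measurable B ->
  nu [set (g * x)%g | x in B] = nu B.

Lemma mulgl_continuous (h : G) : continuous (fun x : G => h * x)%g.
Proof.
move=> x; apply: (@continuous2_cvg _ _ _ _ _ _ (fun _ => h) id (fun x y : G => (x * y)%g)).
- exact: (@mulg_continuous G (h, x)).
- exact: cvg_cst.
- exact: cvg_id.
Qed.

Lemma mulgl_measurable (h : G) :
  measurable_fun setT (fun x : borel G => (h * x)%g : borel G).
Proof.
apply: (measurability (@open G : set (set (borel G))) erefl) => _ [U oU <-].
rewrite setTI; apply: sub_sigma_algebra.
by apply: open_comp => // x _; exact: mulgl_continuous.
Qed.

Lemma mulgl_preimage (h : G) (B : set G) :
  (fun x => h^-1 * x)%g @^-1` B = [set (h * x)%g | x in B].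
Proof.
apply/seteqP; split=> [x /= Bx|_ [x Bx <-]]/=; last by rewrite mulKg.
by exists (h^-1 * x)%g => //; rewrite mulVKg.
Qed.

Lemma haar_integral_mulgl (h : G) (F : borel G -> \bar R) :
  measurable_fun setT F -> (forall x, 0 <= F x)%E ->
  (\int[nu]_x F (h^-1 * x)%g = \int[nu]_x F x)%E.
Proof.
move=> mF F0; have mt := mulgl_measurable (h^-1)%g.
rewrite -[LHS](@ge0_integral_pushforward _ _ _ _ _ _ mt nu setT F)//.
apply: eq_measure_integral => B mB _.
by rewrite /= /pushforward mulgl_preimage left_inv.
Qed.

Lemma simple_integral_mulgl (E : normedModType R[i]) (h : G) (s : borel G -> E) :
  simple_integrable nu s ->
  simple_integrable nu (fun x => s (h^-1 * x)%g) /\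
  simple_integral nu (fun x => s (h^-1 * x)%g) = simple_integral nu s.
Proof.
move=> [fs ms ns].
have rs : range (fun x => s (h^-1 * x)%g) = range s.
  apply/seteqP; split => [_ [x _ <-]|_ [x _ <-]]; first by exists (h^-1 * x)%g.
  by exists (h * x)%g => //; rewrite mulKg.
have fib y : nu ((fun x => s (h^-1 * x)%g) @^-1` [set y]) = nu (s @^-1` [set y]).
  by rewrite -(left_inv h (ms y)) -mulgl_preimage.
split; last by rewrite /simple_integral rs; apply: eq_fsbigr => y _; rewrite fib.
split; first by rewrite rs.
- move=> y; rewrite -[X in measurable X]setTI.
  by have := mulgl_measurable h^-1%g measurableT (ms y).
- by move=> y y0; rewrite fib ns.
Qed.

Lemma cpt_supp_mulgl (E : normedModType R[i]) (h : G) (K : set G) (f : G -> E) :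
  cpt_supp K f -> cpt_supp [set (h * x)%g | x in K] (fun x => f (h^-1 * x)%g).
Proof.
move=> [fc cK f0]; split.
- move=> x; apply: (@continuous_comp _ _ _ (fun x => h^-1 * x)%g f).
    exact: mulgl_continuous.
  exact: fc.
- apply: continuous_compact => //; apply: continuous_subspaceT.
  exact: mulgl_continuous.
- by move=> x; rewrite -mulgl_preimage => /f0.
Qed.

(** Translating a defining sequence of simple functions changes neither their integrals nor the
    distances in mean, so the translate has the same integral. *)
Lemma bint_mulgl (E : normedModType R[i]) (h : G) (K : set G) (f : G -> E) :
  seq_complete E -> cpt_supp K f -> bint (fun x => f (h^-1 * x)%g) = bint f.
Proof.
move=> cE fK; have fc : continuous f by case: fK.
apply: (bint_unique cE (cpt_supp_mulgl h fK)).
have [s [hs ms sf sI]] := bochner_exists cE fK.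
exists (fun n x => s n (h^-1 * x)%g); split => //.
- by move=> n; have [] := simple_integral_mulgl h (hs n).
- move=> n; have := measurableT_comp (ms n) (mulgl_measurable h^-1%g).
  exact.
- rewrite (_ : (fun _ => _) = (fun n => \int[nu]_x (rnorm (f x - s n x))%:E)%E)//.
  apply/funext => n.
  rewrite (@haar_integral_mulgl h (fun x => (rnorm (f x - s n x))%:E))//.
  + exact/measurable_EFinP.
  + by move=> x; rewrite lee_fin rnorm_ge0.
- rewrite (_ : (fun _ => _) = (fun n => simple_integral nu (s n)))//.
  by apply/funext => n; have [] := simple_integral_mulgl h (hs n).
Qed.

(** * Integrals with parameters and Fubini *)

Lemma riemann_sum_bound (E : normedModType R[i]) (K : set G) tag (f : G -> E) (M : R) :
  compact K -> tagging tag -> (forall x, rnorm (f x) <= M) ->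
  rnorm (riemann_sum K tag f) <= M * fine (nu K).
Proof.
move=> cK ttag fM; have mK := compact_borel_measurable cK.
have hs := riemann_step_simple cK ttag f.
have M0 : 0 <= M by rewrite (le_trans (rnorm_ge0 (f 1%g))).
have s0 : simple_integrable nu (riemann_step K tag (fun=> 0 : E)).
  exact: riemann_step_simple.
have := simple_integral_dist hs s0; rewrite !riemann_stepE//.
rewrite [X in rnorm (_ - X)](_ : _ = 0) ?subr0 => [h|]; last first.
  by rewrite /riemann_sum big1// => -[y|] _ /=; rewrite scaler0.
rewrite -lee_fin (le_trans h)//.
apply: (@le_trans _ _ (\int[nu]_x (M%:E * (\1_(K : set (borel G)) x)%:E))%E).
  apply: ge0_le_integral => //.
  - by move=> x _; rewrite lee_fin rnorm_ge0.
  - by apply/measurable_EFinP; exact: (measurable_rnorm_simpleB hs s0).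
  - by apply/measurable_EFinP/measurable_funM.
  - move=> x _; rewrite -EFinM lee_fin indicE /riemann_step /=.
    case: (pselect (K x)) => Kx; first by rewrite mem_set//= subr0 mulr1.
    by rewrite memNset//= subr0 rnorm0 mulr0.
rewrite ge0_integralZl//; last exact/measurable_EFinP.
rewrite integral_indic// setIT EFinM fineK// ge0_fin_numE//.
exact: fin_compact.
Qed.

(** The tube lemma: near [(h, c)] both [F g h'] and [F c h'] are within [e / 2] of [F c h], and
    compactness of [K] gives one neighbourhood of [c] for all [h]. *)
Lemma tube_near (X : topologicalType) (E : normedModType R[i]) (K : set G)
    (F : X -> G -> E) (c : X) (e : R) :
  compact K -> continuous (fun z : G * X => F z.2 z.1) -> 0 < e ->
  \forall g \near c, forall h, K h -> rnorm (F g h - F c h) < e.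
Proof.
move=> /compact_near_coveringP cK Fc e0.
have := cK X (nbhs c) (fun g h => rnorm (F g h - F c h) < e) _; apply => h Kh.
have e2 : 0 < e / 2 by rewrite divr_gt0.
have /continuous_rnormP/(_ (h, c) _ e2)[[A B] /= [hA cB] AB] := Fc.
exists (A, B) => // -[h' g'] /= [Ah Bg].
rewrite (le_lt_trans (rnorm_tri (F c h) _ _))// (splitr e) ltrD//.
  exact: (AB (h', g')).
rewrite rnormB; apply: (AB (h', c)); split => //=.
exact: nbhs_singleton.
Qed.

Lemma cpt_supp_bint (X : topologicalType) (E : normedModType R[i]) (K : set G)
    (F : X -> G -> E) :
  seq_complete E -> compact K -> continuous (fun z : G * X => F z.2 z.1) ->
  (forall x h, ~ K h -> F x h = 0) ->
  (forall x, cpt_supp K (F x)) /\ continuous (fun x => bint (F x)).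
Proof.
move=> cE cK Fc F0.
have FK x : cpt_supp K (F x).
  split => // [h|h]; last exact: F0.
  apply: (@continuous_comp _ _ _ (fun h => (h, x)) (fun z : G * X => F z.2 z.1)).
    by apply: cvg_pair; [exact: cvg_id|exact: cvg_cst].
  exact: Fc.
split => //; apply/continuous_rnormP => c e e0.
(* The [+ 1] keeps the denominator positive when [K] has measure 0. *)
have C0 : 0 < fine (nu K) + 1 by rewrite ltr_wpDl// fine_ge0.
have := tube_near c cK Fc (divr_gt0 e0 C0); apply: filterS => x hx.
apply: (@le_lt_trans _ _ (e / (fine (nu K) + 1) * fine (nu K))).
  apply: bint_dist => // h; case: (pselect (K h)) => Kh; first exact/ltW/hx.
  by rewrite !F0// subrr rnorm0 divr_ge0// ltW.
by rewrite -mulrA gtr_pMr// mulrC ltr_pdivrMr// mul1r ltrDl.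
Qed.

(** There are two errors, each [e * nu K * nu K]: the outer Riemann error, since the inner integral
    oscillates by at most [e * nu K] on a cell, and the outer Riemann sum of the inner errors. *)
Lemma bint_bint_riemann (E : normedModType R[i]) (K : set G) (Phi : G -> G -> E)
    (tg th : G -> G) (e : R) :
  seq_complete E -> compact K -> continuous (fun z : G * G => Phi z.1 z.2) ->
  (forall h g, ~ (K h /\ K g) -> Phi h g = 0) ->
  tagging tg -> tagging th -> 0 <= e ->
  (forall h g, K g -> rnorm (Phi h g - Phi h (tg g)) <= e) ->
  (forall h g, K h -> rnorm (Phi h g - Phi (th h) g) <= e) ->
  rnorm (bint (fun g => bint (fun h => Phi h g)) -
    riemann_sum K tg (fun g => riemann_sum K th (fun h => Phi h g))) <=
  e * (fine (nu K) * fine (nu K) + fine (nu K) * fine (nu K)).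
Proof.
move=> cE cK Pc P0 ttg tth e0 hg hh.
have [PK bc] := @cpt_supp_bint G E K (fun g h => Phi h g) cE cK Pc
  (fun g h Kh => P0 h g (fun KK => Kh KK.1)).
have bK : cpt_supp K (fun g => bint (fun h => Phi h g)).
  split => // g Kg; apply/rnorm_le0.
  rewrite -(mul0r (fine (nu K))); apply: (bint_bound cE (PK g)) => h.
  by rewrite P0 ?rnorm0// => -[].
have nu0 : 0 <= fine (nu K) by exact: fine_ge0.
rewrite (le_trans (rnorm_tri (riemann_sum K tg (fun g => bint (fun h => Phi h g))) _ _))//.
rewrite mulrDr lerD//.
  rewrite mulrA; apply: bint_riemann => //; first exact: mulr_ge0.
  by move=> g Kg; apply: bint_dist => // h; exact: hg.
rewrite addrC -scaleN1r -riemann_sumP mulrA.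
apply: riemann_sum_bound => // g; rewrite scaleN1r addrC.
by apply: bint_riemann => // h Kh; exact: hh.
Qed.

Lemma riemann_sum_swap (E : normedModType R[i]) (K : set G) (tg th : G -> G)
    (Phi : G -> G -> E) :
  riemann_sum K tg (fun g => riemann_sum K th (fun h => Phi h g)) =
  riemann_sum K th (fun h => riemann_sum K tg (fun g => Phi h g)).
Proof.
rewrite /riemann_sum.
set A := fset_set _; set B := fset_set _.
pose c w := (fine (nu ((fun x : borel G => if x \in K then Some (tg x) else None) @^-1` [set w])))%:C.
pose d v := (fine (nu ((fun x : borel G => if x \in K then Some (th x) else None) @^-1` [set v])))%:C.
transitivity (\sum_(w <- A) \sum_(v <- B)
    (c w * d v) *: oapp (fun g => oapp (Phi^~ g) 0 v) 0 w).
  apply: eq_bigr => -[g|] _ /=.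
    by rewrite scaler_sumr; apply: eq_bigr => v _; rewrite scalerA.
  by rewrite scaler0 big1// => v _; rewrite scaler0.
rewrite exchange_big; apply: eq_bigr => -[h|] _ /=.
  rewrite scaler_sumr; apply: eq_bigr => -[g|] _ /=; first by rewrite scalerA mulrC.
  by rewrite !scaler0.
by rewrite scaler0 big1// => -[g|] _; rewrite scaler0.
Qed.

(** Both iterated integrals are close to the same finite double sum. The tags of each variable come
    from [tube_near], so that they are good uniformly in the other variable. *)
Lemma bint_fubini (E : normedModType R[i]) (K : set G) (Phi : G -> G -> E) :
  seq_complete E -> compact K -> continuous (fun z : G * G => Phi z.1 z.2) ->
  (forall h g, ~ (K h /\ K g) -> Phi h g = 0) ->
  bint (fun g => bint (fun h => Phi h g)) = bint (fun h => bint (fun g => Phi h g)).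
Proof.
move=> cE cK Pc P0.
have Pc' : continuous (fun z : G * G => Phi z.2 z.1).
  move=> z; apply: (@continuous_comp _ _ _ (fun z : G * G => (z.2, z.1))
    (fun z : G * G => Phi z.1 z.2)); last exact: Pc.
  by apply: cvg_pair; [exact: cvg_snd|exact: cvg_fst].
set C := fine (nu K) * fine (nu K) + fine (nu K) * fine (nu K).
apply: (@rnorm_small_eq _ _ _ (C + C)) => e e0.
have [|tg ttg htg] := @tagging_compact K
    (fun c g => forall h, K h -> rnorm (Phi h g - Phi h c) < e) cK.
  by move=> c; exact: (@tube_near _ _ _ (fun g h => Phi h g)).
have [|th tth hth] := @tagging_compact K
    (fun c h => forall g, K g -> rnorm (Phi h g - Phi c g) < e) cK.
  by move=> c; exact: (@tube_near _ _ _ (fun h g => Phi h g)).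
have e0' := ltW e0.
have hg h g : K g -> rnorm (Phi h g - Phi h (tg g)) <= e.
  move=> Kg; case: (pselect (K h)) => Kh; first exact/ltW/htg.
  by rewrite !P0 ?subrr ?rnorm0// => -[].
have hh h g : K h -> rnorm (Phi h g - Phi (th h) g) <= e.
  move=> Kh; case: (pselect (K g)) => Kg; first exact/ltW/hth.
  by rewrite !P0 ?subrr ?rnorm0// => -[].
have swap : riemann_sum K tg (fun g => riemann_sum K th (fun h => Phi h g)) =
    riemann_sum K th (fun h => riemann_sum K tg (fun g => Phi h g)).
  exact: riemann_sum_swap.
rewrite (le_trans (rnorm_tri
  (riemann_sum K tg (fun g => riemann_sum K th (fun h => Phi h g))) _ _))//.
rewrite mulrDr lerD//; first exact: bint_bint_riemann.
rewrite rnormB swap.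
apply: (@bint_bint_riemann E K (fun g h => Phi h g)) => //.
- by move=> h g KK; apply: P0 => -[? ?]; exact: KK.
- by move=> h g; exact: hh.
- by move=> h g; exact: hg.
Qed.

End bochner_continuous.

(** * Complex L^p spaces *)

Local Open Scope quotient_scope.

Section Lp_facts.
Context d (T : measurableType d) (R : realType).
Variables (mu : {measure set T -> \bar R}) (p : R) (p1 : 1 <= p).

Let p0 : 0 < p. Proof. exact: lt_le_trans p1. Qed.

(** The p-th power of the norm: without the root, Tonelli, Fatou and dominated convergence apply
    directly. *)
Definition Lp_power (F : T -> R[i]) : \bar R :=
  (\int[mu]_x (rnorm (F x) `^ p)%:E)%E.

Lemma Lp_power_ge0 F : (0 <= Lp_power F)%E.
Proof. by apply: integral_ge0 => x _; rewrite lee_fin powR_ge0. Qed.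

Lemma cLnormE F : cLnorm mu p F = (Lp_power F `^ p^-1)%E.
Proof.
rewrite /cLnorm unlock /Lnorm /Lp_power; apply: (congr1 (fun z => (z `^ p^-1)%E)).
by apply: eq_integral => x _ /=; rewrite ger0_norm ?rnorm_ge0.
Qed.

Lemma cLnorm_lty F : ((cLnorm mu p F < +oo) = (Lp_power F < +oo))%E.
Proof.
rewrite cLnormE; apply/idP/idP => [|/poweR_lty]; last exact.
by apply: lty_poweRy; rewrite invr_eq0 gt_eqF.
Qed.

Lemma cmeasurableP (k : R[i]) (F H : T -> R[i]) :
  cmeasurable F -> cmeasurable H -> cmeasurable (fun x => k *: F x + H x : R[i]^o).
Proof.
move=> [Fr Fi] [Hr Hi]; split.
  rewrite (_ : (fun _ => _) = (fun x => complex.Re k * complex.Re (F x) -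
      complex.Im k * complex.Im (F x) + complex.Re (H x))).
    by apply: measurable_funD => //; apply: measurable_funB; apply: measurable_funM.
  by apply/funext => x; rewrite raddfD/=; case: k (F x) => [a b] [c e].
rewrite (_ : (fun _ => _) = (fun x => complex.Re k * complex.Im (F x) +
      complex.Im k * complex.Re (F x) + complex.Im (H x))).
  by apply: measurable_funD => //; apply: measurable_funD; apply: measurable_funM.
by apply/funext => x; rewrite raddfD/=; case: k (F x) => [a b] [c e].
Qed.

Lemma cmeasurableB (F H : T -> R[i]) :
  cmeasurable F -> cmeasurable H -> cmeasurable (fun x => F x - H x).
Proof.
move=> mF mH; have := cmeasurableP (-1) mH mF.
by congr cmeasurable; apply/funext => x; rewrite scaleN1r addrC.
Qed.

Lemma cmeasurable_cst (c : R[i]) : cmeasurable (fun _ : T => c).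
Proof. by split; exact: measurable_cst. Qed.

Lemma Lp_power0 : Lp_power (fun=> 0) = 0.
Proof.
by apply: integral0_eq => x _; rewrite rnorm0 powR0// gt_eqF.
Qed.

Lemma measurable_power (F : T -> R[i]) : cmeasurable F ->
  measurable_fun setT (fun x => (rnorm (F x) `^ p)%:E).
Proof.
move=> /measurable_rnorm mF; apply/measurable_EFinP.
by apply: (@measurableT_comp _ _ _ _ _ _ (@powR R ^~ p)).
Qed.

Lemma eq_ae_power (F H : T -> R[i]) : cmeasurable F -> cmeasurable H ->
  {ae mu, forall x, F x = H x} -> Lp_power F = Lp_power H.
Proof.
move=> mF mH FH; apply: ge0_ae_eq_integral => //; try exact: measurable_power.
- by move=> x _; rewrite lee_fin powR_ge0.
- by move=> x _; rewrite lee_fin powR_ge0.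
by apply: filterS FH => x FHx _ /=; rewrite FHx.
Qed.

Lemma Lp_power_eq0 (F : T -> R[i]) : cmeasurable F -> Lp_power F = 0 -> {ae mu, forall x, F x = 0}.
Proof.
move=> mF F0.
have : (\int[mu]_x `|(rnorm (F x) `^ p)%:E| = 0)%E.
  by rewrite -[RHS]F0; apply: eq_integral => x _; rewrite gee0_abs// lee_fin powR_ge0.
move/(ae_eq_integral_abs _ measurableT (measurable_power mF)).
apply: filterS => x /(_ I)[/eqP]; rewrite powR_eq0 => /andP[/eqP x0 _].
exact: rnorm_eq0.
Qed.

Notation Lp := (Lp mu p1).

Lemma Lp_cmeasurable (f : Lp) : cmeasurable (Lp_fun f).
Proof. by have [] := cLfunP (repr f). Qed.

Lemma Lp_power_lty (f : Lp) : (Lp_power (Lp_fun f) < +oo)%E.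
Proof. by rewrite -cLnorm_lty; have [] := cLfunP (repr f). Qed.

Lemma rnorm_LpE (f : Lp) : ((rnorm f `^ p)%:E = Lp_power (Lp_fun f))%E.
Proof.
rewrite -{1}[f]reprK hquot_rnorm /= -poweR_EFin.
rewrite fineK; last first.
  rewrite ge0_fin_numE ?Lnorm_ge0//; by have [] := cLfunP (repr f).
by rewrite cLnormE -poweRrM mulVf ?gt_eqF// poweRe1// Lp_power_ge0.
Qed.

(** The chosen representative differs from [u] by a function of seminorm 0, which vanishes almost
    everywhere. *)
Lemma Lp_fun_pi (u : cLfun mu p) :
  {ae mu, forall x, Lp_fun (\pi_(Lp) u) x = u x}.
Proof.
have h := hquotK (Lp_seminorm mu p1) u.
have [mu1 fu1] := cLfunP (repr (\pi_(Lp) u) - u).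
move: h => /= /eqP; rewrite fine_eq0 ?ge0_fin_numE ?Lnorm_ge0// => /eqP.
rewrite cLnormE => /eqP; rewrite poweR_eq0 ?Lp_power_ge0// => /andP[/eqP h _].
have := Lp_power_eq0 mu1 h; apply: filterS => x /eqP.
by rewrite subr_eq0 => /eqP.
Qed.

Lemma Lp_mk (F : T -> R[i]) : cmeasurable F -> (Lp_power F < +oo)%E ->
  exists f : Lp, {ae mu, forall x, Lp_fun f x = F x}.
Proof.
move=> mF Fy; have hF : F \in cLfun_pred mu p by apply/asboolP; rewrite cLnorm_lty.
by exists (\pi_(Lp) (CLfun hF)); exact: Lp_fun_pi.
Qed.

(** Choosing representatives is linear only almost everywhere; every computation with [Lp_fun] goes
    through this. *)
Lemma Lp_funP (k : R[i]) (f g : Lp) :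
  {ae mu, forall x, Lp_fun (k *: f + g) x = k * Lp_fun f x + Lp_fun g x}.
Proof.
have -> : k *: f + g = \pi_(Lp) (k *: repr f + repr g).
  by rewrite -hquot_piD -hquot_piZ !reprK.
exact: (Lp_fun_pi (k *: repr f + repr g)).
Qed.

Lemma Lp_funB (f g : Lp) :
  {ae mu, forall x, Lp_fun (f - g) x = Lp_fun f x - Lp_fun g x}.
Proof.
rewrite -[f - g]addrC -scaleN1r.
by apply: filterS (Lp_funP (-1) g f) => x ->; rewrite mulN1r addrC.
Qed.

Lemma rnorm_LpB (f g : Lp) :
  ((rnorm (f - g) `^ p)%:E = Lp_power (fun x => Lp_fun f x - Lp_fun g x)%R)%E.
Proof.
rewrite rnorm_LpE; apply: eq_ae_power; last exact: Lp_funB.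
  exact: Lp_cmeasurable.
by apply: cmeasurableB; exact: Lp_cmeasurable.
Qed.

Lemma Lp_eq (f g : Lp) : {ae mu, forall x, Lp_fun f x = Lp_fun g x} -> f = g.
Proof.
move=> fg; apply/eqP; rewrite -subr_eq0; apply/eqP/rnorm_eq0/eqP.
suff : (rnorm (f - g) `^ p) == 0 by rewrite powR_eq0 => /andP[].
rewrite -eqe rnorm_LpB; apply/eqP; rewrite -[RHS]Lp_power0; apply: eq_ae_power.
- by apply: cmeasurableB; exact: Lp_cmeasurable.
- exact: cmeasurable_cst.
- by apply: filterS fg => x ->; rewrite subrr.
Qed.

Lemma ler_rnorm_Lp (f g : Lp) (C : R) : 0 <= C ->
  (Lp_power (Lp_fun f) <= (C `^ p)%:E * Lp_power (Lp_fun g))%E ->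
  rnorm f <= C * rnorm g.
Proof.
move=> C0; rewrite -!rnorm_LpE -EFinM lee_fin -powRM ?rnorm_ge0//.
rewrite !leNgt; apply: contra => h.
by apply: gt0_ltr_powR; rewrite ?nnegrE ?mulr_ge0 ?rnorm_ge0.
Qed.

(** * Completeness of L^p *)

Lemma rnorm_le_ReIm (z : R[i]) : rnorm z <= `|complex.Re z| + `|complex.Im z|.
Proof.
rewrite -lecR rnormE normc_def lecR -ler_sqr ?nnegrE ?addr_ge0 ?sqrtr_ge0//.
rewrite sqr_sqrtr ?addr_ge0 ?sqr_ge0// sqrrD !real_normK ?num_real//.
by rewrite addrAC lerDl mulrn_wge0// mulr_ge0.
Qed.

Lemma Re_le_rnorm (z : R[i]) : `|complex.Re z| <= rnorm z.
Proof.
rewrite -lecR rnormE normc_def lecR -ler_sqr ?nnegrE ?sqrtr_ge0//.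
rewrite sqr_sqrtr ?addr_ge0 ?sqr_ge0// real_normK ?num_real//.
by rewrite lerDl sqr_ge0.
Qed.

Lemma Im_le_rnorm (z : R[i]) : `|complex.Im z| <= rnorm z.
Proof.
rewrite -lecR rnormE normc_def lecR -ler_sqr ?nnegrE ?sqrtr_ge0//.
rewrite sqr_sqrtr ?addr_ge0 ?sqr_ge0// real_normK ?num_real//.
by rewrite lerDr sqr_ge0.
Qed.

Lemma cvg_geometric_increments (a : nat -> R) (M : R) :
  (forall n, `|a n.+1 - a n| <= M / 2 ^+ n.+1) -> cvgn a.
Proof.
move=> ha.
have e2 n : M / 2 ^+ n = M / 2 ^+ n.+1 + M / 2 ^+ n.+1 :> R.
  rewrite exprS invfM mulrCA -mulrDl.
  by rewrite (_ : 2^-1 + 2^-1 = 1 :> R) ?mul1r//; lra.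
(* The geometric tail is written as a difference so that the bound telescopes in the induction on
   [j]. *)
have hj n j : `|a (n + j)%N - a n| <= M / 2 ^+ n - M / 2 ^+ (n + j).
  elim: j => [|j IH]; first by rewrite addn0 !subrr normr0.
  rewrite addnS (le_trans (ler_distD (a (n + j)%N) _ _))//.
  have := ha (n + j)%N; have := e2 (n + j)%N; move: IH; lra.
have M0 : 0 <= M by have := le_trans (normr_ge0 _) (ha 0); rewrite pmulr_lge0.
apply/cauchy_cvgP/cauchyP => e e0.
have Me : (fun n => M * (2^-1 ^+ n) : R^o) @ \oo --> (M * 0 : R^o).
  by apply: cvgMr; apply: cvg_expr; rewrite ger0_norm ?invf_lt1 ?ltr1n.
move: Me; rewrite mulr0 => /cvgrPdist_lt/(_ _ e0)[N _ hN].
exists (a N), N => // n /= Nn; rewrite -ball_normE/= distrC -(subnKC Nn).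
rewrite (le_lt_trans (hj N _))// (le_lt_trans _ (hN N (leqnn N)))//.
rewrite sub0r normrN exprVn (le_trans _ (ler_norm _))// lerBlDr lerDl.
by rewrite divr_ge0// exprn_ge0.
Qed.

Lemma cvg_powR (y : nat -> R) (l : R) : 0 < l -> y @ \oo --> l ->
  (fun n => y n `^ p) @ \oo --> l `^ p.
Proof.
move=> l0 yl; apply: (@continuous_cvg _ _ _ _ _ _ (@powR R ^~ p)) => //.
apply: differentiable_continuous; apply/derivable1_diffP.
by apply: derivable_powR; rewrite in_itv/= l0.
Qed.

Lemma powR_le_limn_einf (y : nat -> R) (l : R) : (forall n, 0 <= y n) -> y @ \oo --> l ->
  ((l `^ p)%:E <= limn_einf (fun n => (y n `^ p)%:E))%E.
Proof.
move=> y0 yl; have l0 : 0 <= l.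
  by apply: (ler_cvg_to (cvg_cst (0 : R)) yl); exact: nearW.
(* Continuity of the power is used only at a positive limit; for [l = 0] nonnegativity of the terms
   is enough. *)
move: l0; rewrite le_eqVlt => /orP[/eqP <-|l0].
  rewrite powR0 ?gt_eqF// limn_einf_lim; apply: lime_ge; first exact: is_cvg_einfs.
  apply: nearW => n; apply/ereal_infP => _ [m _ <-].
  by rewrite lee_fin powR_ge0.
have h : (fun n => (y n `^ p)%:E) @ \oo --> (l `^ p)%:E.
  by apply: cvg_EFin; [exact: nearW|exact: cvg_powR].
by rewrite (cvg_limn_einf_sup h).1.
Qed.

Lemma measurable_limn_einf (f : nat -> T -> \bar R) :
  (forall n, measurable_fun setT (f n)) ->
  measurable_fun setT (fun x => limn_einf (f^~ x)).
Proof.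
move=> mf; rewrite (_ : (fun _ => _) = (fun x => - limn_esup (fun n => - f n x))%E).
  apply: measurableT_comp => //; apply: measurable_fun_limn_esup => n.
  exact: measurableT_comp.
apply/funext => x; rewrite -limn_einfN; congr limn_einf.
by apply/funext => n /=; rewrite oppeK.
Qed.

Lemma ae_bounded_increments (w : nat -> T -> R[i]) :
  (forall n, cmeasurable (w n)) ->
  (forall n, (Lp_power (fun x => w n.+1 x - w n x)%R <=
              (((4^-1 ^+ n.+1) `^ p)%R)%:E)%E) ->
  {ae mu, forall x, exists M : R,
    forall n, rnorm (w n.+1 x - w n x) <= M / 2 ^+ n.+1}.
Proof.
move=> mw hw.
(* The weight [2 ^+ n.+1] turns the bound [4^-1 ^+ n.+1] into [2^-1 ^+ n.+1], still summable; since
   [1 <= p], the power only decreases it. *)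
pose f n x := (((2 ^+ n.+1 * rnorm (w n.+1 x - w n x)) `^ p)%R)%:E.
have mf n : measurable_fun setT (f n).
  apply/measurable_EFinP; apply: (@measurableT_comp _ _ _ _ _ _ (@powR R ^~ p)) => //.
  apply: measurable_funM => //; apply: measurable_rnorm.
  exact: cmeasurableB.
have f0 n x : (0 <= f n x)%E by rewrite lee_fin powR_ge0.
have intf n : (\int[mu]_x f n x <= (1 / (2 ^ n.+1)%:R)%:E)%E.
  have -> : (\int[mu]_x f n x = (((2 ^+ n.+1) `^ p)%R)%:E *
      Lp_power (fun x => w n.+1 x - w n x)%R)%E.
    rewrite -ge0_integralZl//.
    - by apply: eq_integral => x _; rewrite -EFinM -powRM ?exprn_ge0 ?rnorm_ge0.
    - exact/measurable_power/cmeasurableB.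
    - by move=> x _; rewrite lee_fin powR_ge0.
  apply: (le_trans (lee_wpmul2l _ (hw n))); first by rewrite lee_fin powR_ge0.
  rewrite -EFinM lee_fin -powRM ?exprn_ge0// -exprMn.
  rewrite (_ : 2 * 4^-1 = 2^-1); last by lra.
  rewrite div1r natrX -exprVn; apply: ge1r_powR => //.
  by rewrite exprn_gt0//= exprn_ile1// invf_le1// ler1n.
pose S x := (\sum_(0 <= n <oo) f n x)%E.
have Sint : mu.-integrable setT S.
  apply/integrableP; split; first exact: ge0_emeasurable_sum.
  apply: (@le_lt_trans _ _ (\int[mu]_x S x)%E).
    rewrite (@eq_integral _ _ _ _ _ S)// => x _; rewrite gee0_abs//.
    exact: nneseries_ge0.
  rewrite integral_nneseries//.
  apply: (@le_lt_trans _ _ (\sum_(0 <= n <oo) (1 / (2 ^ n.+1)%:R)%:E)%E).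
    by apply: lee_nneseries => // n _ _; exact: integral_ge0.
  by apply: (le_lt_trans (epsilon_trick0 xpredT ler01)); rewrite ltry.
have := integrable_ae measurableT Sint.
(* The 1 covers weighted increments at most 1; a larger one is at most its p-th power, which is a
   term of the series [S x]. *)
apply: filterS => x /(_ I) Sfin; exists (1 + fine (S x)) => n.
rewrite ler_pdivlMr ?exprn_gt0// mulrC.
have fS : (f n x <= S x)%E.
  apply: (le_trans _ (nneseries_lim_ge n.+1 _)) => //.
  by rewrite big_nat_recr//= leeDr// sume_ge0.
have S0 : 0 <= fine (S x) by rewrite fine_ge0// nneseries_ge0.
have [y1|/ltW y1] := leP (2 ^+ n.+1 * rnorm (w n.+1 x - w n x)) 1.
  by rewrite (le_trans y1)// lerDl.
rewrite (le_trans (le1r_powR y1 p1))// (@le_trans _ _ (fine (S x)))// ?lerDr//.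
by rewrite -lee_fin fineK.
Qed.

(** Riesz-Fischer: a fast subsequence converges almost everywhere, Fatou gives convergence in norm,
    and the Cauchy property carries it to the whole sequence. *)
Lemma Lp_complete : seq_complete Lp.
Proof.
move=> u hu.
pose del n : R := 4^-1 ^+ n.+1.
have del0 n : 0 < del n by rewrite exprn_gt0.
have /choice[K hK] n : exists k : nat, forall m m',
    (k <= m)%N -> (k <= m')%N -> rnorm (u m - u m') < del n by exact: hu.
(* The maximum ensures [K n <= k m] for all [n <= m], so [del n] bounds the distance of [w n] to
   every later [w m]. *)
pose k n := (\max_(i < n.+1) K i)%N.
have Kk n m : (n <= m)%N -> (K n <= k m)%N.
  by move=> nm; exact: (leq_bigmax_cond (Ordinal (nm : (n < m.+1)%N))).
pose w n := Lp_fun (u (k n)).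
have mw n : cmeasurable (w n) by exact: Lp_cmeasurable.
have hw n m : (n <= m)%N ->
    (Lp_power (fun x => w m x - w n x)%R <= ((del n `^ p)%R)%:E)%E.
  move=> nm; rewrite -rnorm_LpB lee_fin ge0_ler_powR ?nnegrE ?rnorm_ge0 ?ltW//.
  by apply: hK; exact: Kk.
have := ae_bounded_increments mw (fun n => hw n n.+1 (leqnSn n)).
(* Upper limits are measurable wherever the sequence behaves badly, and agree with the limit almost
   everywhere. *)
pose a x := fine (limn_esup (fun n => (complex.Re (w n x))%:E)).
pose b x := fine (limn_esup (fun n => (complex.Im (w n x))%:E)).
pose F x : R[i] := (a x +i* b x)%C.
have mF : cmeasurable F.
  split => /=; apply: (measurableT_comp (@fine_measurable R setT measurableT));
    apply: measurable_fun_limn_esup => n; apply/measurable_EFinP;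
    by case: (mw n).
have limF x : (exists M : R, forall n, rnorm (w n.+1 x - w n x) <= M / 2 ^+ n.+1) ->
    (fun n => rnorm (w n x - F x)) @ \oo --> 0.
  move=> [M hM].
  have cv (g : R[i] -> R) (gE : {morph g : x y / x - y}) :
      (forall z, `|g z| <= rnorm z) ->
      (fun n => g (w n x)) @ \oo --> fine (limn_esup (fun n => (g (w n x))%:E)).
    move=> gle; have : cvgn (fun n => g (w n x)).
      apply: (@cvg_geometric_increments _ M) => n; rewrite -gE.
      exact: le_trans (gle _) (hM n).
    move=> /cvg_ex[l gl].
    have gl' : (fun n => (g (w n x))%:E) @ \oo --> l%:E.
      by apply: cvg_EFin => //; exact: nearW.
    by rewrite (cvg_limn_einf_sup gl').2.
  have ha : (fun n => complex.Re (w n x)) @ \oo --> a x.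
    by apply: cv; [exact: raddfB|exact: Re_le_rnorm].
  have hb : (fun n => complex.Im (w n x)) @ \oo --> b x.
    by apply: cv; [exact: raddfB|exact: Im_le_rnorm].
  apply: (@squeeze_cvgr _ _ _ _ (fun=> 0) (fun n => `|complex.Re (w n x) - a x| +
      `|complex.Im (w n x) - b x|)).
  - apply: nearW => n; rewrite rnorm_ge0/=.
    by apply: (le_trans (rnorm_le_ReIm _)); rewrite !raddfB.
  - exact: cvg_cst.
  - rewrite -[X in _ --> X](addr0 0); apply: cvgD.
      by rewrite -[X in _ --> X](@normr0 _ R) -(subrr (a x)); apply: cvg_norm; apply: cvgB => //; exact: cvg_cst.
    by rewrite -[X in _ --> X](@normr0 _ R) -(subrr (b x)); apply: cvg_norm; apply: cvgB => //; exact: cvg_cst.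
move=> aeM.
have hF n : (Lp_power (fun x => F x - w n x)%R <= ((del n `^ p)%R)%:E)%E.
  pose g m x := ((rnorm (w (m + n)%N x - w n x) `^ p)%R)%:E.
  have mg m : measurable_fun setT (g m) by exact/measurable_power/cmeasurableB.
  have g0 m x : (0 <= g m x)%E by rewrite lee_fin powR_ge0.
  apply: (@le_trans _ _ (\int[mu]_x limn_einf (g^~ x))%E).
    apply: ae_ge0_le_integral => //.
    - by move=> x _; rewrite lee_fin powR_ge0.
    - exact/measurable_power/cmeasurableB.
    - move=> x _; rewrite limn_einf_lim; apply: lime_ge; first exact: is_cvg_einfs.
      by apply: nearW => m; apply/ereal_infP => _ [j _ <-].
    - exact: measurable_limn_einf.
    - apply: filterS aeM => x /limF wF _; apply: powR_le_limn_einf.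
        by move=> m; exact: rnorm_ge0.
      have wF' : (fun m => rnorm (w (m + n)%N x - F x)) @ \oo --> 0.
        by move: wF; rewrite -(cvg_shiftn n).
      apply/cvgrPdist_lt => e e0; move/cvgrPdist_lt : wF' => /(_ _ e0).
      apply: filterS => m; rewrite sub0r normrN ger0_norm ?rnorm_ge0// => h.
      rewrite distrC; apply: le_lt_trans h.
      apply: (le_trans (@rnorm_dist R R[i]^o (w (m + n)%N x - w n x) (F x - w n x))).
      by rewrite opprB addrA subrK.
  apply: (le_trans (fatou _ _ _ _)) => //.
  rewrite limn_einf_lim; apply: lime_le; first exact: is_cvg_einfs.
  apply: nearW => m; apply: le_trans (hw n (m + n)%N (leq_addl _ _)).
  by apply: ereal_inf_lbound; exists m => //=.
have [l hl] : exists l : Lp, {ae mu, forall x, Lp_fun l x = F x}.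
  (* [hF] bounds only differences, so the class of [F] is built from [F - w 0] by adding [u (k 0)]
     back. *)
  have [g hg] : exists g : Lp, {ae mu, forall x, Lp_fun g x = F x - w 0 x}.
    apply: Lp_mk; first exact: cmeasurableB.
    by apply: (le_lt_trans (hF 0)); rewrite ltry.
  exists (1 *: g + u (k 0)).
  by apply: filterS2 hg (Lp_funP 1 g (u (k 0))) => x -> ->; rewrite mul1r subrK.
have lk n : rnorm (u (k n) - l) <= del n.
  rewrite rnormB leNgt; apply/negP => h.
  have := hF n; rewrite -(@eq_ae_power (fun x => Lp_fun l x - w n x)); last 3 first.
  - by apply: cmeasurableB => //; exact: Lp_cmeasurable.
  - exact: cmeasurableB.
  - by apply: filterS hl => x ->.
  rewrite -rnorm_LpB lee_fin leNgt => /negP; apply.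
  by apply: gt0_ltr_powR; rewrite ?nnegrE ?rnorm_ge0 ?ltW.
exists l; apply/cvg_rnormP => e e0.
have [N hN] : exists N, del N < e / 2.
  have : (fun n => del n : R^o) @ \oo --> (0 : R^o).
    have : (fun n => 4^-1 ^+ n : R^o) @ \oo --> (0 : R^o).
      by apply: cvg_expr; rewrite ger0_norm ?invf_lt1 ?ltr1n.
    by rewrite -(cvg_shiftS).
  have e2 : 0 < e / 2 by rewrite divr_gt0.
  move=> /cvgrPdist_lt/(_ _ e2)[N _ /(_ N (leqnn N))/=].
  by rewrite sub0r normrN gtr0_norm// => h; exists N.
exists (K N) => // m /= Km.
rewrite (le_lt_trans (rnorm_tri (u (k N)) _ _))// (splitr e) ltrD//.
  by apply: lt_trans hN; apply: hK => //; exact: Kk.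
exact: le_lt_trans (lk N) hN.
Qed.

End Lp_facts.

(** * Density in L^p *)

Section locally_compact.
Context (R : realType) (G : ptopologicalType).
Hypotheses (T2 : hausdorff_space G) (lcG : locally_compact [set: G]).

(** Finitely many interiors of compact neighbourhoods cover [K]; their union, cut down to [U], has
    its closure in a compact set. *)
Lemma compact_open_between (K U : set G) : compact K -> open U -> K `<=` U ->
  exists V, [/\ open V, K `<=` V, V `<=` U & compact (closure V)].
Proof.
move=> cK oU KU.
have hC0 (x : G) : exists C : set G, [/\ nbhs x C, compact C & closed C].
  by have [C] := @lcG x I; rewrite withinET => Cx [cC clC]; exists C.
have [C hC] := choice hC0.
have := cK; rewrite {1}compact_cover => /(_ G setT (fun x => interior (C x))).
case=> [x _|x Kx|D _ KD]; first exact: open_interior.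
  by exists x => //; have [] := hC x.
exists (U `&` \bigcup_(x in [set` D]) interior (C x)); split.
- apply: openI => //; apply: bigcup_open => x _; exact: open_interior.
- by move=> x Kx; split; [exact: KU|exact: KD].
- by move=> x [].
- have cD : compact (\bigcup_(x in [set` D]) C x).
    rewrite -bigsetU_fset_set//; elim/big_ind : _ => //.
    + exact: compact0.
    + by move=> A B; exact: compactU.
    + by move=> x _; have [] := hC x.
  have clD := compact_closed T2 cD.
  apply: subclosed_compact cD _; first exact: closed_closure.
  rewrite [X in _ `<=` X](closure_id _).1//.
  by apply: closureS => x [_ [y Dy Cy]]; exists y => //; exact: interior_subset.
Qed.

(** The one-point compactification is compact Hausdorff, hence normal. Separating [K] from the
    complement of a relatively compact [V], which contains the point at infinity, forces compact
    support. *)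
Lemma compact_urysohn (K U : set G) : compact K -> open U -> K `<=` U ->
  exists f : G -> R, [/\ continuous (f : G -> R^o), forall x, 0 <= f x <= 1,
    forall x, K x -> f x = 1, forall x, ~ U x -> f x = 0 &
    compact (closure [set x | f x != 0])].
Proof.
move=> cK oU KU; have [V [oV KV VU cV]] := compact_open_between cK oU KU.
have nopc : normal_space (one_point_compactification G).
  apply: compact_normal.
    exact: one_point_compactification_hausdorff.
  exact: one_point_compactification_compact.
have Sc : continuous (Some : G -> one_point_compactification G).
  exact: one_point_compactification_some_continuous.
have clK : closed (Some @` K : set (one_point_compactification G)).
  apply: compact_closed; first exact: one_point_compactification_hausdorff.
  by apply: continuous_compact => //; exact: continuous_subspaceT.
have clV : closed (~` (Some @` V) : set (one_point_compactification G)).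
  apply: open_closedC; exact: one_point_compactification_open_some.
have /(@uniform_separatorP _ R)[f [fc f01 f0 f1]] : uniform_separator
    (~` (Some @` V) : set (one_point_compactification G)) (Some @` K).
  apply: (proj1 (@normal_separatorP R _)) => //.
  by apply/disjoints_subset => x nV [y Ky yx]; apply: nV; exists y => //; exact: KV.
have fV x : ~ V x -> f (Some x) = 0.
  by move=> Vx; apply: f0; exists (Some x) => // -[y Vy [yx]]; apply: Vx; rewrite -yx.
exists (f \o Some); split.
- by move=> x; apply: continuous_comp; [exact: Sc|exact: fc].
- by move=> x; have := f01 (f (Some x)); rewrite /= in_itv/=; apply; exists (Some x).
- by move=> x Kx /=; apply: f1; exists (Some x) => //; exists x.
- by move=> x Ux; apply: fV => /VU.
- apply: subclosed_compact cV _; first exact: closed_closure.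
  by apply: closureS => x /=; apply: contraNP => /fV ->.
Qed.

(** Basic open sets inside compact neighbourhoods have finite measure and already cover. Indexed by
    the injection [f], each [F n] is one such set or empty. *)
Lemma haar_sigma_finite (nu : {measure set (borel G) -> \bar R}) :
  @second_countable G -> (forall K : set G, compact K -> (nu K < +oo)%E) ->
  sigma_finite setT nu.
Proof.
move=> [B /countable_injP[f finj] [Bo Bnbhs]] fin_compact.
pose B' n : set (set G) := [set b | [/\ B b, (nu b < +oo)%E & f b = n]].
pose F n : set G := \bigcup_(b in B' n) b.
have oF n : open (F n) by apply: bigcup_open => b [Bb _ _]; exact: Bo.
exists F.
  apply/seteqP; split => // x _.
  have [C] := @lcG x I; rewrite withinET => Cx [cC clC].
  have [b [Bb bx] bC] := Bnbhs x C Cx.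
  exists (f b) => //; exists b => //; split => //.
  apply: le_lt_trans (fin_compact C cC); apply: le_measure => //; rewrite inE.
    by apply: sub_sigma_algebra; exact: Bo.
  have mC : measurable (~` C : set (borel G)).
    by apply: sub_sigma_algebra; exact: closed_openC.
  by rewrite -[C]setCK; exact: measurableC.
move=> n; split; first exact: sub_sigma_algebra.
have [[b Bb]|n0] := pselect (exists b, B' n b).
  suff -> : F n = b by case: Bb.
  apply/seteqP; split => [x [c [Bc _ cn] cx]|x bx]; last by exists b.
  by case: Bb => Bb _ bn; rewrite (finj b c)// ?inE// bn cn.
suff -> : F n = set0 by rewrite measure0.
by apply/seteqP; split => // x [b Bb _]; apply: n0; exists b.
Qed.

End locally_compact.

Section sigma_finite_copy.
Context d (T : measurableType d) (R : realType).
Variables (mu : {measure set T -> \bar R}) (sf : sigma_finite setT mu).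

(* Tonelli asks for a canonical sigma-finite structure, but the Haar measure is
   only given as a plain measure. *)
Definition sigma_finite_copy of sigma_finite setT mu : set T -> \bar R := mu.
HB.instance Definition _ := Measure.on (sigma_finite_copy sf).
HB.instance Definition _ :=
  Measure_isSigmaFinite.Build d T R (sigma_finite_copy sf) sf.

End sigma_finite_copy.

Section haar_product.
Context (R : realType) (p : R) (p1 : 1 <= p) (G : topologicalGroupType).
Variable nu : {measure set (borel G) -> \bar R}.
Hypothesis sfnu : sigma_finite setT nu.
Context d (X0 : measurableType d) (mu0 : {sigma_finite_measure set X0 -> \bar R}).

Lemma haar_tonelli (F : borel G * X0 -> \bar R) :
  measurable_fun setT F -> (forall z, 0 <= F z)%E ->
  (\int[(nu \x mu0)%E]_z F z = \int[nu]_h \int[mu0]_x F (h, x))%E.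
Proof. exact: (@fubini_tonelli1 _ _ _ _ _ (sigma_finite_copy sfnu) mu0). Qed.

Lemma haar_measurable_section (F : borel G * X0 -> \bar R) :
  measurable_fun setT F -> (forall z, 0 <= F z)%E ->
  measurable_fun setT (fun h => \int[mu0]_x F (h, x))%E.
Proof.
exact: (@measurable_fun_fubini_tonelli_F _ _ _ _ _ mu0).
Qed.

End haar_product.

(** * Closed subspaces of L^p with enough indicators *)

Section Lp_density.
Context d (T : measurableType d) (R : realType).
Variables (mu : {measure set T -> \bar R}) (p : R) (p1 : 1 <= p).
Local Notation Lp := (Lp mu p1).

Let p0 : 0 < p. Proof. exact: lt_le_trans p1. Qed.

Lemma Lp_power_dominated (s : nat -> T -> R[i]) (F : T -> R[i]) (H : T -> R) :
  (forall n, cmeasurable (s n)) -> cmeasurable F -> measurable_fun setT H ->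
  (\int[mu]_x ((H x `^ p)%R)%:E < +oo)%E ->
  (forall n x, rnorm (F x - s n x) <= H x) ->
  (forall x, (fun n => rnorm (F x - s n x)) @ \oo --> 0) ->
  (fun n => Lp_power mu p (fun x => F x - s n x)%R) @ \oo --> 0%E.
Proof.
move=> ms mF mH Hy sH sF.
have mHp : measurable_fun setT (fun x => ((H x `^ p)%R)%:E).
  apply/measurable_EFinP; exact: (@measurableT_comp _ _ _ _ _ _ (@powR R ^~ p)).
have iH : mu.-integrable setT (fun x => ((H x `^ p)%R)%:E).
  apply/integrableP; split => //; apply: le_lt_trans Hy.
  rewrite (eq_integral (fun x => ((H x `^ p)%R)%:E))// => x _.
  by rewrite gee0_abs// lee_fin powR_ge0.
have [||||_ + _] := @dominated_convergence _ _ _ mu setT measurableT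
    (fun n x => ((rnorm (F x - s n x) `^ p)%R)%:E) (cst 0%E) _ _ _ _ iH.
- by move=> n; apply: measurable_power; exact: cmeasurableB.
- exact: measurable_cst.
- apply: aeW => x _; apply: cvg_EFin; first exact: nearW.
  (* Once the difference is below 1, its p-th power is at most the difference itself, since
     [1 <= p]. *)
  apply: (@squeeze_cvgr _ _ _ _ (fun=> 0) (fun n => rnorm (F x - s n x))) => //.
    have /cvgrPdist_lt/(_ _ ltr01) := sF x; apply: filterS => n.
    rewrite sub0r normrN ger0_norm ?rnorm_ge0// => h; rewrite powR_ge0/=.
    have [->|x0] := eqVneq (rnorm (F x - s n x)) 0; first by rewrite powR0// gt_eqF.
    by apply: ge1r_powR => //; rewrite lt_neqAle eq_sym x0 rnorm_ge0/= ltW.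
  exact: cvg_cst.
- apply: aeW => x n _; rewrite gee0_abs ?lee_fin ?powR_ge0//.
  have H0 := le_trans (rnorm_ge0 _) (sH n x).
  by apply: ge0_ler_powR; rewrite ?nnegrE ?rnorm_ge0// ltW.
apply: cvg_trans; apply: near_eq_cvg; apply: nearW => n /=.
by apply: eq_integral => x _; rewrite subr0 ger0_norm// powR_ge0.
Qed.

Variable D : set Lp.
Hypotheses (D_linear : forall (k : R[i]) x y, D x -> D y -> D (k *: x + y))
  (D0 : D 0)
  (D_closed : forall x, (forall e : R, 0 < e -> exists y, D y /\ rnorm (x - y) < e) -> D x).

(** Membership in [D] for honest functions, so that approximations can be built pointwise rather
    than on classes. *)
Definition Lp_represents (F : T -> R[i]) : Prop :=
  exists2 f, D f & {ae mu, forall x, Lp_fun f x = F x}.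

Lemma Lp_represents_linear (k : R[i]) (F H : T -> R[i]) :
  Lp_represents F -> Lp_represents H -> Lp_represents (fun x => k * F x + H x).
Proof.
move=> [f Df fF] [h Dh hH]; exists (k *: f + h); first exact: D_linear.
by apply: filterS3 fF hH (Lp_funP k f h) => x -> -> ->.
Qed.

Lemma Lp_represents0 : Lp_represents (fun=> 0).
Proof.
exists 0 => //; have := Lp_funP (-1) (0 : Lp) 0.
by rewrite scaler0 addr0; apply: filterS => x {1}->; rewrite mulN1r addNr.
Qed.

Lemma Lp_represents_sum (I : Type) (r : seq I) (k : I -> R[i]) (F : I -> T -> R[i]) :
  (forall i, Lp_represents (F i)) ->
  Lp_represents (fun x => \sum_(i <- r) k i * F i x).
Proof.
move=> hF; elim: r => [|i r IH].
  by under eq_fun do rewrite big_nil; exact: Lp_represents0.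
by under eq_fun do rewrite big_cons; exact: Lp_represents_linear.
Qed.

Lemma Lp_represents_limit (F : T -> R[i]) (s : nat -> T -> R[i]) :
  cmeasurable F -> (Lp_power mu p F < +oo)%E ->
  (forall n, cmeasurable (s n)) ->
  (forall n, Lp_represents (s n)) ->
  (fun n => Lp_power mu p (fun x => F x - s n x)%R) @ \oo --> 0%E ->
  Lp_represents F.
Proof.
move=> mF Fy ms Ds sF; have [f hf] := Lp_mk p1 mF Fy.
exists f => //; apply: D_closed => e e0.
have ep : 0 < e `^ p by rewrite powR_gt0.
have [N _ /(_ N (leqnn N)) /= hN] := cvge0_near_lt sF ep.
have [g Dg gs] := Ds N; exists g; split => //.
rewrite ltNge; apply/negP => h.
move: hN; rewrite -(@eq_ae_power _ _ _ mu p (fun x => Lp_fun f x - Lp_fun g x)).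
- rewrite -rnorm_LpB lte_fin ltNge => /negP; apply.
  by apply: ge0_ler_powR; rewrite ?nnegrE ?rnorm_ge0// ltW.
- by apply: cmeasurableB; exact: Lp_cmeasurable.
- exact: cmeasurableB.
- by apply: filterS2 hf gs => x -> ->.
Qed.

Definition cindic (S : set T) (x : T) : R[i] := (\1_S x)%:C.

Lemma cmeasurable_cindic (S : set T) : measurable S -> cmeasurable (cindic S).
Proof. by move=> mS; split; [exact: measurable_indic|exact: measurable_cst]. Qed.

Lemma rnorm_cindic (S : set T) x : rnorm (cindic S x) = \1_S x.
Proof. by rewrite rnorm_real ger0_norm. Qed.

Lemma cindicT (S : set T) x : S x -> cindic S x = 1.
Proof. by move=> Sx; rewrite /cindic indicE mem_set. Qed.

Lemma cindicF (S : set T) x : ~ S x -> cindic S x = 0.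
Proof. by move=> Sx; rewrite /cindic indicE memNset. Qed.

Lemma Lp_power_cindic (S : set T) : measurable S -> Lp_power mu p (cindic S) = mu S.
Proof.
move=> mS; rewrite -[S in RHS](setIT S) -integral_indic//; apply: eq_integral => x _.
rewrite rnorm_cindic indicE; case: (x \in S); first by rewrite powR1.
by rewrite powR0// gt_eqF.
Qed.

Section dynkin.
Variables (C : set (set T)) (Q : set T).
Hypotheses (measC : @measurable _ T = <<s C >>) (CI : setI_closed C)
  (mQ : measurable Q) (Qy : (mu Q < +oo)%E) (DQ : Lp_represents (cindic Q))
  (DC : forall S, C S -> Lp_represents (cindic (S `&` Q))).

(** Dynkin's argument relative to [Q], whose finite measure keeps all indicators in L^p: a
    complement becomes [1_Q] minus an indicator, and a disjoint union is a limit dominated by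
    [1_Q]. *)
Lemma Lp_represents_measurable (S : set T) : measurable S ->
  Lp_represents (cindic (S `&` Q)).
Proof.
rewrite measC; apply: (@dynkin_induction _ _ C (fun S => Lp_represents (cindic (S `&` Q)))) => //.
- by rewrite setTI.
- move=> S' mS DS'.
  rewrite (_ : cindic _ = (fun x => -1 * cindic (S' `&` Q) x + cindic Q x)).
    exact: Lp_represents_linear.
  apply/funext => x; rewrite /cindic mulN1r -rmorphN -rmorphD; congr (_%:C).
  rewrite !indicE !in_setI in_setC; case: (x \in S'); case: (x \in Q) => /=; lra.
- move=> F mF tF DF.
  pose U n := (\bigcup_(i < n) F i) `&` Q.
  have mU n : measurable (U n).
    by apply: measurableI => //; exact: bigcup_measurable.
  have mUU : measurable ((\bigcup_i F i) `&` Q).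
    by apply: measurableI => //; exact: bigcup_measurable.
  have DU n : Lp_represents (cindic (U n)).
    elim: n => [|n IH].
      rewrite (_ : cindic _ = fun=> 0); first exact: Lp_represents0.
      by apply/funext => x; rewrite cindicF// => -[[i /=]].
    rewrite (_ : cindic _ = (fun x => 1 * cindic (U n) x + cindic (F n `&` Q) x)).
      exact: Lp_represents_linear.
    apply/funext => x; rewrite mul1r.
    have [Qx|Qx] := pselect (Q x); last first.
      by rewrite !cindicF ?addr0// => -[].
    have [Fx|Fx] := pselect (F n x).
      rewrite (cindicT (S := F n `&` Q))// (cindicT (S := U n.+1)); last first.
        by split => //; exists n => /=.
      rewrite cindicF ?add0r// => -[[i /= ni Fi] _].
      have ie := tF i n I I (ex_intro _ x (conj Fi Fx)).
      by rewrite ie ltnn in ni.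
    rewrite [cindic (F n `&` Q) x]cindicF ?addr0; last by case.
    have [Ux|Ux] := pselect (U n x).
      rewrite !cindicT//; split => //; case: Ux => -[i /= ni Fi] _.
      by exists i => //=; exact: ltnW.
    rewrite !cindicF// => -[[i /= ni Fi] _]; apply: Ux; split => //.
    exists i => //=; move: ni; rewrite ltnS leq_eqVlt => /orP[/eqP iE|//].
    by rewrite iE in Fi.
  apply: (@Lp_represents_limit _ (fun n => cindic (U n))) => //.
  + exact: cmeasurable_cindic.
  + rewrite Lp_power_cindic//; apply: le_lt_trans Qy; apply: le_measure; rewrite ?inE//.
  + by move=> n; exact: cmeasurable_cindic.
  + apply: (@Lp_power_dominated _ _ (\1_Q)) => //.
    * by move=> n; exact: cmeasurable_cindic.
    * exact: cmeasurable_cindic.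
    * have := Lp_power_cindic mQ; rewrite /Lp_power.
      by under eq_integral do rewrite rnorm_cindic; move=> ->.
    * move=> n x; have [Qx|Qx] := pselect (Q x); last first.
        by rewrite !cindicF ?subrr ?rnorm0// => -[].
      rewrite [leRHS]indicE mem_set//.
      have [Ux|Ux] := pselect (U n x).
        rewrite !cindicT ?subrr ?rnorm0//.
        by case: Ux => -[i _ Fi] _; split => //; exists i.
      by rewrite [cindic (U n) x]cindicF// subr0 rnorm_cindic indicE; case: (_ \in _).
    * move=> x; apply: cvg_near_cst.
      have [[[k _ Fk] Qx]|Ux] := pselect (((\bigcup_i F i) `&` Q) x); last first.
        apply: nearW => n; rewrite !cindicF ?subrr ?rnorm0// => -[[i _ Fi] Qx].
        by apply: Ux; split => //; exists i.
      exists k.+1 => // n /= kn; rewrite !cindicT ?subrr ?rnorm0//.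
        by split => //; exists k.
      by split => //; exists k.
Qed.

End dynkin.

Section density.
Import HBNNSimple.
Variables (C : set (set T)) (Q : nat -> set T).
Hypotheses (measC : @measurable _ T = <<s C >>) (CI : setI_closed C)
  (mQ : forall n, measurable (Q n)) (Qy : forall n, (mu (Q n) < +oo)%E)
  (Qnd : {homo Q : n m / (n <= m)%N >-> (n <= m)%O}) (QT : \bigcup_n Q n = setT)
  (DQ : forall n, Lp_represents (cindic (Q n)))
  (DC : forall n S, C S -> Lp_represents (cindic (S `&` Q n))).

Lemma Lp_represents_nneg (g : T -> R) : measurable_fun setT g ->
  (forall x, 0 <= g x) -> (\int[mu]_x ((g x `^ p)%R)%:E < +oo)%E ->
  Lp_represents (fun x => (g x)%:C).
Proof.
move=> mg g0 gy; have mg' : measurable_fun setT (EFin \o g) by exact/measurable_EFinP.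
pose h := nnsfun_approx measurableT mg'.
have hg x : (fun n => h n x : R) @ \oo --> g x.
  have := @cvg_nnsfun_approx _ _ _ _ measurableT _ mg' (fun x _ => g0 x) x I.
  by move=> /fine_cvgP[_].
have hle n x : 0 <= h n x <= g x.
  rewrite fun_ge0/=; apply: (ler_cvg_to (cvg_cst (h n x : R)) (hg x)).
  by exists n => // m /= nm; exact: (lefP _ _ (nd_nnsfun_approx measurableT mg' nm)).
(* The cutoff reduces each level set to a set of the form already treated. At a fixed point it is
   eventually 1, so the pointwise limit is unchanged. *)
pose s n x := (h n x)%:C * cindic (Q n) x.
have ms n : cmeasurable (s n).
  split; rewrite /s /cindic.
    rewrite (_ : (fun x => _) = (fun x => h n x * \1_(Q n) x)).
      by apply: measurable_funM.
    by apply/funext => x; rewrite -rmorphM.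
  rewrite (_ : (fun x => _) = cst 0) //.
  by apply/funext => x; rewrite -rmorphM.
have mgC : cmeasurable (fun x => (g x)%:C).
  by split => //=; exact: measurable_cst.
apply: (Lp_represents_limit mgC _ ms).
- by rewrite /Lp_power; under eq_integral do rewrite rnorm_real ger0_norm//.
- move=> n; have hS y : Lp_represents (cindic (h n @^-1` [set y] `&` Q n)).
    have mS : measurable (h n @^-1` [set y]) by [].
    exact: (Lp_represents_measurable measC CI (mQ n) (Qy n) (DQ n) (@DC n) mS).
  have := Lp_represents_sum (fset_set (range (h n))) (fun y => y%:C) hS.
  congr Lp_represents; apply/funext => x.
  have fh : finite_set (range (h n)) by exact: fimfunP.
  rewrite /s (simple_comp_indic fh id) rmorph_sum mulr_suml.
  apply: eq_bigr => y _; rewrite rmorphM -mulrA; congr (_ * _).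
  by rewrite /cindic -rmorphM indicI.
- apply: (Lp_power_dominated ms mgC mg gy).
  + move=> n x; rewrite /s /cindic -rmorphM -rmorphB rnorm_real.
    have /andP[h0 hg'] := hle n x; rewrite indicE.
    by case: (x \in Q n); rewrite ?mulr1 ?mulr0 ?subr0 ger0_norm// ?subr_ge0// lerBlDr lerDl.
  + move=> x; have : (\bigcup_n Q n) x by rewrite QT.
    move=> [k _ Qk]; rewrite -(normr0 R) -(subrr (g x)).
    have : (fun n => `|g x - h n x|) @ \oo --> `|g x - g x|.
      by apply: cvg_norm; apply: cvgB => //; exact: cvg_cst.
    apply: cvg_trans; apply: near_eq_cvg; exists k => // n /= kn.
    rewrite /s cindicT ?mulr1 -?rmorphB ?rnorm_real//.
    by have /subsetPset := Qnd kn; apply.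
Qed.

(** Meant for the real and imaginary parts of [F]: positive and negative parts of [g] are dominated
    by [rnorm (F x)], hence have integrable p-th powers. *)
Lemma Lp_represents_real (F : T -> R[i]) (g : T -> R) : measurable_fun setT g ->
  (Lp_power mu p F < +oo)%E -> cmeasurable F -> (forall x, `|g x| <= rnorm (F x)) ->
  Lp_represents (fun x => (g x)%:C).
Proof.
move=> mg Fy mF gF.
have part (h : T -> R) : measurable_fun setT h -> (forall x, 0 <= h x <= `|g x|) ->
    Lp_represents (fun x => (h x)%:C).
  move=> mh hg; apply: (Lp_represents_nneg mh).
    by move=> x; have /andP[] := hg x.
  apply: le_lt_trans Fy; apply: ge0_le_integral => //.
  - by move=> x _; rewrite lee_fin powR_ge0.
  - apply/measurable_EFinP; exact: (@measurableT_comp _ _ _ _ _ _ (@powR R ^~ p)).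
  - exact: measurable_power.
  - move=> x _; have /andP[h0 hle] := hg x; rewrite lee_fin.
    by apply: ge0_ler_powR; rewrite ?nnegrE ?rnorm_ge0 ?(ltW p0)// (le_trans hle).
have gp : Lp_represents (fun x => (Num.max (g x) 0)%:C).
  apply: part; first exact: measurable_maxr.
  move=> x; rewrite le_max lexx orbT/= ge_max normr_ge0 andbT; exact: ler_norm.
have gm : Lp_represents (fun x => (Num.max (- g x) 0)%:C).
  apply: part; first by apply: measurable_maxr => //; exact: measurableT_comp.
  move=> x; rewrite le_max lexx orbT/= ge_max normr_ge0 andbT -normrN; exact: ler_norm.
have := Lp_represents_linear (-1) gm gp; congr Lp_represents.
apply/funext => x; rewrite mulN1r -rmorphN -rmorphD; congr (_%:C).
by case: (leP (g x) 0); case: (leP (- g x) 0); lra.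
Qed.

Lemma closed_subspace_full (f : Lp) : D f.
Proof.
have mf := Lp_cmeasurable f; have fy := Lp_power_lty f.
have fr : Lp_represents (fun x => (complex.Re (Lp_fun f x))%:C).
  apply: (@Lp_represents_real (Lp_fun f)) => //; first by case: mf.
  by move=> x; exact: Re_le_rnorm.
have fi : Lp_represents (fun x => (complex.Im (Lp_fun f x))%:C).
  apply: (@Lp_represents_real (Lp_fun f)) => //; first by case: mf.
  by move=> x; exact: Im_le_rnorm.
have [h Dh hf] := Lp_represents_linear ('i)%C fi fr.
suff -> : f = h by [].
apply: Lp_eq; apply: filterS hf => x ->.
by rewrite addrC {1}[Lp_fun f x]complexE.
Qed.

End density.
End Lp_density.

Lemma rnorm_le_dist (R : realType) (V : normedModType R[i]) (x y : V) :
  rnorm y <= rnorm x + rnorm (x - y).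
Proof. by rewrite rnormB addrC -{1}[y](subrK x); exact: rnormD. Qed.

Section Lp_fun_operations.
Context d (T : measurableType d) (R : realType).
Variables (mu : {measure set T -> \bar R}) (p : R) (p1 : 1 <= p).
Local Notation Lp := (Lp mu p1).

Lemma le_Lp_power (F H : T -> R[i]) : cmeasurable F -> cmeasurable H ->
  (forall x, rnorm (F x) <= rnorm (H x)) ->
  (Lp_power mu p F <= Lp_power mu p H)%E.
Proof.
move=> mF mH FH; have p0 : 0 <= p by exact: le_trans p1.
apply: ge0_le_integral => //.
- by move=> x _; rewrite lee_fin powR_ge0.
- exact: measurable_power.
- exact: measurable_power.
- by move=> x _; rewrite lee_fin ge0_ler_powR ?nnegrE ?rnorm_ge0.
Qed.

Lemma Lp_fun0 : {ae mu, forall x, Lp_fun (0 : Lp) x = 0}.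
Proof.
have := Lp_funP (-1) (0 : Lp) 0.
by rewrite scaler0 addr0; apply: filterS => x {1}->; rewrite mulN1r addNr.
Qed.

Lemma Lp_funZ (k : R[i]) (f : Lp) : {ae mu, forall x, Lp_fun (k *: f) x = k * Lp_fun f x}.
Proof.
have := Lp_funP k f 0; rewrite addr0 => h.
by apply: filterS2 h Lp_fun0 => x -> ->; rewrite addr0.
Qed.

End Lp_fun_operations.

(** * Regular covariant representations *)

Section regular_representation.
Context (R : realType) (p : R) (p1 : 1 <= p) (G : topologicalGroupType).
Variable nu : {measure set (borel G) -> \bar R}.
Hypotheses (T2 : hausdorff_space G) (lcG : locally_compact [set: G])
  (scG : @second_countable G) (haar : left_haar nu).
Context d (X0 : measurableType d) (mu0 : {sigma_finite_measure set X0 -> \bar R}).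
Local Notation LpX := (Lp mu0 p1).
Local Notation LpGX := (Lp (nu \x mu0)%E p1).

Let p0 : 0 < p. Proof. exact: lt_le_trans p1. Qed.

Lemma haar_inv g (B : set (borel G)) : measurable B ->
  nu [set (g * x)%g | x in B] = nu B.
Proof. by case: haar => + _ _ _ _; apply. Qed.

Lemma haar_compact (K : set G) : compact K -> (nu K < +oo)%E.
Proof. by case: haar => _ + _ _ _; apply. Qed.

Let sfnu : sigma_finite setT nu.
Proof. exact: haar_sigma_finite haar_compact. Qed.

(** By Tonelli almost every section of a null set is null. Identities in L^p of the product thus
    become identities on sections, the form in which [pi] is described. *)
Lemma ae_section (P : borel G * X0 -> Prop) : {ae (nu \x mu0)%E, forall z, P z} ->
  {ae nu, forall h, {ae mu0, forall x, P (h, x)}}.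
Proof.
move=> [N [mN N0 PN]].
have mF : measurable_fun setT (fun z => (\1_N z)%:E : \bar R).
  exact/measurable_EFinP.
have F1 z : (0 <= ((\1_N z)%:E : \bar R))%E by rewrite lee_fin.
have F0 := haar_tonelli sfnu mu0 mF F1.
rewrite integral_indic// setIT [LHS]N0 in F0.
have mS := haar_measurable_section mu0 mF F1.
have : (\int[nu]_h `|\int[mu0]_x (\1_N (h, x))%:E| = 0)%E.
  rewrite [RHS]F0; apply: eq_integral => h _; rewrite gee0_abs//.
  exact: integral_ge0.
move/(ae_eq_integral_abs _ measurableT mS).
apply: filterS => h /(_ I) h0.
exists (xsection N h); split.
- exact: measurable_xsection.
- rewrite -[xsection N h]setIT -integral_indic//; last exact: measurable_xsection.
  rewrite -[RHS]h0; apply: eq_integral => x _.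
  by rewrite !indicE mem_xsection.
- by move=> x /= Px; rewrite /xsection/=; apply/mem_set/PN.
Qed.

Lemma Lp_power_tonelli (F : borel G * X0 -> R[i]) : cmeasurable F ->
  Lp_power (nu \x mu0)%E p F = (\int[nu]_h Lp_power mu0 p (fun x => F (h, x)))%E.
Proof.
move=> mF; apply: (haar_tonelli sfnu mu0 (measurable_power p mF)) => z.
by rewrite lee_fin powR_ge0.
Qed.

Lemma measurable_Lp_power_section (F : borel G * X0 -> R[i]) : cmeasurable F ->
  measurable_fun setT (fun h : borel G => Lp_power mu0 p (fun x => F (h, x))).
Proof.
move=> mF; apply: (haar_measurable_section mu0 (measurable_power p mF)) => z.
by rewrite lee_fin powR_ge0.
Qed.

(** By Tonelli the p-th power of the norm is the integral over [h] of the powers of the sections,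
    and left invariance applies to that integral. *)
Lemma translation_isometry (g : G) (xi xi' : LpGX) :
  {ae (nu \x mu0)%E, forall z, Lp_fun xi' z = Lp_fun xi ((g^-1 * z.1)%g, z.2)} ->
  rnorm xi' = rnorm xi.
Proof.
move=> h; pose tau (z : borel G * X0) : borel G * X0 := ((g^-1 * z.1)%g, z.2).
have mtau : measurable_fun setT tau.
  apply: measurable_fun_pair; last exact: measurable_snd.
  exact: (measurableT_comp (mulgl_measurable g^-1%g) measurable_fst).
have [mr mi] := Lp_cmeasurable xi.
have mxt : cmeasurable (fun z => Lp_fun xi (tau z)).
  by split; [exact: (measurableT_comp mr mtau)|exact: (measurableT_comp mi mtau)].
have E : Lp_power (nu \x mu0)%E p (Lp_fun xi') = Lp_power (nu \x mu0)%E p (Lp_fun xi).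
  rewrite (eq_ae_power p (Lp_cmeasurable xi') mxt h).
  rewrite (Lp_power_tonelli mxt) (Lp_power_tonelli (Lp_cmeasurable xi)).
  apply: (haar_integral_mulgl haar_inv g
    (measurable_Lp_power_section (Lp_cmeasurable xi))) => h'.
  exact: Lp_power_ge0.
apply/eqP; rewrite eq_le; apply/andP.
by split; rewrite -[leRHS]mul1r; apply: (ler_rnorm_Lp ler01); rewrite powR1 mul1e E.
Qed.

(** * Density of the image of C_c(G, L^p(X0)) *)

Definition Cc_represents (xi : Cc G LpX) (eta : LpGX) : Prop :=
  {ae nu, forall h : borel G, {ae mu0, forall x, Lp_fun eta (h, x) = Lp_fun (xi h) x}}.

Definition Cc_closure : set LpGX := [set x | forall e : R, 0 < e ->
  exists eta, (exists xi, Cc_represents xi eta) /\ rnorm (x - eta) < e].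

Lemma Cc_represents_linear (k : R[i]) xi eta xi' eta' :
  Cc_represents xi eta -> Cc_represents xi' eta' ->
  Cc_represents (k *: xi + xi') (k *: eta + eta').
Proof.
move=> h h'; have := ae_section (Lp_funP k eta eta').
move: h h'; apply: filterS3 => g h h' hs.
have hh' : {ae mu0, forall x, Lp_fun eta (g, x) = Lp_fun (xi g) x /\
    Lp_fun eta' (g, x) = Lp_fun (xi' g) x} by apply: filterS2 h h'.
have h4 := Lp_funP k (xi g) (xi' g).
apply: filterS3 hh' hs h4 => x [e1 e2] e3 e4.
by rewrite e3 e1 e2 -e4.
Qed.

Lemma Cc_closure_linear (k : R[i]) x y :
  Cc_closure x -> Cc_closure y -> Cc_closure (k *: x + y).
Proof.
move=> hx hy e e0.
have C0 : 0 < rnorm k + 1 by rewrite ltr_wpDl ?rnorm_ge0.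
have e2 : 0 < e / 2 by rewrite divr_gt0.
have [eta [[xi hxi] xe]] := hx _ (divr_gt0 e2 C0).
have [eta' [[xi' hxi'] ye]] := hy _ e2.
exists (k *: eta + eta'); split; first by exists (k *: xi + xi'); exact: Cc_represents_linear.
rewrite opprD addrACA -scalerBr (le_lt_trans (rnormD _ _))// (splitr e) ler_ltD//.
rewrite rnormZ (le_trans (ler_wpM2l (rnorm_ge0 _) (ltW xe)))//.
rewrite mulrCA ler_piMr ?(ltW e2)// ler_pdivrMr// mul1r lerDl//.
Qed.

Lemma Cc_closure_closed x :
  (forall e : R, 0 < e -> exists y, Cc_closure y /\ rnorm (x - y) < e) -> Cc_closure x.
Proof.
move=> hx e e0; have e2 : 0 < e / 2 by rewrite divr_gt0.
have [y [hy xy]] := hx _ e2; have [eta [hxi yeta]] := hy _ e2.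
exists eta; split => //.
by rewrite (le_lt_trans (rnorm_tri y _ _))// (splitr e) ltrD.
Qed.

Lemma Cc_closure0 : Cc_closure 0.
Proof.
move=> e e0; exists 0; split; last by rewrite subrr rnorm0.
exists 0; have := ae_section (Lp_funP (-1) (0 : LpGX) 0).
apply: filterS => h; rewrite scaler0 addr0 => H.
have := Lp_funP (-1) (0 : LpX) 0; rewrite scaler0 addr0 => H'.
apply: filterS2 H H' => x -> ->.
by rewrite !mulN1r !addNr.
Qed.

Lemma product_rectangle (A : set (borel G)) (B : set X0) :
  measurable A -> measurable B ->
  ((nu \x mu0 : {measure set (borel G * X0) -> \bar R}) (A `*` B) = nu A * mu0 B)%E.
Proof. exact: product_measure1E. Qed.

(* By regularity there are [K `<=` U] with [K] compact, [U] open, [A `<=` U] and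
   both [U `\` A] and [U `\` K] small; a Urysohn function [phi] between [K] and [U]
   gives the approximation [phi * 1_B]. *)
Lemma Cc_closure_rectangle (A : set (borel G)) (B : set X0) :
  measurable A -> measurable B -> (nu A < +oo)%E -> (mu0 B < +oo)%E ->
  Lp_represents Cc_closure (cindic R (A `*` B)).
Proof.
move=> mA mB Ay By; have mAB : measurable (A `*` B) by exact: measurableX.
have ABy : ((nu \x mu0)%E (A `*` B) < +oo)%E.
  by rewrite product_measure1E// lte_mul_pinfty// ge0_fin_numE.
have [f fE] : exists f : LpGX, {ae (nu \x mu0)%E, forall z, Lp_fun f z = cindic R (A `*` B) z}.
  by apply: Lp_mk; [exact: cmeasurable_cindic|rewrite Lp_power_cindic].
exists f => // e e0.
pose m := fine (mu0 B); have m0 : 0 <= m by exact: fine_ge0.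
(* The sets [U] minus [A] and [U] minus [K] contribute at most [del * m] each, in total strictly
   less than [e ^ p]; the [+ 1] also covers [m = 0]. *)
pose del := (e `^ p) / (2 * (m + 1)).
have ep : 0 < e `^ p by rewrite powR_gt0.
have del0 : 0 < del by rewrite divr_gt0// mulr_gt0// ltr_wpDl.
have [_ _ outer inner _] := haar.
have Afin : nu A \is a fin_num by rewrite ge0_fin_numE.
have Afin' := Afin; rewrite (outer A mA) in Afin'.
have [_ [U [oU AU] <-]] := lb_ereal_inf_adherent del0 Afin'.
rewrite -(outer A mA) => UA.
have mU : measurable (U : set (borel G)) by exact: sub_sigma_algebra.
have Uy : (nu U < +oo)%E.
  by apply: (lt_trans UA); rewrite -(fineK Afin) -EFinD ltry.
have Ufin : nu U \is a fin_num by rewrite ge0_fin_numE.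
have Ufin' := Ufin; rewrite (inner U oU) in Ufin'.
have [_ [K [cK KU] <-]] := ub_ereal_sup_adherent del0 Ufin'.
rewrite -(inner U oU) => UK.
have mK : measurable (K : set (borel G)) by exact: compact_borel_measurable.
have [phi [phic phi01 phiK phiU phis]] := compact_urysohn R T2 lcG cK oU KU.
have UAy : (nu (U `\` A) <= del%:E)%E.
  by rewrite measureD// setIidr// leeBlDl// ltW.
have UKy : (nu (U `\` K) <= del%:E)%E.
  rewrite measureD// setIidr// leeBlDl//; last first.
    by rewrite ge0_fin_numE// haar_compact.
  by rewrite ltW// -lteBlDr.
pose F (z : borel G * X0) : R[i] := (phi z.1 * \1_B z.2)%:C.
have mphi : measurable_fun setT (phi : borel G -> R).
  exact: continuous_borel_measurable.
have mF : cmeasurable F.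
  split; last exact: measurable_cst.
  apply: measurable_funM; first exact: (measurableT_comp mphi measurable_fst).
  have mB1 : measurable_fun setT (\1_B : X0 -> R) by exact: measurable_indic.
  exact: (measurableT_comp mB1 measurable_snd).
pose W : set (borel G) := U; pose Z : set (borel G) := K.
have mUB : measurable (W `*` B) by exact: measurableX.
have Fy : (Lp_power (nu \x mu0)%E p F < +oo)%E.
  apply: (le_lt_trans (le_Lp_power (nu \x mu0)%E p1 mF (cmeasurable_cindic R mUB) _)).
    move=> -[h x].
    rewrite rnorm_cindic /F rnorm_real/= !indicE.
    have [Bx|Bx] := pselect (B x); last first.
      by rewrite (memNset Bx) mulr0 normr0.
    rewrite (mem_set Bx) mulr1; have [Ux|Ux] := pselect (U h).
      by rewrite mem_set//=; have /andP[? ?] := phi01 h; rewrite ger0_norm.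
    by rewrite phiU// normr0.
  rewrite (Lp_power_cindic _ p1 mUB) (product_rectangle (mU : measurable W) mB).
  by rewrite lte_mul_pinfty.
have [eta etaE] := Lp_mk p1 mF Fy.
have [b bE] : exists b : LpX, {ae mu0, forall x, Lp_fun b x = cindic R B x}.
  by apply: Lp_mk; [exact: cmeasurable_cindic|rewrite Lp_power_cindic].
exists eta; split.
  have xiP : (fun h : G => (phi h)%:C *: b : LpX) \in @Cc_pred R G LpX.
    apply/asboolP; split.
      apply/continuous_rnormP => t r r0; have b1 : 0 < rnorm b + 1 by rewrite ltr_wpDl ?rnorm_ge0.
      have /cvgrPdist_lt/(_ _ (divr_gt0 r0 b1)) := phic t; apply: filterS => s.
      rewrite ltr_pdivlMr// => h; apply: le_lt_trans h.
      rewrite -scalerBl rnormZ -rmorphB rnorm_real distrC ler_wpM2l// lerDl//.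
    apply: subclosed_compact phis _; first exact: closed_closure.
    by apply: closureS => h /=; apply: contraNN => /eqP ->; rewrite scale0r.
  exists (MkCc xiP); apply: filterS (ae_section etaE) => h hE.
  apply: filterS3 hE (Lp_funZ (phi h)%:C b) bE => x -> /= -> ->.
  by rewrite /F /cindic -rmorphM.
rewrite ltNge; apply/negP => fe.
have : (Lp_power (nu \x mu0)%E p (fun z => cindic R (A `*` B) z - F z)%R < (e `^ p)%:E)%E.
  have mUA : measurable ((W `\` A) `*` B).
    by apply: measurableX => //; exact: measurableD.
  have mUK : measurable ((W `\` Z) `*` B).
    by apply: measurableX => //; exact: measurableD.
  (* Outside [U] or outside [B] both functions vanish, and over [B] both are 1 on the part of [A]
     inside [K]. Elsewhere they differ by at most 1, and [h] lies in [U] minus [A] or in [U] minus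
     [K]. *)
  apply: (@le_lt_trans _ _ (\int[(nu \x mu0)%E]_z
    ((\1_((W `\` A) `*` B) z)%:E + (\1_((W `\` Z) `*` B) z)%:E))%E).
    apply: ge0_le_integral => //.
    - by move=> z _; rewrite lee_fin powR_ge0.
    - apply: measurable_power; apply: cmeasurableB => //; exact: cmeasurable_cindic.
    - by apply: emeasurable_funD; apply/measurable_EFinP; exact: measurable_indic.
    - move=> -[h x] _; rewrite -EFinD lee_fin /cindic /F -rmorphB rnorm_real/= !indicE.
      have [Bx|Bx] := pselect (B x); last first.
        rewrite (memNset Bx) mulr0 !memNset ?subr0 ?normr0 ?powR0 ?gt_eqF ?addr0//;
        by case.
      rewrite (mem_set Bx) mulr1.
      have [Uh|Uh] := pselect (U h); last first.
        rewrite phiU// !memNset ?subr0 ?normr0 ?powR0 ?gt_eqF ?addr0//.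
        + by move=> [[]].
        + by move=> [[]].
        + by move=> [/AU].
      set r := `|_|; have r01 : 0 <= r <= 1.
        rewrite normr_ge0/= /r; have /andP[q0 q1] := phi01 h.
        case: (_ \in _) => /=; first by rewrite ger0_norm ?subr_ge0// lerBlDr lerDl.
        by rewrite sub0r normrN ger0_norm.
      have rp1 : r `^ p <= 1 `^ p.
        by have /andP[r0 r1] := r01; apply: ge0_ler_powR; rewrite ?nnegrE// ltW.
      rewrite powR1 in rp1.
      have [Ah|Ah] := pselect (A h); last first.
        have hx : ((W `\` A) `*` B) (h, x) by [].
        by rewrite (le_trans rp1)// (mem_set hx) lerDl.
      have [Kh|Kh] := pselect (K h); last first.
        have hx : ((W `\` Z) `*` B) (h, x) by [].
        by rewrite (le_trans rp1)// (mem_set hx) lerDr.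
      rewrite /r phiK// mem_set// subrr normr0 powR0 ?gt_eqF//.
  rewrite ge0_integralD//; last 2 first.
    by apply/measurable_EFinP; exact: measurable_indic.
    by apply/measurable_EFinP; exact: measurable_indic.
  rewrite !integral_indic// !setIT.
  rewrite (product_rectangle _ mB); last exact: measurableD.
  rewrite (product_rectangle _ mB); last exact: measurableD.
  have Bfin : mu0 B \is a fin_num by rewrite ge0_fin_numE.
  rewrite -(fineK Bfin) -/m.
  apply: (@le_lt_trans _ _ (del%:E * m%:E + del%:E * m%:E)%E).
    by apply: leeD; apply: lee_wpmul2r; rewrite ?lee_fin.
  rewrite -!EFinM -EFinD lte_fin -mulrDl /del.
  have -> : (e `^ p / (2 * (m + 1)) + e `^ p / (2 * (m + 1))) * m = e `^ p * (m / (m + 1)).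
    by field; rewrite gt_eqF// ltr_wpDl.
  by rewrite gtr_pMr// ltr_pdivrMr ?ltr_wpDl// mul1r ltrDl.
rewrite -(@eq_ae_power _ _ _ (nu \x mu0)%E p (fun z => Lp_fun f z - Lp_fun eta z)).
- rewrite -rnorm_LpB lte_fin ltNge => /negP; apply.
  by apply: ge0_ler_powR; rewrite ?nnegrE ?rnorm_ge0// ltW.
- by apply: cmeasurableB; exact: Lp_cmeasurable.
- by apply: cmeasurableB => //; exact: cmeasurable_cindic.
- by apply: filterS2 fE etaE => z -> ->.
Qed.

(** Measurable rectangles are stable under intersection and generate the product sigma-algebra; the
    increasing products of [F n] and [F0 n] exhaust it with finite measure. Density is thus reduced
    to rectangles of finite measure. *)
Lemma Cc_closure_full (x : LpGX) : Cc_closure x.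
Proof.
have [F [FT Fnd mF]] := (sigma_finiteP setT nu).1 sfnu.
have [F0 [F0T F0nd mF0]] := (sigma_finiteP setT mu0).1 (sigma_finiteT mu0).
have rect n (A : set (borel G)) (B : set X0) : measurable A -> measurable B ->
    Lp_represents Cc_closure (cindic R ((A `&` F n) `*` (B `&` F0 n))).
  have [mFn Fny] := mF n; have [mF0n F0ny] := mF0 n => mA mB.
  apply: Cc_closure_rectangle; try exact: measurableI.
    apply: le_lt_trans Fny; apply: le_measure => //; rewrite ?inE//; exact: measurableI.
  by apply: le_lt_trans F0ny; apply: le_measure => //; rewrite ?inE//; exact: measurableI.
apply: (@closed_subspace_full _ _ _ _ _ p1 Cc_closure Cc_closure_linear Cc_closure0 Cc_closure_closed
  [set A `*` B | A in measurable & B in measurable] (fun n => F n `*` F0 n)).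
- exact: measurable_prod_measurableType.
- move=> _ _ [A mA [B mB <-]] [A' mA' [B' mB' <-]].
  exists (A `&` A'); first exact: measurableI.
  by exists (B `&` B'); [exact: measurableI|rewrite setXI].
- by move=> n; apply: measurableX; [case: (mF n)|case: (mF0 n)].
- move=> n; have [mFn Fny] := mF n; have [mF0n F0ny] := mF0 n.
  by rewrite product_rectangle// lte_mul_pinfty// ge0_fin_numE.
- move=> n m nm; apply/subsetPset => -[h y] [/= Fh Fy].
  split; first by have /subsetPset := Fnd _ _ nm; apply.
  by have /subsetPset := F0nd _ _ nm; apply.
- apply/seteqP; split => // -[h y] _.
  have [n _ Fh] : (\bigcup_n F n) h by rewrite -FT.
  have [n' _ Fy] : (\bigcup_n F0 n) y by rewrite -F0T.
  exists (maxn n n') => //; split => /=.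
    by have /subsetPset := Fnd _ _ (leq_maxl n n'); apply.
  by have /subsetPset := F0nd _ _ (leq_maxr n n'); apply.
- move=> n; have := rect n setT setT measurableT measurableT.
  by rewrite !setTI.
- by move=> n _ [A mA [B mB <-]]; rewrite -setXI; exact: rect.
Qed.

(** * Isometric translations and contractivity of the representation *)

Section contractive.
Variables (A : banachAlgType R[i]) (alpha : G -> A -> A).
Hypothesis iso : isometric_action alpha.
Variables (pi0 : A -> bop LpX) (v : G -> bop LpGX) (pi : A -> bop LpGX).
Hypotheses (pi0c : contractive pi0) (reg : regular_covariant alpha pi0 v pi).

Lemma regular_translation_isometry g xi : rnorm (v g xi) = rnorm xi.
Proof. by case: reg => _ vg _; exact: translation_isometry (vg g xi). Qed.

Lemma measurable_section_fun (F : borel G * X0 -> R[i]) (h : borel G) :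
  cmeasurable F -> cmeasurable (fun x => F (h, x)).
Proof.
move=> [mr mi]; split.
  exact: (measurableT_comp mr (pair1_measurable h)).
exact: (measurableT_comp mi (pair1_measurable h)).
Qed.

(** On almost every section the operator is [pi0] at an element of norm [rnorm a], because the
    action is isometric; integrating p-th powers over [h] keeps this constant. *)
Lemma regular_contractive_Cc a xi eta : Cc_represents xi eta ->
  rnorm (pi a eta) <= rnorm a * rnorm eta.
Proof.
move=> hxi; have [_ _ /(_ a xi eta hxi) hpi] := reg.
apply: ler_rnorm_Lp; first exact: rnorm_ge0.
have mpe := Lp_cmeasurable (pi a eta); have me := Lp_cmeasurable eta.
rewrite (Lp_power_tonelli mpe) (Lp_power_tonelli me).
rewrite -ge0_integralZl//; last 3 first.
- exact: (measurable_Lp_power_section me).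
- by move=> h _; exact: Lp_power_ge0.
- by rewrite lee_fin powR_ge0.
apply: ae_ge0_le_integral.
- exact: measurableT.
- by move=> h _; exact: Lp_power_ge0.
- exact: (measurable_Lp_power_section mpe).
- by move=> h _; rewrite mule_ge0// ?lee_fin ?powR_ge0// Lp_power_ge0.
- apply: emeasurable_funM; first exact: measurable_cst.
  exact: (measurable_Lp_power_section me).
apply: filterS2 hxi hpi => h hx hp _.
rewrite (eq_ae_power p (measurable_section_fun h mpe) (Lp_cmeasurable _) hp).
rewrite (eq_ae_power p (measurable_section_fun h me) (Lp_cmeasurable _) hx).
rewrite -!rnorm_LpE -EFinM lee_fin -powRM ?rnorm_ge0//.
apply: ge0_ler_powR; rewrite ?nnegrE ?mulr_ge0 ?rnorm_ge0 ?(ltW p0)//.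
rewrite (le_trans (le_opnorm _ _))// ler_wpM2r ?rnorm_ge0// -bop_rnorm.
rewrite -lecR !rnormE (le_trans (pi0c _))//.
by have [/(_ h^-1%g)[_ _ ->] _ _ _] := iso.
Qed.

Lemma regular_contractive : contractive pi.
Proof.
move=> a; rewrite -!rnormE lecR bop_rnorm; apply: ge_sup.
  by exists (rnorm (pi a 0)), 0 => //=; rewrite rnorm0.
move=> _ [x /= x1 <-]; apply/ler_addgt0Pr => e e0.
(* Replacing [x] by a represented [eta] at distance less than [q] costs at most
   [(opnorm (pi a) + rnorm a) * q]; this denominator makes the cost at most [e]. *)
have C0 : 0 < opnorm (pi a) + rnorm a + 1.
  by rewrite ltr_wpDl// addr_ge0 ?rnorm_ge0 ?opnorm_ge0.
have [eta [[xi hxi] xe]] := Cc_closure_full x (divr_gt0 e0 C0).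
set q := e / _ in xe.
have piB : pi a x = pi a (x - eta) + pi a eta.
  have [lin _] := bopP (pi a); have := lin 1 (x - eta) eta.
  by rewrite !scale1r subrK.
rewrite piB (le_trans (rnormD _ _))//.
have q0 : 0 <= q by rewrite divr_ge0// ltW.
have h1 : rnorm (pi a (x - eta)) <= opnorm (pi a) * q.
  by rewrite (le_trans (le_opnorm _ _))// ler_wpM2l ?opnorm_ge0// ltW.
have h2 : rnorm eta <= 1 + q.
  by apply: (le_trans (rnorm_le_dist x eta)); apply: lerD => //; exact: ltW.
have h3 : rnorm (pi a eta) <= rnorm a * (1 + q).
  by rewrite (le_trans (regular_contractive_Cc a hxi))// ler_wpM2l ?rnorm_ge0.
have h4 : (opnorm (pi a) + rnorm a + 1) * q = e.
  by rewrite mulrC /q divfK// gt_eqF.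
by move: h1 h3 h4 q0; nra.
Qed.

End contractive.
End regular_representation.

(** * Convolution and integrated forms *)

Lemma linear_sub (K : pzRingType) (U V : lmodType K) (f : U -> V) x y :
  linear f -> f (x - y) = f x - f y.
Proof. by move=> lf; rewrite addrC -scaleN1r lf scaleN1r addrC. Qed.

Lemma linear_zero (K : pzRingType) (U V : lmodType K) (f : U -> V) :
  linear f -> f 0 = 0.
Proof. by move=> lf; rewrite -(subrr 0) linear_sub// subrr. Qed.

Section joint_continuity.
Context (R : realType) (X : topologicalType).
Variables A E F : normedModType R[i].

Lemma continuous_bilinear (B : A -> E -> F) (f : X -> A) (g : X -> E) :
  (forall a b x, B (a - b) x = B a x - B b x) ->
  (forall a x y, B a (x - y) = B a x - B a y) ->
  (forall a x, rnorm (B a x) <= rnorm a * rnorm x) ->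
  continuous f -> continuous g -> continuous (fun t => B (f t) (g t)).
Proof.
move=> Bl Br Bb /continuous_rnormP fc /continuous_rnormP gc.
apply/continuous_rnormP => t e e0.
pose C := rnorm (f t) + rnorm (g t) + 1.
have C1 : 1 <= C by rewrite lerDr addr_ge0 ?rnorm_ge0.
have C0 : 0 < C := lt_le_trans ltr01 C1.
(* [q <= 1] bounds [rnorm (g s)] by [rnorm (g t) + 1], so the total error is at most [q * C]; the
   factor 2 makes this strictly less than [e]. *)
pose q := Num.min 1 (e / (C *+ 2)).
have q0 : 0 < q by rewrite lt_min ltr01/= divr_gt0// mulrn_wgt0.
have := gc t q q0; have := fc t q q0; apply: filterS2 => s fs gs.
have -> : B (f s) (g s) - B (f t) (g t) =
    B (f s - f t) (g s) + B (f t) (g s - g t).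
  by rewrite Bl Br subrKA.
have q1 : q <= 1 by rewrite ge_min lexx.
have qe : q * (C *+ 2) <= e by rewrite -ler_pdivlMr ?mulrn_wgt0// ge_min lexx orbT.
have gs1 : rnorm (g s) <= rnorm (g t) + 1.
  rewrite (le_trans (rnorm_le_dist (g t) (g s)))// lerD2l rnormB.
  exact: le_trans (ltW gs) q1.
have h1 := Bb (f s - f t) (g s); have h2 := Bb (f t) (g s - g t).
rewrite (le_lt_trans (rnormD _ _))//.
have n1 := rnorm_ge0 (f t); have n2 := rnorm_ge0 (g t); have n3 := rnorm_ge0 (g s).
have n4 := rnorm_ge0 (f s - f t); have n5 := rnorm_ge0 (g s - g t).
have h3 : rnorm (f s - f t) * rnorm (g s) <= q * (rnorm (g t) + 1).
  by apply: ler_pM => //; exact: ltW.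
have h4 : rnorm (f t) * rnorm (g s - g t) <= rnorm (f t) * q.
  by rewrite ler_wpM2l// ltW.
have h5 : q * C < e.
  by have := mulr_gt0 q0 C0; move: qe; rewrite mulrnAr mulr2n; lra.
apply: le_lt_trans h5; rewrite /C; move: h1 h2 h3 h4; lra.
Qed.

(** Strong continuity together with the common Lipschitz constant 1 gives joint continuity. It
    serves both for [alpha] and for the translations [v]. *)
Lemma continuous_contractions (Y : topologicalType) (S : X -> E -> F)
    (f : Y -> X) (g : Y -> E) :
  (forall t x y, S t (x - y) = S t x - S t y) ->
  (forall t x, rnorm (S t x) <= rnorm x) ->
  (forall x, continuous (S^~ x)) ->
  continuous f -> continuous g -> continuous (fun y => S (f y) (g y)).
Proof.
move=> Sl Sb Sc fc /continuous_rnormP gc; apply/continuous_rnormP => y e e0.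
have e2 : 0 < e / 2 by rewrite divr_gt0.
have Sf : continuous (fun z => S (f z) (g y)).
  by move=> z; exact: (@continuous_comp _ _ _ f (S^~ (g y)) z (fc z) (Sc _ _)).
move/continuous_rnormP : Sf => /(_ y _ e2); have := gc y _ e2.
apply: filterS2 => z gz Sz.
rewrite (le_lt_trans (rnorm_tri (S (f z) (g y)) _ _))// (splitr e) ltrD//.
by rewrite -Sl (le_lt_trans (Sb _ _)).
Qed.

End joint_continuity.

Lemma bmul0r (K : numFieldType) (A : normedAlgType K) (x : A) : bmul 0 x = 0.
Proof. by have := bmulZl 0 (0 : A) x; rewrite !scale0r. Qed.

Lemma bmulr0 (K : numFieldType) (A : normedAlgType K) (x : A) : bmul x 0 = 0.
Proof. by have := bmulZr 0 x (0 : A); rewrite !scale0r. Qed.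

(** * Convolution *)

Section convolution.
Context (R : realType) (G : topologicalGroupType).
Variables (nu : {measure set (borel G) -> \bar R}) (A : banachAlgType R[i]).
Variable alpha : G -> A -> A.
Hypotheses (T2 : hausdorff_space G) (haar : left_haar nu)
  (iso : isometric_action alpha).

Let fin_compact := haar_compact haar.

Lemma Cc_supp (E : normedModType R[i]) (a : Cc G E) :
  cpt_supp (closure [set g | a g != 0]) a.
Proof.
have /asboolP[ac cK] : (a : G -> E) \in @Cc_pred R G E by exact: valP.
split => // x xK; apply/eqP/negP => ax; apply: xK; apply: subset_closure.
exact/negP.
Qed.

Lemma cpt_supp_Cc (E : normedModType R[i]) (K : set G) (f : G -> E) :
  cpt_supp K f -> f \in @Cc_pred R G E.
Proof.
move=> [fc cK f0]; apply/asboolP; split => //.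
have clK := compact_closed T2 cK.
apply: subclosed_compact cK _; first exact: closed_closure.
rewrite [X in _ `<=` X](closure_id _).1//; apply: closureS => x /= fx.
by apply: contrapT => /f0 fx0; rewrite fx0 eqxx in fx.
Qed.

Lemma action_continuous (Y : topologicalType) (f : Y -> G) (g : Y -> A) :
  continuous f -> continuous g -> continuous (fun y => alpha (f y) (g y)).
Proof.
have [al _ _ ac] := iso; apply: continuous_contractions => //.
- by move=> t x y; have [[lin _] _ _] := al t; exact: linear_sub.
- by move=> t x; have [_ _ h] := al t; rewrite -lecR !rnormE h.
Qed.

Lemma mulg_continuous_comp (Y : topologicalType) (f g : Y -> G) :
  continuous f -> continuous g -> continuous (fun y => (f y * g y)%g).
Proof.
move=> fc gc y; apply: (@continuous2_cvg _ _ _ _ _ _ f g (fun x y : G => (x * y)%g)).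
- exact: (@mulg_continuous G (f y, g y)).
- exact: fc.
- exact: gc.
Qed.

Lemma invg_continuous_comp (Y : topologicalType) (f : Y -> G) :
  continuous f -> continuous (fun y => (f y)^-1%g).
Proof. by move=> fc y; apply: continuous_comp; [exact: fc|exact: invg_continuous]. Qed.

Section integrand.
Variables a b : Cc G A.
Let Ka := closure [set g | a g != 0].
Let Kb := closure [set g | b g != 0].
Let Kab := [set (z.1 * z.2)%g | z in Ka `*` Kb].

Definition conv_integrand (g h : G) : A := bmul (a h) (alpha h (b (h^-1 * g)%g)).

Lemma conv_integrand_continuous :
  continuous (fun z : G * G => conv_integrand z.2 z.1).
Proof.
have [ac _ _] := Cc_supp a; have [bc _ _] := Cc_supp b.
apply: (@continuous_bilinear R _ A A A (@bmul _ A)).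
- by move=> x y z; rewrite bmulDl -[- y]scaleN1r bmulZl scaleN1r.
- by move=> x y z; rewrite bmulDr -[- z]scaleN1r bmulZr scaleN1r.
- by move=> x y; rewrite -lecR rmorphM/= !rnormE bnormM.
- by move=> z; exact: (@continuous_comp _ _ _ fst a z cvg_fst (ac _)).
apply: action_continuous => [z|]; first exact: cvg_fst.
move=> z; apply: (@continuous_comp _ _ _ (fun z : G * G => (z.1^-1 * z.2)%g) b); last exact: bc.
apply: mulg_continuous_comp => [|y]; last exact: cvg_snd.
by apply: invg_continuous_comp => y; exact: cvg_fst.
Qed.

Lemma action0 g : alpha g 0 = 0.
Proof. by have [/(_ g)[_ _ h] _ _ _] := iso; apply/normr0_eq0; rewrite h normr0. Qed.

Lemma conv_integrand_supp g h : conv_integrand g h != 0 -> Ka h /\ Kb (h^-1 * g)%g.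
Proof.
have [_ _ a0] := Cc_supp a; have [_ _ b0] := Cc_supp b.
move=> F0; split; apply: contrapT => nK; move: F0; rewrite /conv_integrand.
  by rewrite (a0 _ nK) bmul0r eqxx.
by rewrite (b0 _ nK) action0 bmulr0 eqxx.
Qed.

Lemma Kab_compact : compact Kab.
Proof.
have [_ cKa _] := Cc_supp a; have [_ cKb _] := Cc_supp b.
apply: continuous_compact; last exact: compact_setX.
apply: continuous_subspaceT => z; exact: mulg_continuous.
Qed.

(** In [h] the integrand is supported in [Ka] whatever [g] is, so the integral is continuous in [g];
    it vanishes off [Kab] because [g] is the product of [h] and [h^-1 * g]. *)
Lemma conv_integrandP :
  (forall g, cpt_supp Ka (conv_integrand g)) /\ cpt_supp Kab (convolution nu alpha a b).
Proof.
have [_ cKa _] := Cc_supp a.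
have cA : seq_complete A by exact: completeNormedModType_seq_complete.
have [H1 H2] := cpt_supp_bint T2 fin_compact cA cKa conv_integrand_continuous
  (fun g h nK => contrapT (fun F0 => nK (conv_integrand_supp (introN eqP F0)).1)).
split => //; split; [exact: H2|exact: Kab_compact|] => g gK.
apply/rnorm_le0; rewrite -(mul0r (fine (nu Ka))).
apply: (bint_bound T2 fin_compact cA (H1 g)) => h.
have [->|/conv_integrand_supp[Kh Kg]] := eqVneq (conv_integrand g h) 0; first by rewrite rnorm0.
by exfalso; apply: gK; exists (h, (h^-1 * g)%g) => //=; rewrite mulVKg.
Qed.

Lemma Cc_mulE : Cc_mul nu alpha a b = convolution nu alpha a b :> (G -> A).
Proof. by apply: insubdK; have [_ /cpt_supp_Cc] := conv_integrandP. Qed.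

End integrand.
End convolution.

(** * Integrated forms *)

Section integrated_form.
Context (R : realType) (G : topologicalGroupType).
Variables (nu : {measure set (borel G) -> \bar R}) (A : banachAlgType R[i]).
Variable alpha : G -> A -> A.
Hypotheses (T2 : hausdorff_space G) (haar : left_haar nu)
  (iso : isometric_action alpha).

Let fin_compact := haar_compact haar.

(** On the support, [a] is within 1 of its value at one of finitely many tags, so the sum of the
    norms at the tags plus 1 is a bound. *)
Lemma Cc_bounded (E : normedModType R[i]) (a : Cc G E) :
  exists2 M : R, 0 <= M & forall g, rnorm (a g) <= M.
Proof.
have [ac cK a0] := Cc_supp a; set K := closure _ in cK a0.
have [tag [ftag _] htag] := tagging_compact cK
  (P := fun c x => rnorm (a x - a c) < 1)
  (fun c => (proj1 (continuous_rnormP a) ac) c 1 ltr01).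
pose S := \sum_(c <- fset_set (range tag)) rnorm (a c).
have S0 : 0 <= S by apply: sumr_ge0 => c _; exact: rnorm_ge0.
exists (S + 1); first exact: addr_ge0.
move=> g; have [Kg|/a0 ->] := pselect (K g); last by rewrite rnorm0 addr_ge0.
rewrite (le_trans (rnorm_le_dist (a (tag g)) (a g)))// lerD//.
  rewrite /S (bigD1_seq (tag g)) ?fset_uniq//=.
    by rewrite lerDl; apply: sumr_ge0 => c _; exact: rnorm_ge0.
  by rewrite in_fset_set//; apply/mem_set; exists g.
by rewrite rnormB ltW// htag.
Qed.

Lemma cpt_supp_sub (E : normedModType R[i]) (K K' : set G) (f : G -> E) :
  K `<=` K' -> compact K' -> cpt_supp K f -> cpt_supp K' f.
Proof. by move=> KK' cK' [fc _ f0]; split => // x nK; apply: f0 => /KK'. Qed.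

Lemma bint_linear_image (E F : normedModType R[i]) (L : E -> F) (C : R)
    (K : set G) (f : G -> E) :
  seq_complete E -> seq_complete F -> linear L ->
  (forall x, rnorm (L x) <= C * rnorm x) -> cpt_supp K f ->
  bochner_integral nu (L \o f : borel G -> F) =
  L (bochner_integral nu (f : borel G -> E)).
Proof.
move=> cE cF lin LC fK.
pose L' : {linear E -> F} := HB.pack L (GRing.isLinear.Build R[i] E F *:%R L lin).
exact: (bint_bounded_linear T2 fin_compact (L := L') cE cF LC fK).
Qed.

Variables (E : normedModType R[i]) (v : G -> bop E) (pi : A -> bop E).
Hypotheses (cE : seq_complete E) (cov : covariant alpha v pi)
  (vi : forall g x, rnorm (v g x) = rnorm x) (pc : contractive pi).

Local Notation form := (integrated_form nu v pi).

Lemma rnorm_contractive c x : rnorm (pi c x) <= rnorm c * rnorm x.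
Proof.
rewrite (le_trans (le_opnorm _ _))// ler_wpM2r ?rnorm_ge0// -bop_rnorm.
by rewrite -lecR !rnormE pc.
Qed.

Let pi_linear : linear pi. Proof. by case: cov => [[[]]]. Qed.

Let pi_mul : {morph pi : a b / bmul a b}. Proof. by case: cov => [[[]]]. Qed.

Let v_sub g x y : v g (x - y) = v g x - v g y.
Proof. by have [l _] := bopP (v g); exact: linear_sub. Qed.

Let pi_sub c x y : pi c (x - y) = pi c x - pi c y.
Proof. by have [l _] := bopP (pi c); exact: linear_sub. Qed.

Lemma rep_continuous (X : topologicalType) (f : X -> A) (g : X -> E) :
  continuous f -> continuous g -> continuous (fun t => pi (f t) (g t)).
Proof.
apply: (@continuous_bilinear _ _ _ _ _ (fun c x => pi c x)) => //.
- by move=> a b x; rewrite linear_sub.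
- exact: rnorm_contractive.
Qed.

Lemma translation_continuous (X : topologicalType) (f : X -> G) (g : X -> E) :
  continuous f -> continuous g -> continuous (fun t => v (f t) (g t)).
Proof.
apply: (@continuous_contractions _ _ _ _ _ (fun g x => v g x)) => //.
- by move=> t x; rewrite vi.
- by case: cov.
Qed.

Lemma form_integrand_supp (a : Cc G A) x :
  cpt_supp (closure [set g | a g != 0]) (fun g => pi (a g) (v g x)).
Proof.
have [ac cK a0] := Cc_supp a; split => //.
  by apply: rep_continuous => //; apply: translation_continuous => y;
    [exact: cvg_id|exact: cvg_cst].
by move=> g /a0 ->; rewrite linear_zero.
Qed.

Lemma form_linear (a : Cc G A) : linear (form a).
Proof.
move=> k x y; rewrite /integrated_form.
rewrite -(bint_linear T2 fin_compact k cE (form_integrand_supp a x) (form_integrand_supp a y)).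
congr bochner_integral; apply/funext => g.
have [vl _] := bopP (v g); have [pl _] := bopP (pi (a g)).
by rewrite vl pl.
Qed.

(** [M] and [K] depend only on [a]: this is the uniformity that makes the supremum over all
    representations finite. *)
Lemma form_bound (a : Cc G A) (K : set G) (M : R) x :
  cpt_supp K a -> (forall g, rnorm (a g) <= M) ->
  rnorm (form a x) <= M * fine (nu K) * rnorm x.
Proof.
move=> aK aM; rewrite mulrAC.
have fK : cpt_supp K (fun g => pi (a g) (v g x)).
  have [fc _ _] := form_integrand_supp a x; have [_ cK a0] := aK.
  by split => // g /a0 ->; rewrite linear_zero.
apply: (bint_bound T2 fin_compact cE fK) => g.
by rewrite (le_trans (rnorm_contractive _ _))// vi ler_wpM2r ?rnorm_ge0.
Qed.

Lemma form_bounded (a : Cc G A) : form a \in @bounded_operator R E.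
Proof.
have [M M0 aM] := Cc_bounded a.
apply/asboolP; split; first exact: form_linear.
by exists (M * fine (nu (closure [set g | a g != 0]))) => x; apply: form_bound (Cc_supp a) aM.
Qed.

Definition form_bop (a : Cc G A) : bop E := Bop (form_bounded a).

Lemma form_linearl (k : R[i]) (a b : Cc G A) x :
  form (k *: a + b) x = k *: form a x + form b x.
Proof.
have [_ cKa _] := Cc_supp a; have [_ cKb _] := Cc_supp b.
have cK := compactU cKa cKb.
have fa := cpt_supp_sub (@subsetUl _ _ _) cK (form_integrand_supp a x).
have fb := cpt_supp_sub (@subsetUr _ _ _) cK (form_integrand_supp b x).
rewrite /integrated_form -(bint_linear T2 fin_compact k cE fa fb).
congr bochner_integral; apply/funext => g.
by have -> : (k *: a + b) g = k *: a g + b g by []; rewrite pi_linear.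
Qed.

(** [pi] moves inside the convolution, covariance factors the integrand, and Fubini exchanges the
    integrals. Translating [g] by [h] then isolates the integrand of [form b x], and the bounded
    operator [pi (a h)] after [v h] comes out of the integral. *)
Lemma form_mul (a b : Cc G A) x :
  form (Cc_mul nu alpha a b) x = form a (form b x).
Proof.
have cA : seq_complete A by exact: completeNormedModType_seq_complete.
have [ac cKa a0] := Cc_supp a; have [bc cKb b0] := Cc_supp b.
set Ka := closure _ in cKa a0; set Kb := closure _ in cKb b0.
pose Kab : set G := [set (z.1 * z.2)%g | z in Ka `*` Kb].
have [H1 H2] := conv_integrandP T2 haar iso a b.
have [_ v1 vM vc pv] := cov.
pose Phi h g := pi (conv_integrand alpha a b g h) (v g x).
(* Covariance produces [v h^-1] in front of [v g], and these combine into [v (h^-1 * g)]. *)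
have PhiE h g : Phi h g = pi (a h) (v h (pi (b (h^-1 * g)%g) (v (h^-1 * g)%g x))).
  by rewrite /Phi /conv_integrand pi_mul /= pv -vM.
have Phi_cont : continuous (fun z : G * G => Phi z.1 z.2).
  apply: rep_continuous.
    exact: conv_integrand_continuous.
  by apply: translation_continuous => z; [exact: cvg_snd|exact: cvg_cst].
have inner g : pi (Cc_mul nu alpha a b g) (v g x) =
    bochner_integral nu (fun h : borel G => Phi h g).
  rewrite (Cc_mulE T2 haar iso a b); apply/esym.
  apply: (bint_linear_image (L := fun c => pi c (v g x)) (C := rnorm x) cA cE) (H1 g).
    by move=> k c c'; rewrite pi_linear.
  by move=> c; rewrite (le_trans (rnorm_contractive _ _))// vi mulrC.
(* Fubini asks for one compact set for both variables: [h] ranges in [Ka] and [g] in [Kab]. *)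
pose K := Ka `|` Kab.
have cK : compact K by apply: compactU => //; case: H2.
have Phi0 h g : ~ (K h /\ K g) -> Phi h g = 0.
  move=> nK; rewrite /Phi; have [->|/(conv_integrand_supp iso)[Kh Kg]] :=
    eqVneq (conv_integrand alpha a b g h) 0; first by rewrite linear_zero.
  exfalso; apply: nK; split; first by left.
  by right; exists (h, (h^-1 * g)%g) => //=; rewrite mulVKg.
transitivity (bochner_integral nu (fun g : borel G =>
    bochner_integral nu (fun h : borel G => Phi h g))).
  by congr bochner_integral; apply/funext => g; exact: inner.
rewrite (bint_fubini T2 fin_compact cE cK Phi_cont Phi0).
congr bochner_integral; apply/funext => h.
pose Psi g := pi (b g) (v g x).
have PsiK : cpt_supp Kb Psi by exact: form_integrand_supp.
transitivity (bochner_integral nu (fun g : borel G => pi (a h) (v h (Psi (h^-1 * g)%g)))).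
  by congr bochner_integral; apply/funext => g; exact: PhiE.
have -> : form b x = bochner_integral nu (fun g : borel G => Psi (h^-1 * g)%g).
  exact/esym/(bint_mulgl T2 fin_compact (haar_inv haar) h cE PsiK).
apply: (bint_linear_image (L := fun y => pi (a h) (v h y))
  (C := rnorm (a h)) cE cE) (cpt_supp_mulgl h PsiK).
- have [pl _] := bopP (pi (a h)); have [vl _] := bopP (v h).
  by move=> k y y'; rewrite vl pl.
- by move=> y; rewrite (le_trans (rnorm_contractive _ _))// vi.
Qed.

End integrated_form.

(** * Extension to the completion *)

(** Product estimates are quadratic in [e], so they are linear only for [e <= 1]; for larger [e] the
    bound is trivial once the constant is at least [rnorm (x - y)]. *)
Lemma rnorm_eq_small (R : realType) (V : normedModType R[i]) (x y : V) (C : R) :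
  (forall e : R, 0 < e -> e <= 1 -> rnorm (x - y) <= e * C) -> x = y.
Proof.
move=> h; apply: (@rnorm_small_eq _ _ _ _ (Num.max C (rnorm (x - y)))) => e e0.
have C0 : 0 <= Num.max C (rnorm (x - y)) by rewrite le_max rnorm_ge0 orbT.
have [e1|/ltW e1] := leP e 1.
  by rewrite (le_trans (h e e0 e1))// ler_wpM2l ?(ltW e0)// le_max lexx.
by rewrite (@le_trans _ _ (Num.max C (rnorm (x - y))))// ?ler_peMl// le_max lexx orbT.
Qed.

Lemma opnorm_le (R : realType) (E : normedModType R[i]) (f : E -> E) (C : R) :
  0 <= C -> f 0 = 0 -> (forall x, rnorm (f x) <= C * rnorm x) -> opnorm f <= C.
Proof.
move=> C0 f0 fC; apply: ge_sup.
  by exists (rnorm (f 0)), 0 => //=; rewrite rnorm0.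
by move=> _ [x /= x1 <-]; rewrite (le_trans (fC x))// ler_piMr.
Qed.

(** The limit is taken pointwise. Letting one index tend to infinity in the Cauchy estimate gives a
    bound relative to [rnorm x] with a rank independent of [x], hence boundedness and convergence in
    norm. *)
Lemma bop_seq_complete (R : realType) (E : normedModType R[i]) :
  seq_complete E -> seq_complete (bop E).
Proof.
move=> cE u hu.
have uB m n x : u m x - u n x = (u m - u n) x by [].
have [f hf] : exists f : E -> E, forall x, (fun n => u n x) @ \oo --> f x.
  have /choice[f hf] x : exists l : E, (fun n => u n x) @ \oo --> l; last by exists f.
  apply: cE => e e0; have x1 : 0 < rnorm x + 1 by rewrite ltr_wpDl ?rnorm_ge0.
  have [k hk] := hu _ (divr_gt0 e0 x1); exists k => m n km kn.
  rewrite uB (le_lt_trans (le_opnorm _ _))// -bop_rnorm.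
  have [->|x0] := eqVneq (rnorm x) 0; first by rewrite mulr0.
  have xp : 0 < rnorm x by rewrite lt_neqAle eq_sym x0 rnorm_ge0.
  rewrite -ltr_pdivlMr// (lt_le_trans (hk m n km kn))//.
  by rewrite ler_pM2l// lef_pV2 ?posrE// lerDl.
have near_lim e : 0 < e -> exists k : nat, forall n, (k <= n)%N ->
    forall x, rnorm (u n x - f x) <= e * rnorm x.
  move=> e0; have [k hk] := hu e e0; exists k => n kn x.
  apply/ler_addgt0Pr => r r0.
  move/cvg_rnormP : (hf x) => /(_ r r0)[N _ hN].
  pose m := maxn k N.
  rewrite (le_trans (rnorm_tri (u m x) _ _))// lerD//; last first.
    by apply/ltW/hN => /=; exact: leq_maxr.
  rewrite uB (le_trans (le_opnorm _ _))// ler_wpM2r ?rnorm_ge0// -bop_rnorm ltW//.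
  by apply: hk => //; exact: leq_maxl.
have flin : linear f.
  move=> k x y; apply: (cvg_unique (@norm_hausdorff _ _) (hf (k *: x + y))).
  have : (fun n => k *: u n x + u n y) @ \oo --> k *: f x + f y.
    by apply: cvgD; [apply: cvgZr; exact: hf|exact: hf].
  apply: cvg_trans; apply: near_eq_cvg; apply: nearW => n.
  by have [-> _] := bopP (u n).
have fb : f \in @bounded_operator R E.
  apply/asboolP; split => //; have [k hk] := near_lim 1 ltr01.
  exists (1 + opnorm (u k)) => x; rewrite mulrDl.
  rewrite (le_trans (rnorm_le_dist (u k x) (f x)))// addrC lerD//; first exact: hk.
  exact: le_opnorm.
exists (Bop fb); apply/cvg_rnormP => e e0.
have [k hk] := near_lim (e / 2) (divr_gt0 e0 (ltr0Sn _ 1)).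
exists k => // n /= kn; rewrite bop_rnorm.
apply: (@le_lt_trans _ _ (e / 2)); last by rewrite ltr_pdivrMr// ltr_pMr// ltr1n.
apply: opnorm_le.
- by rewrite divr_ge0// ltW.
- by have [l _] := bopP (u n - Bop fb); exact: linear_zero.
- by move=> x; exact: hk.
Qed.

Lemma rnorm_bmul (R : realType) (A : normedAlgType R[i]) (a b : A) :
  rnorm (bmul a b) <= rnorm a * rnorm b.
Proof. by rewrite -lecR rmorphM/= !rnormE bnormM. Qed.

Lemma rnorm_bmulB (R : realType) (A : normedAlgType R[i]) (a b c d : A) :
  rnorm (bmul a b - bmul c d) <=
  rnorm (a - c) * rnorm b + rnorm c * rnorm (b - d).
Proof.
rewrite (le_trans (rnorm_tri (bmul c b) _ _))// lerD//.
  by have := rnorm_bmul (a - c) b; rewrite bmulDl -[- c]scaleN1r bmulZl !scaleN1r.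
by have := rnorm_bmul c (b - d); rewrite bmulDr -[- d]scaleN1r bmulZr !scaleN1r.
Qed.

(** The bound involves only [a] and [b]: the norm of [c] is at most [rnorm a + 1] since [e <= 1]. *)
Lemma rnorm_bmulB_small (R : realType) (A : normedAlgType R[i]) (a b c d : A) (e : R) :
  e <= 1 -> rnorm (a - c) <= e -> rnorm (b - d) <= e ->
  rnorm (bmul a b - bmul c d) <= e * (rnorm a + rnorm b + 1).
Proof.
move=> e1 ac bd; rewrite (le_trans (rnorm_bmulB _ _ _ _))//.
have e0 : 0 <= e by exact: le_trans (rnorm_ge0 _) ac.
have -> : rnorm a + rnorm b + 1 = rnorm b + (rnorm a + 1) by rewrite addrCA addrA.
rewrite mulrDr lerD//; first by rewrite ler_wpM2r ?rnorm_ge0.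
rewrite mulrC ler_pM ?rnorm_ge0// (le_trans (rnorm_le_dist a c))// lerD2l.
exact: le_trans e1.
Qed.

Lemma contractive_continuous (R : realType) (V W : normedModType R[i]) (f : V -> W) :
  linear f -> (forall x, rnorm (f x) <= rnorm x) -> continuous f.
Proof.
move=> lf fc; apply/continuous_rnormP => x e e0.
have /continuous_rnormP/(_ x e e0) : continuous (id : V -> V) by move=> y; exact: cvg_id.
by apply: filterS => y; apply: le_lt_trans; rewrite -linear_sub.
Qed.

Section completion_extension.
Variables (R : realType) (V : lmodType R[i]) (mul : V -> V -> V).
Variables (M : algebra_seminorm mul) (B : normedAlgType R[i]).
Let N := to_seminorm M.
Let A : banachAlgType R[i] := algebra_completion M.
Let iota : V -> A := to_completion N.
Variable T : V -> B.
Hypotheses (cB : seq_complete B) (Tl : linear T)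
  (TM : forall x y, T (mul x y) = bmul (T x) (T y)) (TN : forall x, rnorm (T x) <= M x).

Let iotaB x y : iota x - iota y = iota (x - y). Proof. by rewrite /iota linearB. Qed.
Let iotaE x : rnorm (iota x) = M x.
Proof. by rewrite [LHS]to_completion_norm /N to_seminormE. Qed.
Let iotaM x y : iota (mul x y) = bmul (iota x) (iota y). Proof. exact: to_completionM. Qed.

Let iota_approx (c : A) (e : R) : 0 < e -> exists x, rnorm (c - iota x) < e.
Proof. exact: to_completion_dense. Qed.

(* [l] is the limit of [T (u n)] for any [u] with [iota (u n)] tending to [c]; the
   estimate against every [x] makes the resulting map extend [T], linear and
   multiplicative. *)
Lemma completion_extension_exists (c : A) :
  exists l : B, forall x, rnorm (l - T x) <= rnorm (c - iota x).
Proof.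
have e0 n : 0 < n.+1%:R^-1 :> R by rewrite invr_gt0.
have /choice[u hu] n : exists x, rnorm (c - iota x) < n.+1%:R^-1 by exact: iota_approx.
have small (e : R) : 0 < e -> exists k : nat, forall n, (k <= n)%N -> n.+1%:R^-1 < e.
  move=> ep; have [K _ hK] := near_infty_natSinv_lt (PosNum ep).
  by exists K => n Kn; exact: hK.
have Tu m n : rnorm (T (u m) - T (u n)) <= m.+1%:R^-1 + n.+1%:R^-1.
  rewrite -linear_sub// (le_trans (TN _))// -iotaE -iotaB.
  rewrite (le_trans (rnorm_tri c _ _))// lerD//; last exact/ltW/hu.
  by rewrite rnormB; exact/ltW/hu.
have [e ep|l hl] := cB (u := fun n => T (u n)).
  have [k hk] := small (e / 2) (divr_gt0 ep (ltr0Sn _ 1)).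
  exists k => m n km kn; rewrite (le_lt_trans (Tu m n))// (splitr e).
  by rewrite ltrD ?hk.
exists l => x; apply/ler_addgt0Pr => e ep.
have e2 : 0 < e / 2 by rewrite divr_gt0.
have [k hk] := small _ e2; move/cvg_rnormP : hl => /(_ _ e2)[K _ hK].
pose n := maxn k K.
have h1 : rnorm (T (u n) - l) < e / 2 by apply: hK => /=; exact: leq_maxr.
have h2 : rnorm (c - iota (u n)) < e / 2.
  by apply: lt_trans (hu n) (hk n _); exact: leq_maxl.
have h3 : rnorm (T (u n) - T x) <= rnorm (iota (u n) - c) + rnorm (c - iota x).
  rewrite -linear_sub// (le_trans (TN _))// -iotaE -iotaB.
  exact: rnorm_tri.
have h4 := rnorm_tri (T (u n)) l (T x).
rewrite (le_trans h4)// rnormB (le_trans (lerD (ltW h1) h3))//.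
rewrite [leRHS]addrC [X in _ <= X + _](splitr e) -[leRHS]addrA !lerD2l lerD2r rnormB.
exact/ltW.
Qed.

Lemma completion_contraction_unique (E : normedModType R[i]) (f f' : A -> E) :
  linear f -> linear f' -> (forall c, rnorm (f c) <= rnorm c) ->
  (forall c, rnorm (f' c) <= rnorm c) ->
  (forall x, f (iota x) = f' (iota x)) -> f = f'.
Proof.
move=> lf lf' fc fc' ff'; apply/funext => c.
apply: (@rnorm_small_eq _ _ _ _ (1 + 1)) => e e0.
have [x /ltW hx] := iota_approx c e0.
rewrite (le_trans (rnorm_tri (f (iota x)) _ _))// mulrDr mulr1 lerD//.
  by rewrite -linear_sub// (le_trans (fc _)).
by rewrite ff' -linear_sub// (le_trans (fc' _))// rnormB.
Qed.

(** The estimate defining [rho] contains everything: [c = iota x] gives the extension property,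
    [x = 0] contractivity, and close approximants give linearity and multiplicativity. *)
Lemma completion_extension : exists rho : A -> B,
  [/\ homomorphism rho, forall c, rnorm (rho c) <= rnorm c & forall x, rho (iota x) = T x].
Proof.
have [rho hrho] := choice completion_extension_exists.
have rhoT x : rho (iota x) = T x.
  by apply/eqP; rewrite -subr_eq0; apply/eqP/rnorm_le0; rewrite (le_trans (hrho _ _))// subrr rnorm0.
have rho_le c : rnorm (rho c) <= rnorm c.
  by have := hrho c 0; rewrite linear_zero// subr0 /iota linear0 subr0.
exists rho; split => //; split.
  (* The error [e * (rnorm k + 1)] occurs twice: for the value at the combination and for the
     combination of the values. *)
  move=> k c c'; apply: (@rnorm_eq_small _ _ _ _ ((rnorm k + 1) *+ 2)) => e e0 e1.
  have [x hx] := iota_approx c e0; have [x' hx'] := iota_approx c' e0.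
  have H1 := le_trans (hrho c x) (ltW hx); have H2 := le_trans (hrho c' x') (ltW hx').
  have H3 := hrho (k *: c + c') (k *: x + x').
  rewrite (le_trans (rnorm_tri (T (k *: x + x')) _ _))// mulrnAr mulr2n lerD//.
    apply: (le_trans H3); rewrite /iota linearP opprD addrACA -scalerBr.
    rewrite (le_trans (rnormD _ _))// rnormZ mulrDr mulr1 lerD ?(ltW hx')//.
    by rewrite mulrC ler_wpM2r ?rnorm_ge0// ltW.
  rewrite rnormB Tl opprD addrACA -scalerBr (le_trans (rnormD _ _))// rnormZ.
  by rewrite mulrDr mulr1 lerD// mulrC ler_wpM2r ?rnorm_ge0.
move=> c c'.
apply: (@rnorm_eq_small _ _ _ _ ((rnorm c + rnorm c' + 1) *+ 2)) => e e0 e1.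
have [x hx] := iota_approx c e0; have [x' hx'] := iota_approx c' e0.
have H1 := le_trans (hrho c x) (ltW hx); have H2 := le_trans (hrho c' x') (ltW hx').
rewrite (le_trans (rnorm_tri (T (mul x x')) _ _))// mulrnAr mulr2n lerD//.
  by rewrite (le_trans (hrho _ _))// iotaM rnorm_bmulB_small// ltW.
rewrite TM rnormB (le_trans (rnorm_bmulB_small e1 H1 H2))//.
by rewrite ler_wpM2l ?(ltW e0)// lerD2r lerD ?rho_le.
Qed.

End completion_extension.

(** * The reduced norm *)

Lemma linear_add (K : pzRingType) (U V : lmodType K) (f : U -> V) x y :
  linear f -> f (x + y) = f x + f y.
Proof. by move=> lf; rewrite -[x in LHS]scale1r lf scale1r. Qed.

Lemma linear_scale (K : pzRingType) (U V : lmodType K) (f : U -> V) k x :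
  linear f -> f (k *: x) = k *: f x.
Proof. by move=> lf; rewrite -[X in f X]addr0 lf linear_zero// addr0. Qed.

(** Sets that are empty or unbounded above have [sup] equal to 0, so they satisfy the inequality as
    well. *)
Lemma sup_ge0 (R : realType) (S : set R) : (forall r, S r -> 0 <= r) -> 0 <= sup S.
Proof.
move=> S0; have [hS|/sup_out->//] := pselect (has_sup S).
have [[r Sr] _] := hS; apply: le_trans (S0 r Sr) _.
by apply: ub_le_sup => //; case: hS.
Qed.

Lemma sup_le_ub0 (R : realType) (S : set R) (C : R) :
  0 <= C -> (forall r, S r -> r <= C) -> sup S <= C.
Proof.
move=> C0 SC; have [S0|/set0P S0] := eqVneq S set0; first by rewrite S0 sup0.
exact: ge_sup.
Qed.

Section morphism_seminorm.
Variables (R : realType) (V : lmodType R[i]) (mul : V -> V -> V) (N : V -> R).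

Definition contractive_morphism (B : normedAlgType R[i]) (T : V -> B) : Prop :=
  [/\ linear T, forall x y, T (mul x y) = bmul (T x) (T y) &
      forall x, rnorm (T x) <= N x].

(** The second hypothesis says that [N] is recovered from the norms of contractive morphisms, so
    each axiom is inherited from the algebras [B]. A morphism sends the defect of associativity or
    bilinearity of [mul] to 0, hence [N] of the defect is 0. *)
Lemma morphism_algebra_seminorm : (forall x, 0 <= N x) ->
  (forall x (C : R), 0 <= C ->
    (forall (B : normedAlgType R[i]) (T : V -> B),
      contractive_morphism T -> rnorm (T x) <= C) -> N x <= C) ->
  is_algebra_seminorm mul N.
Proof.
move=> N0 NT.
have Neq0 x : (forall (B : normedAlgType R[i]) (T : V -> B), linear T ->
    (forall x y, T (mul x y) = bmul (T x) (T y)) -> T x = 0) -> N x = 0.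
  move=> h; apply/eqP; rewrite eq_le N0 andbT.
  by apply: NT => // B T [Tl Tm _]; rewrite (h _ T Tl Tm) rnorm0.
have NZ k x : N (k *: x) <= rnorm k * N x.
  apply: NT => [|B T [Tl _ TN]].
    by rewrite mulr_ge0// rnorm_ge0.
  by rewrite (linear_scale _ _ Tl) rnormZ ler_wpM2l// rnorm_ge0.
split.
- move=> x y; apply: NT => [|B T [Tl _ TN]].
    by rewrite addr_ge0.
  by rewrite (linear_add _ _ Tl) (le_trans (rnormD _ _))// lerD.
- move=> k x; apply/eqP; rewrite eq_le NZ/=.
  have [->|k0] := eqVneq k 0; first by rewrite rnorm0 mul0r.
  rewrite -[x in leLHS]scale1r -(mulVf k0) -scalerA.
  rewrite (le_trans (ler_wpM2l (rnorm_ge0 _) (NZ _ _)))// mulrA -rnormM mulfV//.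
  by rewrite (_ : rnorm 1 = 1) ?mul1r//; apply: complexI; rewrite rnormE normr1.
- split.
  + move=> x y; apply: NT => [|B T [_ Tm TN]].
      by rewrite mulr_ge0.
    by rewrite Tm (le_trans (rnorm_bmul _ _))// ler_pM ?rnorm_ge0.
  + move=> x y z; apply: Neq0 => B T Tl Tm.
    by rewrite (linear_sub _ _ Tl) !Tm bmulA subrr.
  + split.
    * move=> x y z; apply: Neq0 => B T Tl Tm.
      by rewrite (linear_sub _ _ Tl) (linear_add (mul _ _) _ Tl) !Tm (linear_add _ _ Tl) bmulDl subrr.
    * move=> x y z; apply: Neq0 => B T Tl Tm.
      by rewrite (linear_sub _ _ Tl) (linear_add (mul _ _) _ Tl) !Tm (linear_add _ _ Tl) bmulDr subrr.
    * move=> k x y; apply: Neq0 => B T Tl Tm.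
      by rewrite (linear_sub _ _ Tl) (linear_scale _ (mul _ _) Tl) !Tm (linear_scale _ _ Tl) bmulZl subrr.
    * move=> k x y; apply: Neq0 => B T Tl Tm.
      by rewrite (linear_sub _ _ Tl) (linear_scale _ (mul _ _) Tl) !Tm (linear_scale _ _ Tl) bmulZr subrr.
Qed.

End morphism_seminorm.

Section reduced_norm.
Variables (R : realType) (p : R) (p1 : 1 <= p) (G : topologicalGroupType).
Variables (nu : {measure set (borel G) -> \bar R}) (A : banachAlgType R[i]).
Variable alpha : G -> A -> A.
Hypotheses (T2 : hausdorff_space G) (lcG : locally_compact [set: G])
  (scG : @second_countable G) (haar : left_haar nu) (iso : isometric_action alpha).

Let mul := Cc_mul nu alpha.
Let N : Cc G A -> R := reduced_norm p1 nu alpha.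

(** [integrated_form] yields bare functions; [T] carries their boundedness, so that the norm and the
    product of [bop] become available. *)
Lemma regular_form d (X0 : measurableType d)
    (mu0 : {sigma_finite_measure set X0 -> \bar R})
    (v : G -> bop (Lp (nu \x mu0)%E p1)) (pi : A -> bop (Lp (nu \x mu0)%E p1)) :
  nondegenerate_contractive_regular alpha v pi ->
  exists T : Cc G A -> bop (Lp (nu \x mu0)%E p1),
  [/\ linear T, forall a b, T (mul a b) = bmul (T a) (T b),
      forall a, bop_fun (T a) = integrated_form nu v pi a &
      forall (a : Cc G A) K M, 0 <= M -> cpt_supp K a -> (forall g, rnorm (a g) <= M) ->
        rnorm (T a) <= M * fine (nu K)].
Proof.
move=> [pi0 [_ pi0c _ reg]].
have [cov _ _] := reg.
have cE := @Lp_complete _ _ _ (nu \x mu0)%E _ p1.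
have vi := regular_translation_isometry lcG scG haar reg.
have pc := regular_contractive T2 lcG scG haar iso pi0c reg.
exists (form_bop T2 haar cE cov vi pc); split => //.
- by move=> k a b; apply/val_inj/funext => x; exact: (form_linearl T2 haar cE cov vi pc).
- by move=> a b; apply/val_inj/funext => x; exact: (form_mul T2 haar iso cE cov vi pc).
- move=> a K M M0 Ka aM; rewrite bop_rnorm; apply: opnorm_le.
  + by rewrite mulr_ge0// fine_ge0.
  + exact/linear_zero/(form_linear T2 haar cE cov vi pc).
  + by move=> x; exact: (form_bound T2 haar cE cov vi pc).
Qed.

(** A [sup] dominates its set only when the set is bounded above; the bound from [M] and the support
    of [a] is common to all representations. *)
Lemma form_le_reduced_norm d (X0 : measurableType d)
    (mu0 : {sigma_finite_measure set X0 -> \bar R})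
    (v : G -> bop (Lp (nu \x mu0)%E p1)) (pi : A -> bop (Lp (nu \x mu0)%E p1)) a :
  nondegenerate_contractive_regular alpha v pi ->
  opnorm (integrated_form nu v pi a) <= N a.
Proof.
move=> reg; apply: ub_le_sup; last by exists d, X0, mu0, v, pi.
have [M M0 aM] := Cc_bounded a.
exists (M * fine (nu (closure [set g | a g != 0]))).
move=> _ [d' [Y [mu1 [w [rho [reg' ->]]]]]].
have [T [_ _ TE Tb]] := regular_form reg'.
by rewrite -TE -bop_rnorm Tb//; exact: Cc_supp.
Qed.

Lemma reduced_norm_le a (C : R) : 0 <= C ->
  (forall d (X0 : measurableType d) (mu0 : {sigma_finite_measure set X0 -> \bar R})
    (v : G -> bop (Lp (nu \x mu0)%E p1)) (pi : A -> bop (Lp (nu \x mu0)%E p1)),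
    nondegenerate_contractive_regular alpha v pi ->
    opnorm (integrated_form nu v pi a) <= C) ->
  N a <= C.
Proof.
move=> C0 h; apply: sup_le_ub0 => // _ [d [X0 [mu0 [v [pi [reg ->]]]]]].
exact: h.
Qed.

Lemma reduced_norm_ge0 a : 0 <= N a.
Proof.
apply: sup_ge0 => _ [d [X0 [mu0 [v [pi [reg ->]]]]]].
by have [T [_ _ <- _]] := regular_form reg; exact: opnorm_ge0.
Qed.

(** The integrated forms themselves are the contractive morphisms against which the seminorm is
    tested. *)
Lemma reduced_norm_algebra_seminorm : is_algebra_seminorm mul N.
Proof.
apply: morphism_algebra_seminorm; first exact: reduced_norm_ge0.
move=> a C C0 h; apply: reduced_norm_le => // d X0 mu0 v pi reg.
have [T [Tl Tm TE _]] := regular_form reg.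
rewrite -TE; apply: (h _ T); split=> // x.
by rewrite bop_rnorm TE; exact: form_le_reduced_norm.
Qed.

Lemma reduced_seminormE : reduced_seminorm p1 nu alpha = N :> (Cc G A -> R).
Proof. by rewrite /reduced_seminorm insubdK//; exact/asboolP/reduced_norm_algebra_seminorm. Qed.

Let F := reduced_crossed_product p1 nu alpha.
Let iota : Cc G A -> F := to_completion (to_seminorm (reduced_seminorm p1 nu alpha)).

Lemma contractive_rnormP (B C : normedAlgType R[i]) (f : B -> C) :
  (forall a, `|f a| <= `|a|) <-> (forall a, rnorm (f a) <= rnorm a).
Proof. by split => h a; have := h a; rewrite -!rnormE lecR. Qed.

Lemma integrated_extension d (X0 : measurableType d)
    (mu0 : {sigma_finite_measure set X0 -> \bar R})
    (v : G -> bop (Lp (nu \x mu0)%E p1)) (pi : A -> bop (Lp (nu \x mu0)%E p1)) :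
  nondegenerate_contractive_regular alpha v pi ->
  exists! rho : F -> bop (Lp (nu \x mu0)%E p1),
    [/\ representation rho, contractive rho &
        forall a xi, rho (iota a) xi = integrated_form nu v pi a xi].
Proof.
move=> reg; have [T [Tl Tm TE _]] := regular_form reg.
have [|a|rho [rhoh rhoc rhoT]] := completion_extension (M := reduced_seminorm p1 nu alpha)
  (bop_seq_complete (@Lp_complete _ _ _ (nu \x mu0)%E _ p1)) Tl.
- exact: Tm.
- by rewrite reduced_seminormE bop_rnorm TE form_le_reduced_norm.
exists rho; split.
  split.
  - by split=> //; apply: contractive_continuous => //; case: rhoh.
  - exact/contractive_rnormP.
  - by move=> a xi; rewrite rhoT TE.
move=> rho' [[[rhol' _] _] /contractive_rnormP rhoc' rhoT'].
have [rhol _] := rhoh.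
apply: (@completion_contraction_unique _ _ _ (reduced_seminorm p1 nu alpha)) => // a.
by apply/val_inj/funext => x; rewrite /= rhoT TE [RHS]rhoT'.
Qed.

End reduced_norm.

Section reduced_crossed_product.
Variables (R : realType) (p : R) (p1 : 1 <= p) (G : topologicalGroupType).
Variables (nu : {measure set (borel G) -> \bar R}) (A : banachAlgType R[i]).
Variable alpha : G -> A -> A.
Hypotheses (T2 : hausdorff_space G) (lcG : locally_compact [set: G])
  (scG : @second_countable G) (haar : left_haar nu) (iso : isometric_action alpha).

Let F := reduced_crossed_product p1 nu alpha.
Let iota : Cc G A -> F := to_completion (to_seminorm (reduced_seminorm p1 nu alpha)).

Let iota_norm a : rnorm (iota a) = reduced_norm p1 nu alpha a.
Proof. by rewrite [LHS]to_completion_norm to_seminormE reduced_seminormE. Qed.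

Let iota_approx (c : F) (e : R) : 0 < e -> exists x, rnorm (c - iota x) < e.
Proof. exact: to_completion_dense. Qed.

Lemma reduced_crossed_norm (a : F) :
  rnorm a = sup [set r | exists (d : measure_display)
          (X0 : measurableType d)
          (mu0 : {sigma_finite_measure set X0 -> \bar R})
          (v : G -> bop (Lp (nu \x mu0)%E p1))
          (pi : A -> bop (Lp (nu \x mu0)%E p1))
          (rho : F -> bop (Lp (nu \x mu0)%E p1)),
          [/\ nondegenerate_contractive_regular alpha v pi,
              [/\ representation rho, contractive rho &
                  forall b xi, rho (iota b) xi = integrated_form nu v pi b xi] &
              r = rnorm (rho a)]].
Proof.
set S := [set r | _].
have ubS r : S r -> r <= rnorm a.
  by move=> [d [X0 [mu0 [v [pi [rho [_ [_ /contractive_rnormP rhoc _] ->]]]]]]].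
have S0 : 0 <= sup S.
  by apply: sup_ge0 => _ [d [X0 [mu0 [v [pi [rho [_ _ ->]]]]]]]; exact: rnorm_ge0.
apply/eqP; rewrite eq_le (sup_le_ub0 (rnorm_ge0 _) ubS) andbT.
apply/ler_addgt0Pr => e e0; have e2 : 0 < e / 2 by rewrite divr_gt0.
have [x /ltW hx] := iota_approx a e2.
rewrite (le_trans (rnorm_le_dist (iota x) a))// (splitr e) addrA lerD//; last first.
  by rewrite rnormB.
rewrite iota_norm; apply: reduced_norm_le => [|d X0 mu0 v pi reg].
  by rewrite addr_ge0// ltW.
have [rho [[rhor rhoc rhoE] _]] := integrated_extension T2 lcG scG haar iso reg.
have -> : integrated_form nu v pi x = rho (iota x) by apply/funext => y; rewrite rhoE.
rewrite -bop_rnorm (le_trans (rnorm_le_dist (rho a) (rho (iota x))))// lerD//.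
  apply: ub_le_sup; first by exists (rnorm a) => r; exact: ubS.
  by exists d, X0, mu0, v, pi, rho.
have [[rhol _] _] := rhor; rewrite -(linear_sub _ _ rhol) (le_trans _ hx)//.
by have /contractive_rnormP := rhoc; exact.
Qed.

Lemma iota_dense : dense (range iota).
Proof.
move=> O [c Oc] oO.
have /nbhs_ballP[e e0 ceO] : nbhs c O by exact: open_nbhs_nbhs.
have er : (complex.Re e)%:C = e by rewrite RRe_real// gtr0_real.
have [|x hx] := iota_approx c (e := complex.Re e); first by rewrite -(ltcR 0) er.
exists (iota x); split; last by exists x.
by apply: ceO; rewrite -ball_normE /= -rnormE -er ltcR.
Qed.

End reduced_crossed_product.

Theorem theorem3p7 (R : realType) (p : R) (p1 : 1 <= p)
    (G : topologicalGroupType) (nu : {measure set (borel G) -> \bar R})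
    (A : banachAlgType R[i]) (alpha : G -> A -> A) :
  hausdorff_space G -> locally_compact [set: G] -> @second_countable G ->
  left_haar nu ->
  Lp_operator_algebra A p1 -> isometric_action alpha ->
  nondegenerately_sigma_finitely_representable A p1 ->
  exists iota : Cc G A -> reduced_crossed_product p1 nu alpha,
  [/\ linear iota /\ {morph iota : a b / Cc_mul nu alpha a b >-> bmul a b},
      forall (d : measure_display) (X0 : measurableType d)
        (mu0 : {sigma_finite_measure set X0 -> \bar R})
        (v : G -> bop (Lp (nu \x mu0)%E p1))
        (pi : A -> bop (Lp (nu \x mu0)%E p1)),
        nondegenerate_contractive_regular alpha v pi ->
        exists! rho : reduced_crossed_product p1 nu alpha ->
                      bop (Lp (nu \x mu0)%E p1),
        [/\ representation rho, contractive rho &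
            forall a xi, rho (iota a) xi = integrated_form nu v pi a xi],
      forall a : reduced_crossed_product p1 nu alpha,
        rnorm a = sup [set r | exists (d : measure_display)
          (X0 : measurableType d)
          (mu0 : {sigma_finite_measure set X0 -> \bar R})
          (v : G -> bop (Lp (nu \x mu0)%E p1))
          (pi : A -> bop (Lp (nu \x mu0)%E p1))
          (rho : reduced_crossed_product p1 nu alpha ->
                 bop (Lp (nu \x mu0)%E p1)),
          [/\ nondegenerate_contractive_regular alpha v pi,
              [/\ representation rho, contractive rho &
                  forall b xi, rho (iota b) xi = integrated_form nu v pi b xi] &
              r = rnorm (rho a)]] &
      dense (range iota)].
Proof.
move=> T2 lcG scG haar _ iso _.
exists (to_completion (to_seminorm (reduced_seminorm p1 nu alpha))); split.
- by split; [exact: linearP|exact: to_completionM].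
- by move=> d X0 mu0 v pi; exact: integrated_extension.
- exact: reduced_crossed_norm.
- exact: iota_dense.
Qed.
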